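(* The configuration space $\mathcal S$ of maxtame subsets of $S^1$ is homeomorphic to the infinite sphere $S^\infty$.
   Context: A finite subset of $\mathbb R^2$ is balanced if its convex hull contains the origin. A subset of the unit circle $S^1\subset\mathbb R^2$ is $2$-tame if it has no balanced non-empty subset with at most two points (equivalently, it contains no pair of antipodal points). A subset $U\subseteq S^1$ is maxtame if it is open, $2$-tame, has finitely many connected components, and is maximal under inclusion amongst all open $2$-tame subsets of $S^1$. The boundary $\partial U$ of a maxtame set $U\subset S^1$ consists of an odd number of distinct pairs of antipodal points, and for each choice of an odd number of distinct antipodal pairs there are exactly two maxtame sets with that boundary. Configuration space of odd numbers of points on $\mathbb{RP}^1$: for odd $\ell\ge1$ let $C_\ell$ be the quotient space of $(\mathbb{RP}^1)^\ell$ (with $\mathbb{RP}^1=[0,1]/\{0\sim 1\}$) by the equivalence relation generated by the permutation action of the symmetric group on the coordinates together with $(x_1,\dots,x_\ell)\sim(y_1,\dots,y_\ell)$ whenever there are indices $i\neq j$ with $x_i=x_j$, $y_i=y_j$, and $x_k=y_k$ for all $k\ne i,j$ (so coinciding pairs of points are cancelled, and an element of $C_\ell$ is a finite subset of $\mathbb{RP}^1$ of odd cardinality at most $\ell$). There are inclusions $C_\ell\subset C_{\ell+2}$ given by adjoining a cancelling pair, and $C=\bigcup_{\ell\ \mathrm{odd}}C_\ell$ carries the direct limit topology. $\mathcal S$ is the set of all maxtame subsets of $S^1$, regarded as a space via the map $\mathcal S\to C$ sending $U$ to the image of $\partial U$ under the double cover $S^1\to\mathbb{RP}^1$: it is topologized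 so that this map is a connected double covering of $C$. The space $S^\infty=\bigcup_k S^k$ carries the direct limit topology. *)

(* Defs.v *)
From HB Require Import structures.
From Stdlib Require Relation_Operators.
From mathcomp Require Import all_boot all_order all_algebra perm generic_quotient.
From mathcomp Require Import all_classical all_reals all_analysis.

Set Implicit Arguments.
Unset Strict Implicit.
Unset Printing Implicit Defensive.

Import Order.TTheory GRing.Theory Num.Theory.
Import numFieldNormedType.Exports.

Local Open Scope classical_set_scope.
Local Open Scope ring_scope.
Local Open Scope quotient_scope.

Notation generated := (@Relation_Operators.clos_refl_sym_trans _).

Section Quotient.
Context {T : topologicalType} (r : T -> T -> Prop).

Let gen_rel : rel T := fun x y => `[< generated r x y >].

Local Lemma gen_refl : reflexive gen_rel.
Proof. by move=> x; apply/asboolP; exact: Relation_Operators.rst_refl. Qed.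

Local Lemma gen_sym : symmetric gen_rel.
Proof.
by move=> x y; apply/asboolP/asboolP; exact: Relation_Operators.rst_sym.
Qed.

Local Lemma gen_trans : transitive gen_rel.
Proof.
move=> y x z /asboolP xy /asboolP yz; apply/asboolP.
exact: Relation_Operators.rst_trans xy yz.
Qed.

Definition gen_equiv := EquivRel gen_rel gen_refl gen_sym gen_trans.

Definition quot_space := {eq_quot gen_equiv}.

HB.instance Definition _ :=
  Topological.copy quot_space (quotient_topology quot_space).
HB.instance Definition _ := Quotient.on quot_space.

Definition quot_proj : T -> quot_space := \pi_quot_space.

Lemma quot_projP x y : quot_proj x = quot_proj y <-> generated r x y.
Proof. by split=> [/eqmodP/asboolP | xy]; last apply/eqmodP/asboolP. Qed.

Lemma quot_proj_repr c : quot_proj (repr c) = c.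
Proof. exact: reprK. Qed.

Lemma quot_open (U : set quot_space) : open U <-> open (quot_proj @^-1` U).
Proof. by []. Qed.

End Quotient.

Section DirectLimit.
Context (X : nat -> topologicalType) (f : forall k, X k -> X k.+1).

Definition dirlim_step (a b : {k & X k}) : Prop :=
  b = existT X (projT1 a).+1 (f (projT2 a)).

Definition dirlim : topologicalType := quot_space dirlim_step.

Definition dirlim_inj k (x : X k) : dirlim :=
  quot_proj dirlim_step (existT X k x).

End DirectLimit.

Definition topology_on (X : Type) : Type := Topological.axioms_ X.

Definition with_topology (X : Type) (tau : topology_on X) : topologicalType :=
  Topological.Pack tau.

Definition homeomorphic (X Y : topologicalType) : Prop :=
  exists (f : X -> Y) (g : Y -> X),
    [/\ cancel f g, cancel g f, continuous f & continuous g].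

Definition maps_homeomorphically (X Y : topologicalType) (f : X -> Y)
    (A : set X) (B : set Y) : Prop :=
  exists g : Y -> X,
    [/\ f @` A `<=` B, g @` B `<=` A,
        {in A, cancel f g} /\ {in B, cancel g f},
        {within A, continuous f} & {within B, continuous g}].

Definition double_covering (E B : topologicalType) (p : E -> B) : Prop :=
  forall b : B, exists2 V : set B, open V /\ V b &
    exists A1 A2 : set E,
      [/\ open A1 /\ open A2, A1 `&` A2 = set0, p @^-1` V = A1 `|` A2,
          maps_homeomorphically p A1 V & maps_homeomorphically p A2 V].

Definition connected_double_covering (E B : topologicalType) (p : E -> B) :
    Prop :=
  double_covering p /\ connected [set: E].

Section Spheres.
Variable R : realType.

Definition sphere (k : nat) : topologicalType :=
  [set x : 'rV[R]_k.+1 | \sum_i x ord0 i ^+ 2 = 1].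

Definition append0 k (x : 'rV[R]_k.+1) : 'rV[R]_k.+2 :=
  \row_i (if insub (val i) is Some j then x ord0 j else 0).

Lemma append0_sphere k (x : sphere k) :
  \sum_i append0 (set_val x) ord0 i ^+ 2 = 1.
Proof.
rewrite big_ord_recr /= mxE insubN ?ltnn// expr0n addr0.
have x1 : \sum_i set_val x ord0 i ^+ 2 = 1 := set_valP x.
rewrite -[RHS]x1; apply: eq_bigr => i _.
by rewrite mxE /= valK.
Qed.

Definition sphere_incl k (x : sphere k) : sphere k.+1 :=
  SigSub (mem_set (append0_sphere x)).

Definition sphere_infty : topologicalType := dirlim sphere_incl.

End Spheres.

Section Maxtame.
Variable R : realType.

Notation S1 := (sphere R 1).

Definition convex_hull (A : set 'rV[R]_2) : set 'rV[R]_2 :=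
  smallest (@convex_set R 'rV[R]_2) A.

Definition balanced (A : set 'rV[R]_2) : Prop := convex_hull A 0.

Definition two_tame (U : set S1) : Prop :=
  forall A : set S1, A `<=` U -> A !=set0 -> (A #<= `I_2)%card ->
    ~ balanced (set_val @` A).

Definition boundary (T : topologicalType) (U : set T) : set T :=
  closure U `\` interior U.

Definition maxtame (U : set S1) : Prop :=
  [/\ open U, two_tame U, finite_set (connected_component U @` U) &
      forall V : set S1, open V -> two_tame V -> U `<=` V -> V = U].

Definition maxtames : Type := {U : set S1 | maxtame U}.

End Maxtame.

Section Configurations.
Variable R : realType.

Notation S1 := (sphere R 1).

Definition unit_itv : topologicalType := [set t : R | 0 <= t <= 1].

Definition RP1 : topologicalType :=
  quot_space (fun s t : unit_itv => set_val s = 0 /\ set_val t = 1).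

Definition RP1_pt (t : unit_itv) : RP1 := quot_proj _ t.

Lemma unit_itv0 : [set t : R | 0 <= t <= 1] 0.
Proof. by rewrite /= lexx ler01. Qed.

Definition RP1_base : RP1 := RP1_pt (SigSub (mem_set unit_itv0)).

Definition arc_pt (t : unit_itv) : 'rV[R]_2 :=
  \row_i (if i == 0 then cos (pi * set_val t) else sin (pi * set_val t)).

(* The double cover of the projective line by the circle, sending both
   exp(i pi t) and - exp(i pi t) to the class of t. *)
Definition circle_to_RP1 (z : S1) : RP1 :=
  xget RP1_base
    [set RP1_pt t | t in [set t | set_val z = arc_pt t \/
                                  set_val z = - arc_pt t]].

Definition same_config (l : nat) (x y : {ptws 'I_l -> RP1}) : Prop :=
  (exists s : 'S_l, forall i, y i = x (s i)) \/
  (exists i j : 'I_l, [/\ i != j, x i = x j, y i = y j &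
     forall k, k != i -> k != j -> x k = y k]).

(* [Cfin k] is C_l for the odd number l = 2k+1. *)
Definition Cfin (k : nat) : topologicalType :=
  quot_space (@same_config k.*2.+1).

Definition Cfin_class k (x : 'I_k.*2.+1 -> RP1) : Cfin k :=
  quot_proj (@same_config k.*2.+1) x.

Definition adjoin_pair l (x : 'I_l -> RP1) (b : RP1) : 'I_l.+2 -> RP1 :=
  fun i => if insub (val i) is Some j then x j else b.

(* By [Cfin_inclE], the choice of the representative and of the cancelling
   pair is immaterial. *)
Definition Cfin_incl k (c : Cfin k) : Cfin k.+1 :=
  @Cfin_class k.+1 (adjoin_pair (repr c) RP1_base).

Definition Cinf : topologicalType := dirlim Cfin_incl.

Definition Cinf_class k (x : 'I_k.*2.+1 -> RP1) : Cinf :=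
  dirlim_inj Cfin_incl (Cfin_class x).

(* The point of [Cinf] given by a finite set [A] of odd cardinality; see
   [Cinf_of_setE].  The default value is never used for the boundary of a
   maxtame set, which is a nonempty finite union of antipodal pairs, odd in
   number. *)
Definition Cinf_of_set (A : set RP1) : Cinf :=
  xget (@Cinf_class 0 (fun=> RP1_base))
    [set c | exists k (x : 'I_k.*2.+1 -> RP1),
       [/\ injective x, range x = A & c = Cinf_class x]].

Definition boundary_config (U : maxtames R) : Cinf :=
  Cinf_of_set (circle_to_RP1 @` boundary (proj1_sig U)).

End Configurations.

Section WellDefined.
Variable R : realType.

Lemma sin_pi_ends (t : unit_itv R) :
  sin (pi * set_val t) = 0 -> set_val t = 0 \/ set_val t = 1.
Proof.
have /andP[t0 t1] : 0 <= set_val t <= 1 := set_valP t.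
move: t0; rewrite le_eqVlt => /orP[/eqP<- _|t0]; first by left.
move: t1; rewrite le_eqVlt => /orP[/eqP-> _|t1]; first by right.
have : 0 < sin (pi * set_val t).
  by apply: sin_gt0_pi; rewrite mulr_gt0 ?pi_gt0//= gtr_pMr ?pi_gt0.
by move=> /[swap] ->; rewrite ltxx.
Qed.

Lemma RP1_pt_ends (s t : unit_itv R) :
  set_val s = 0 \/ set_val s = 1 -> set_val t = 0 \/ set_val t = 1 ->
  RP1_pt s = RP1_pt t.
Proof.
move=> [s0|s1] [t0|t1].
- by congr RP1_pt; apply: val_inj; exact: etrans s0 (esym t0).
- by apply/quot_projP; exact: Relation_Operators.rst_step.
- by apply/quot_projP/Relation_Operators.rst_sym/Relation_Operators.rst_step.
- by congr RP1_pt; apply: val_inj; exact: etrans s1 (esym t1).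
Qed.

Lemma arc_ptE (t : unit_itv R) :
  arc_pt t ord0 ord0 = cos (pi * set_val t) /\
  arc_pt t ord0 ord_max = sin (pi * set_val t).
Proof. by rewrite !mxE. Qed.

Lemma pi_itv (t : unit_itv R) : pi * set_val t \in `[0, pi].
Proof.
have /andP[t0 t1] : 0 <= set_val t <= 1 := set_valP t.
by rewrite in_itv/= mulr_ge0 ?pi_ge0//= ger_pMr ?pi_gt0.
Qed.

Lemma arc_pt_inj (s t : unit_itv R) : arc_pt s = arc_pt t -> s = t.
Proof.
move=> st; have [cs _] := arc_ptE s; have [ct _] := arc_ptE t.
move: cs; rewrite st ct => /(cos_inj (pi_itv _) (pi_itv _)).
by move=> /(mulfI (lt0r_neq0 (pi_gt0 R))) ts; apply: val_inj.
Qed.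

Lemma arc_pt_opp (s t : unit_itv R) :
  arc_pt s = - arc_pt t -> RP1_pt s = RP1_pt t.
Proof.
move=> st; have [_ ss] := arc_ptE s; have [_ tt] := arc_ptE t.
have sge0 (u : unit_itv R) : 0 <= sin (pi * set_val u).
  by apply: sin_ge0_pi; have := pi_itv u; rewrite in_itv.
have eq_sin : sin (pi * set_val s) = - sin (pi * set_val t).
  by rewrite -ss -tt st mxE.
have t0 : sin (pi * set_val t) = 0.
  by apply/eqP; rewrite eq_le sge0 -oppr_ge0 -eq_sin sge0.
by apply: RP1_pt_ends; apply: sin_pi_ends; rewrite ?eq_sin t0 ?oppr0.
Qed.

Lemma circle_to_RP1E (z : sphere R 1) (t : unit_itv R) :
  set_val z = arc_pt t \/ set_val z = - arc_pt t ->
  circle_to_RP1 z = RP1_pt t.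
Proof.
move=> zt; rewrite /circle_to_RP1; case: xgetP => [_ -> [s /= zs <-]|]; last first.
  by move=> /(_ (RP1_pt t))/=; case; exists t.
case: zs zt => -> [].
- by move=> /arc_pt_inj ->.
- exact: arc_pt_opp.
- by move=> /(congr1 -%R); rewrite opprK => /arc_pt_opp.
- by move=> /oppr_inj/arc_pt_inj ->.
Qed.

Lemma adjoin_pair_base l (x : 'I_l -> RP1 R) (b b' : RP1 R) :
  same_config (adjoin_pair x b) (adjoin_pair x b').
Proof.
right; exists (inord l), (inord l.+1).
have out (i : nat) : (l <= i)%N -> insub i = None :> option 'I_l.
  by move=> li; rewrite insubN// -leqNgt.
have v0 : val (inord l : 'I_l.+2) = l by exact: inordK.
have v1 : val (inord l.+1 : 'I_l.+2) = l.+1 by exact: inordK.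
rewrite /adjoin_pair; split; rewrite ?v0 ?v1 ?out//.
  by apply/eqP => /(congr1 val); rewrite v0 v1 => /n_Sn.
move=> k kl kl1; suff kltl : (k < l)%N by rewrite insubT.
have := ltn_ord k; rewrite ltnS leq_eqVlt => /orP[/eqP kE|].
  by case/eqP: kl1; apply: val_inj; rewrite v1.
rewrite ltnS leq_eqVlt => /orP[/eqP kE|//].
by case/eqP: kl; apply: val_inj; rewrite v0.
Qed.

Lemma same_config_adjoin l (x y : {ptws 'I_l -> RP1 R}) (b : RP1 R) :
  same_config x y -> same_config (adjoin_pair x b) (adjoin_pair y b).
Proof.
have le_l : (l <= l.+2)%N by rewrite leqW.
case=> [[s xy]|[i [j [ij xij yij xy]]]]; last first.
  right; exists (widen_ord le_l i), (widen_ord le_l j).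
  rewrite /adjoin_pair/= !valK; split=> //.
  move=> k ki kj; case: insubP => //= k' _ k'k; apply: xy.
    by apply: contra ki => /eqP<-; apply/eqP/val_inj.
  by apply: contra kj => /eqP<-; apply/eqP/val_inj.
left; pose g (i : 'I_l.+2) : 'I_l.+2 :=
  if insub (val i) is Some j then widen_ord le_l (s j) else i.
have g_inj : injective g.
  move=> i j; rewrite /g; case: insubP => [i' _ i'i|il];
    case: insubP => [j' _ j'j|jl].
  - move=> /(congr1 val)/= /val_inj/perm_inj i'j'.
    by apply: val_inj; rewrite -i'i -j'j i'j'.
  - by move=> ij; case/negP: jl; rewrite -ij /=.
  - by move=> ij; case/negP: il; rewrite ij /=.
  - by [].
exists (perm g_inj) => i; rewrite permE /g /adjoin_pair.
by case: insubP => [i' _ i'i|il]; rewrite ?valK ?xy// insubN.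
Qed.

Lemma generated_adjoin l (x y : {ptws 'I_l -> RP1 R}) (b : RP1 R) :
  generated (@same_config R l) x y ->
  generated (@same_config R l.+2) (adjoin_pair x b) (adjoin_pair y b).
Proof.
elim=> {x y} [x y xy|x|x y _|x y z _ xy _ yz].
- by apply: Relation_Operators.rst_step; exact: same_config_adjoin.
- exact: Relation_Operators.rst_refl.
- exact: Relation_Operators.rst_sym.
- exact: Relation_Operators.rst_trans xy yz.
Qed.

Lemma Cfin_inclE k (x : 'I_k.*2.+1 -> RP1 R) (b : RP1 R) :
  Cfin_incl (Cfin_class x) = @Cfin_class R k.+1 (adjoin_pair x b).
Proof.
apply/quot_projP; apply: Relation_Operators.rst_trans.
  apply: generated_adjoin; apply/quot_projP; exact: quot_proj_repr.
by apply: Relation_Operators.rst_step; exact: adjoin_pair_base.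
Qed.

Lemma Cinf_of_setE k (x : 'I_k.*2.+1 -> RP1 R) :
  injective x -> Cinf_of_set (range x) = Cinf_class x.
Proof.
move=> x_inj; rewrite /Cinf_of_set; case: xgetP => [_ -> [m [y [y_inj yx ->]]]|].
  have factor m1 m2 (u : 'I_m1 -> RP1 R) (v : 'I_m2 -> RP1 R) :
      injective u -> range u = range v ->
      exists2 g : 'I_m1 -> 'I_m2, injective g & forall i, u i = v (g i).
    move=> u_inj uv.
    have /choice[g gE] : forall i, exists j, u i = v j.
      move=> i; have : range u (u i) by exists i.
      by rewrite uv => -[j _ <-]; exists j.
    by exists g => // i j gij; apply: u_inj; rewrite !gE gij.
  have [g g_inj yE] := factor _ _ _ _ y_inj yx.
  have [h h_inj xE] := factor _ _ _ _ x_inj (esym yx).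
  have mk : m = k.
    apply: double_inj; apply/eqP; rewrite eqn_leq -ltnS -[X in _ && X]ltnS.
    by have := leq_card _ g_inj; have := leq_card _ h_inj; rewrite !card_ord => -> ->.
  subst m; congr dirlim_inj; apply/quot_projP.
  apply/Relation_Operators.rst_sym/Relation_Operators.rst_step.
  by left; exists (perm g_inj) => i; rewrite permE yE.
by move=> /(_ (Cinf_class x))/=; case; exists k, x.
Qed.

End WellDefined.

(* Main.v *)
(** A maxtame set is determined by a sign and its boundary, hence by a function with values
+1 and -1 on [0, 1] having finitely many jumps. For the functions with at most [n] jumps, the
vector of the moments 0, ..., n meets every ray from the origin exactly once (Markov's L-problem):
it is the maximiser of the pairing with the polynomial of degree at most [n] whose sign it is, so
the moment vectors form the boundary of a strictly convex and smooth body. In particular the next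
moment is a continuous homogeneous function of the preceding ones. Subtracting from each moment
the value so predicted gives coordinates that vanish beyond [n] on the functions with at most [n]
jumps; after normalisation these coordinates identify the functions with at most [n] jumps with
the sphere of dimension [n], compatibly for all [n] and with antipodes corresponding to a change
of sign. Forgetting the sign, the infinite sphere becomes a double covering of the space of
configurations. Since each sphere is contractible in the next one, this covering lifts to every
double covering, and it is the only connected one. *)

From Stdlib Require Relation_Operators.
Require Import Defs.
From mathcomp Require Import all_boot all_order all_algebra perm generic_quotient.
From mathcomp Require Import all_classical all_reals all_analysis.
From mathcomp Require Import zify ring lra.

Set Implicit Arguments.
Unset Strict Implicit.
Unset Printing Implicit Defensive.

Import Order.TTheory GRing.Theory Num.Theory.
Import numFieldNormedType.Exports.

Local Open Scope classical_set_scope.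
Local Open Scope ring_scope.

(** * Step functions and their signed primitives *)

(** Uniqueness on rays leaves two facts open: that every ray is met, and that the predicted moment
    is continuous. The first is obtained without degree theory, by maximising a linear form over the
    polar body of the compact set of moment vectors. The second is compactness again: bounded
    multiples of moment vectors form the image of a compact space under a closed map. To have such
    compact spaces at hand, jumps are kept as arbitrary tuples in a cube, in any order, with
    repetitions and with jumps at the endpoints, and integrals are replaced by an explicit primitive
    that is continuous in the jumps. Jumps at 0 and 1 are invisible inside the interval apart from a
    global sign. Hence a configuration is read off from the parities of its interior jumps, and the
    base point of the projective line from the oddness of the total number. On the maxtame side only
    the two-point fibres over the configurations matter: a topology can be transported through any
    fibrewise bijection with the sphere, and the classification applies to every connected double
    covering. *)

Section SignedPrimitive.
Variable R : realType.
Implicit Types (f : R -> R) (ts : seq R) (x y t : R).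

(* [flip P ts y] is the integral over [0, y] of [P'] times the step function
   [x |-> prod_(t <- ts) sg (x - t)].  In this recursive form it is visibly
   continuous in the jumps, whatever their order. *)
Fixpoint flip f ts y : R :=
  if ts is t :: ts' then flip f ts' y - 2 * flip f ts' (Num.min t y) else f y.

Definition root_prod ts x : R := \prod_(t <- ts) (x - t).

Lemma flip_continuous (X : topologicalType) (I : Type) f (a : I -> X -> R)
    (s : seq I) (y : X -> R) :
  continuous f -> (forall i, continuous (a i)) -> continuous y ->
  continuous (fun z : X => flip f [seq a i z | i <- s] (y z)).
Proof.
move=> cf ca; elim: s y => [|i s ih] y cy x /=.
  by apply: continuous_comp; [exact: cy|exact: cf].
apply: cvgB; first exact: ih.
apply: cvgM; first exact: cvg_cst.
apply: (ih (fun z : X => Num.min (a i z) (y z))) => z.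
by apply: continuous_min; [exact: ca|exact: cy].
Qed.

Lemma flip_id_continuous f ts : continuous f -> continuous (flip f ts).
Proof.
move=> cf; have := @flip_continuous R R f (fun t _ => t) ts id cf.
rewrite map_id; apply => [t y|y]; [exact: cvg_cst|exact: cvg_id].
Qed.

Lemma flip_lin f g (c : R) ts y :
  flip (fun x => f x + c * g x) ts y = flip f ts y + c * flip g ts y.
Proof. by elim: ts y => [//|t ts ih] y /=; rewrite !ih; ring. Qed.

Lemma eq_flip f g ts y : f =1 g -> flip f ts y = flip g ts y.
Proof. by move=> fg; elim: ts y => [|t ts ih] y /=; rewrite ?fg ?ih. Qed.

Lemma flip_sum (I : Type) (s : seq I) (c : I -> R) (f : I -> R -> R) ts y :
  flip (fun x => \sum_(i <- s) c i * f i x) ts y = \sum_(i <- s) c i * flip (f i) ts y.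
Proof.
elim: s => [|i s ih].
  rewrite big_nil; elim: ts y => [|t ts iht] y /=; first by rewrite big_nil.
  by rewrite !iht; ring.
rewrite big_cons -ih addrC -flip_lin; apply: eq_flip => x.
by rewrite big_cons addrC.
Qed.

Lemma flip0 f ts : f 0 = 0 -> all (>= 0) ts -> flip f ts 0 = 0.
Proof.
move=> f0; elim: ts => [//|t ts ih] /= /andP[t0 /ih h].
by rewrite (min_idPr t0) h; ring.
Qed.

Lemma flip_cons0 f ts y : f 0 = 0 -> all (>= 0) ts -> 0 <= y ->
  flip f (0 :: ts) y = flip f ts y.
Proof. by move=> f0 ts0 y0; rewrite /= (min_idPl y0) flip0//; ring. Qed.

Lemma flip_cons1 f ts : flip f (1 :: ts) 1 = - flip f ts 1.
Proof. by rewrite /= minxx; ring. Qed.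

Lemma root_prod_cons t ts x : root_prod (t :: ts) x = (x - t) * root_prod ts x.
Proof. by rewrite /root_prod big_cons. Qed.

Lemma root_prod_eq0 ts x : (root_prod ts x == 0) = (x \in ts).
Proof.
elim: ts => [|t ts ih]; first by rewrite /root_prod big_nil oner_eq0.
by rewrite root_prod_cons mulf_eq0 ih subr_eq0 inE.
Qed.

(** To the right of a jump the subtracted term of [flip] is constant; to the left it is twice the
    function itself, so the derivative changes sign there. *)
Lemma flip_derive (P : {poly R}) ts x : x \notin ts ->
  is_derive x 1 (flip (horner P) ts) (Num.sg (root_prod ts x) * P^`().[x]).
Proof.
elim: ts x => [|t ts ih] x.
  by rewrite /root_prod big_nil sgr1 mul1r => _; exact: is_derive_poly.
rewrite inE negb_or => /andP[xt /ih{}ih].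
rewrite root_prod_cons sgrM; move: xt; rewrite neq_lt => /orP[xt|tx].
- apply: (@near_eq_is_derive _ _ _ (- flip (horner P) ts)).
    near=> z; have zt : z < t by near: z; exact: lt_nbhsl.
    by rewrite /= (min_idPr (ltW zt)) [LHS]/GRing.opp/=; ring.
  rewrite ltr0_sg ?subr_lt0// mulN1r mulNr; exact: is_deriveN.
- apply: (@near_eq_is_derive _ _ _ (flip (horner P) ts - cst (2 * flip (horner P) ts t))).
    near=> z; have zt : t < z by near: z; exact: lt_nbhsr.
    by rewrite /= (min_idPl (ltW zt)).
  rewrite gtr0_sg ?subr_gt0// mul1r; apply: is_derive_eq; by rewrite subr0.
Unshelve. all: by end_near. Qed.

End SignedPrimitive.

Section MonotoneOffFinite.
Variable R : realType.
Implicit Types (f df : R -> R) (s : seq R).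

(** The interval is cut at the exceptional points one by one, and the mean value theorem applies to
    each piece. This takes the place of the positivity of an integral. *)
Lemma monotone_off_finite f df s (a b : R) : a <= b -> continuous f ->
  (forall x, a < x < b -> x \notin s -> is_derive x 1 f (df x)) ->
  (forall x, a < x < b -> x \notin s -> 0 <= df x) ->
  f a <= f b.
Proof.
move=> ab cf; elim: s a b ab => [|c s ih] a b ab H1 H2.
  move: ab; rewrite le_eqVlt => /orP[/eqP->//|ab].
  have [||c cab E] := @MVT _ f df a b ab.
  - by move=> x xab; apply: H1.
  - exact: continuous_subspaceT.
  by rewrite -subr_ge0 E mulr_ge0 ?H2 ?subr_ge0 ?(ltW ab).
have [cab|ncab] := boolP (a < c < b); last first.
  have nc x : a < x < b -> x \notin s -> x \notin c :: s.
    move=> xab xs; rewrite inE negb_or xs andbT; apply: contraNneq ncab.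
    by move=> <-.
  by apply: ih => // x xab xs; [apply: H1|apply: H2] => //; exact: nc.
have /andP[ac cb] := cab.
apply: (@le_trans _ _ (f c)).
  apply: ih (ltW ac) _ _ => x /andP[ax xc] xs; [apply: H1|apply: H2];
    by rewrite ?ax ?(lt_trans xc) // inE negb_or xs andbT lt_eqF.
apply: ih (ltW cb) _ _ => x /andP[cx xb] xs; [apply: H1|apply: H2];
  by rewrite ?xb ?(lt_trans ac) // inE negb_or xs andbT gt_eqF.
Qed.

(** Monotonicity squeezes [f] between its equal end values, so it is constant. This is what settles
    the equality case of the extremal problem. *)
Lemma derive_eq0_off_finite f df s (a b : R) : f a = f b -> continuous f ->
  (forall x, a < x < b -> x \notin s -> is_derive x 1 f (df x)) ->
  (forall x, a < x < b -> x \notin s -> 0 <= df x) ->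
  forall x, a < x < b -> x \notin s -> df x = 0.
Proof.
move=> fab cf H1 H2 x /andP[ax xb] xs.
have fc y : a <= y <= b -> f y = f a.
  move=> /andP[ay yb]; apply/eqP; rewrite eq_le {1}fab; apply/andP; split.
    apply: (@monotone_off_finite f df s) => // z /andP[yz zb];
    [apply: H1|apply: H2]; by rewrite zb (le_lt_trans ay yz).
  apply: (@monotone_off_finite f df s) => // z /andP[yz zb];
    [apply: H1|apply: H2]; by rewrite yz (lt_le_trans zb yb).
have d0 : is_derive x 1 f 0.
  apply: (@near_eq_is_derive _ _ _ (cst (f a))).
    near=> y; rewrite fc//; apply/andP; split; apply: ltW; near: y.
      exact: lt_nbhsr.
    exact: lt_nbhsl.
have := H1 x _ xs; rewrite ax xb => /(_ isT) [_ <-].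
by case: d0 => _ <-.
Unshelve. all: by end_near. Qed.

End MonotoneOffFinite.

(* If [P'] has the sign of the step function of [ts], that step function maximises
   the pairing with [P'] among all functions of absolute value at most 1. *)
Section SignMaximal.
Variable R : realType.
Variables (P : {poly R}) (ts ts' : seq R) (d : R).
Hypothesis P0 : P.[0] = 0.
Hypothesis ts0 : all (>= 0) ts.
Hypothesis ts'0 : all (>= 0) ts'.
Hypothesis d1 : `|d| <= 1.
Hypothesis P_ts : forall x, 0 < x < 1 -> x \notin ts ->
  0 < P^`().[x] * root_prod ts x.

(** The primitive of [P'] times the difference of the two step functions, the second scaled by [d].
    As [P'] has the sign of the first and the other is bounded by 1, the integrand is
    nonnegative. *)
Let D x := flip (horner P) ts x - d * flip (horner P) ts' x.
Let dD x := (Num.sg (root_prod ts x) - d * Num.sg (root_prod ts' x)) * P^`().[x].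

Let cD : continuous D.
Proof.
move=> x; apply: cvgB.
  exact/flip_id_continuous/continuous_horner.
apply: cvgM; first exact: cvg_cst.
exact/flip_id_continuous/continuous_horner.
Qed.

Let D0 : D 0 = 0.
Proof. by rewrite /D !flip0//; ring. Qed.

Let D_derive x : x \notin ts ++ ts' -> is_derive x 1 D (dD x).
Proof.
rewrite mem_cat negb_or => /andP[xts xts'].
have h1 := @flip_derive _ P _ _ xts.
have h2 := @flip_derive _ P _ _ xts'.
have -> : D = flip (horner P) ts - d \*: flip (horner P) ts' by [].
apply: is_derive_eq; rewrite /dD /GRing.scale/=; ring.
Qed.

Let dD_sg x : 0 < x < 1 -> x \notin ts ++ ts' ->
  dD x = (1 - d * Num.sg (root_prod ts x) * Num.sg (root_prod ts' x)) * `|P^`().[x]|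
  /\ 0 < `|P^`().[x]|.
Proof.
move=> x01; rewrite mem_cat negb_or => /andP[xts xts'].
have := P_ts x01 xts; move=> pos.
have p0 : P^`().[x] != 0 by apply: contraTneq pos => ->; rewrite mul0r ltxx.
rewrite normr_gt0; split => //; rewrite /dD normrEsg.
have -> : Num.sg P^`().[x] = Num.sg (root_prod ts x).
  move: pos; have [h|h] := orP (lt_total p0).
    by rewrite nmulr_rgt0// => /ltr0_sg ->; rewrite ltr0_sg.
  by rewrite pmulr_rgt0// => /gtr0_sg ->; rewrite gtr0_sg.
have : Num.sg (root_prod ts x) * Num.sg (root_prod ts x) = 1.
  rewrite -expr2 sqr_sg root_prod_eq0 (negbTE xts)//.
move: (Num.sg (root_prod ts x)) (Num.sg (root_prod ts' x)) => a b aa.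
have -> : (1 - d * a * b) * (a * P^`().[x]) = (a - d * b * (a * a)) * P^`().[x].
  by ring.
by rewrite aa mulr1.
Qed.

Let dD_ge0 x : 0 < x < 1 -> x \notin ts ++ ts' -> 0 <= dD x.
Proof.
move=> x01 xs; have [-> p0] := dD_sg x01 xs; rewrite mulr_ge0// subr_ge0.
apply: le_trans (ler_norm _) _; rewrite !normrM -mulrA mulr_ile1// ?mulr_ge0//.
by rewrite mulr_ile1// normr_sg; case: (_ != 0).
Qed.

Lemma flip_le : d * flip (horner P) ts' 1 <= flip (horner P) ts 1.
Proof.
rewrite -subr_ge0 -/(D 1) -D0.
apply: (@monotone_off_finite _ D dD (ts ++ ts')) => // x _; exact: D_derive.
Qed.

(** A tie makes [D] take the value 0 at both ends, so its derivative vanishes off the jumps; there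
    [P'] is nonzero, and the sign factor must vanish. *)
Lemma flip_eq_sg : d * flip (horner P) ts' 1 = flip (horner P) ts 1 ->
  forall x, 0 < x < 1 -> x \notin ts ++ ts' ->
  d * Num.sg (root_prod ts x) * Num.sg (root_prod ts' x) = 1.
Proof.
move=> E x x01 xs.
have D01 : D 0 = D 1 by rewrite D0 /D E subrr.
have := @derive_eq0_off_finite _ D dD (ts ++ ts') 0 1 D01 cD
  (fun x _ => @D_derive x) dD_ge0 x x01 xs.
have [-> p0] := dD_sg x01 xs.
by move/eqP; rewrite mulf_eq0 (gt_eqF p0) orbF subr_eq0 => /eqP.
Qed.

End SignMaximal.

(** * Moments of step functions with jumps in the unit interval *)

Section Moments.
Variable R : realType.
Implicit Types (ts : seq R) (x : R).

(** This is [i + 1] times the usual moment of order [i], since the derivative of [x ^+ i.+1] is what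
    gets integrated. The scaling avoids denominators, and the primitive vanishes at 0. *)
Definition moment (i : nat) ts : R := flip (fun x => x ^+ i.+1) ts 1.

Definition unit_seq ts := all (fun t => 0 <= t <= 1) ts.

Lemma unit_seq_ge0 ts : unit_seq ts -> all (>= 0) ts.
Proof. by apply: sub_all => t /andP[]. Qed.

Definition moment_poly n (c : 'I_n -> R) : {poly R} := \sum_(i < n) c i *: 'X^(i.+1).

Lemma moment_poly0 n (c : 'I_n -> R) : (moment_poly c).[0] = 0.
Proof.
rewrite horner_sum big1// => i _.
by rewrite hornerZ hornerXn expr0n mulr0.
Qed.

Lemma flip_moment_poly n (c : 'I_n -> R) ts :
  flip (horner (moment_poly c)) ts 1 = \sum_(i < n) c i * moment i ts.
Proof.
rewrite /moment -flip_sum; apply: eq_flip => x.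
by rewrite horner_sum; apply: eq_bigr => i _; rewrite hornerZ hornerXn.
Qed.

Lemma coef_deriv_moment_poly n (c : 'I_n -> R) (i : 'I_n) :
  (moment_poly c)^`()`_i = c i *+ i.+1.
Proof.
rewrite coef_deriv coef_sum (bigD1 i)//= coefZ coefXn eqxx mulr1 big1 ?addr0//.
by move=> j ji; rewrite coefZ coefXn eqSS eq_sym val_eqE (negbTE ji) mulr0.
Qed.

Lemma size_deriv_moment_poly n (c : 'I_n -> R) :
  (size (moment_poly c)^`() <= n)%N.
Proof.
apply/leq_sizeP => j nj; rewrite coef_deriv coef_sum big1 ?mul0rn// => i _.
rewrite coefZ coefXn eqSS gtn_eqF ?mulr0//.
by rewrite (leq_trans (ltn_ord i)).
Qed.

Lemma deriv_moment_poly_neq0 n (c : 'I_n -> R) (i : 'I_n) :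
  c i != 0 -> (moment_poly c)^`() != 0.
Proof.
move=> ci; apply/eqP => /(congr1 (fun p : {poly R} => p`_i)).
by rewrite coef_deriv_moment_poly coef0 => /eqP; rewrite mulrn_eq0 (negbTE ci).
Qed.

Lemma deriv_moment_poly_surj n (p : {poly R}) : (size p <= n)%N ->
  exists c : 'I_n -> R, (moment_poly c)^`() = p.
Proof.
move=> sp; exists (fun i => p`_i / i.+1%:R); apply/polyP => j.
have [jn|nj] := ltnP j n; last first.
  rewrite !nth_default//; first exact: leq_trans nj.
  exact: leq_trans (size_deriv_moment_poly _) nj.
rewrite (coef_deriv_moment_poly _ (Ordinal jn))/=.
by rewrite -[LHS]mulr_natr mulfVK// pnatr_eq0.
Qed.

Lemma ivt_sign (p : {poly R}) (a b : R) : a <= b ->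
  (forall x, a <= x <= b -> ~~ root p x) -> 0 < p.[a] * p.[b].
Proof.
move=> ab nr.
wlog pa : p nr / 0 < p.[a].
  move=> H; have : p.[a] != 0 by have := nr a; rewrite lexx ab => /(_ isT).
  rewrite neq_lt => /orP[pa|]; last exact: H.
  rewrite -mulrNN -!hornerN; apply: H; last by rewrite hornerN oppr_gt0.
  by move=> x xab; rewrite rootN nr.
rewrite pmulr_rgt0// ltNge; apply/negP => pb.
have [|x xab] := @poly_ivt R (- p) a b ab.
  by rewrite !hornerN oppr_le0 oppr_ge0 (ltW pa).
by rewrite rootN => rx; have := nr x xab; rewrite rx.
Qed.

(** Each root in the interval is split off and becomes a jump, so that the remaining factor is a
    square. A polynomial without roots there has constant sign. *)
Lemma poly_sign_pattern n (p : {poly R}) : p != 0 -> (size p <= n.+1)%N ->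
  exists ts (e : R), [/\ size ts = n, unit_seq ts, `|e| = 1 &
    forall x, 0 < x < 1 -> x \notin ts -> 0 < (e * p.[x]) * root_prod ts x].
Proof.
elim: n p => [|n ih] p p0 sp.
  exists [::], (Num.sg p.[0]).
  have nr x : ~~ root p x.
    by move/size1_polyC: sp p0 => -> c0; rewrite rootC -polyC_eq0.
  split => //; first by rewrite normr_sg (nr 0).
  move=> x /andP[x0 x1] _; rewrite /root_prod big_nil mulr1.
  have := @ivt_sign p 0 x (ltW x0) (fun y _ => nr y).
  have := nr 0; rewrite /root neq_lt => /orP[h|h].
    by rewrite nmulr_rgt0// ltr0_sg// mulN1r oppr_gt0.
  by rewrite pmulr_rgt0// gtr0_sg// mul1r.
have [[a a01 /factor_theorem[q def]]|nr] :=
    pselect (exists2 a, 0 <= a <= 1 & root p a).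
  have q0 : q != 0 by apply: contraNneq p0 => q0; rewrite def q0 mul0r.
  have [|ts [e [sts uts e1 H]]] := ih q q0.
    by move: sp; rewrite def size_Mmonic ?monicXsubC// size_XsubC addn2.
  exists (a :: ts), e; split => //=; first by rewrite sts.
    by rewrite a01.
  move=> x x01; rewrite inE negb_or => /andP[xa xts].
  rewrite def hornerM hornerXsubC root_prod_cons.
  have -> : e * (q.[x] * (x - a)) * ((x - a) * root_prod ts x) =
    (e * q.[x] * root_prod ts x) * (x - a) ^+ 2 by ring.
  by rewrite mulr_gt0 ?H// exprn_even_gt0//= subr_eq0.
have {}nr x : 0 <= x <= 1 -> ~~ root p x.
  by move=> x01; apply/negP => rx; apply: nr; exists x.
(* No root is left, but the list must have prescribed length: jumps at 0 do not affect the sign on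
   the open interval. *)
exists (nseq n.+1 0), (Num.sg p.[0]); split.
- by rewrite size_nseq.
- by apply/allP => t /nseqP[-> _]; rewrite lexx ler01.
- by rewrite normr_sg -[_ != 0]/(~~ root p 0) nr// lexx ler01.
move=> x /andP[x0 x1] _.
have -> : root_prod (nseq n.+1 0) x = x ^+ n.+1.
  elim: n {ih sp} => [|n ihn]; first by rewrite /root_prod big_seq1 subr0 expr1.
  by rewrite -[nseq _ _]/(0 :: nseq n.+1 0) root_prod_cons ihn subr0 -exprS.
rewrite pmulr_lgt0 ?exprn_gt0//.
have := @ivt_sign p 0 x (ltW x0).
have p00 : p.[0] != 0 by rewrite -[_ != 0]/(~~ root p 0) nr// lexx ler01.
have h : 0 < p.[0] * p.[x].
  apply: ivt_sign (ltW x0) _ => y /andP[y0 yx].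
  by rewrite nr// y0 (le_trans yx)// ltW.
move: p00; rewrite neq_lt => /orP[p0'|p0'] _.
  by move: h; rewrite nmulr_rgt0// ltr0_sg// mulN1r oppr_gt0.
by move: h; rewrite pmulr_rgt0// gtr0_sg// mul1r.
Qed.

(** The list [s] absorbs the jumps, where the signs vanish, as well as jumps that cancel. That [r]
    is 1 or -1 is a consequence, [same_sign_norm]. *)
Definition same_sign (r : R) ts ts' :=
  exists s : seq R, forall x, 0 < x < 1 -> x \notin s ->
    r * Num.sg (root_prod ts x) * Num.sg (root_prod ts' x) = 1.

Lemma generic_point (a b : R) (s : seq R) : a < b ->
  exists2 x, a < x < b & x \notin s.
Proof.
elim: s b => [|c s ih] b ab.
  by exists ((a + b) / 2); rewrite ?midf_lt.
have [cab|] := ltP a c; last first.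
  move=> ca; have [x xab xs] := ih b ab; exists x => //; rewrite inE negb_or xs andbT gt_eqF//
    (le_lt_trans ca)//.
  by case/andP: xab.
have [x /andP[ax]] := ih (Num.min b c) ltac:(by rewrite lt_min ab cab).
rewrite lt_min => /andP[xb xc] xs; exists x; first by rewrite ax xb.
by rewrite inE negb_or xs andbT lt_eqF.
Qed.

Lemma same_sign_norm r ts ts' : same_sign r ts ts' -> r = 1 \/ r = -1.
Proof.
have sgP (u : R) : [\/ Num.sg u = 0, Num.sg u = 1 | Num.sg u = -1].
  have [h|h|->] := ltrgt0P u; last by rewrite sgr0; constructor 1.
    by rewrite gtr0_sg//; constructor 2.
  by rewrite ltr0_sg//; constructor 3.
move=> [s H]; have [x x01 xs] := @generic_point 0 1 s ltr01.
have := H x x01 xs.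
by case: (sgP (root_prod ts x)) => ->; case: (sgP (root_prod ts' x)) => -> h;
  first [left; lra|right; lra|exfalso; lra].
Qed.

Lemma same_sign_sym r ts ts' : same_sign r ts ts' -> same_sign r^-1 ts' ts.
Proof.
move=> H; have r1 : r^-1 = r.
  by case: (same_sign_norm H) => ->; rewrite ?invr1// invrN invr1.
move: H => [s H]; exists s => x x01 xs; rewrite r1 -[RHS](H x x01 xs); ring.
Qed.

(** The primitives of the two step functions, one of them scaled by [r], have the same derivative
    off a finite set and the same value at 0. *)
Lemma same_sign_moment r ts ts' i : unit_seq ts -> unit_seq ts' ->
  same_sign r ts ts' -> moment i ts = r * moment i ts'.
Proof.
move=> /unit_seq_ge0 uts /unit_seq_ge0 uts' rr; have r1 := same_sign_norm rr.
move: rr => [s H].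
pose P : {poly R} := 'X^(i.+1).
have mE ts0 : moment i ts0 = flip (horner P) ts0 1.
  by apply: eq_flip => x; rewrite hornerXn.
have P0 : P.[0] = 0 by rewrite hornerXn expr0n.
rewrite !mE.
(* The factor [k] will be 1 and then -1: monotonicity of both functions forces the difference to
   vanish at 1. *)
pose D k x := k * (flip (horner P) ts x - r * flip (horner P) ts' x).
have cD k : continuous (D k).
  move=> x; apply: cvgM; first exact: cvg_cst.
  apply: cvgB; first exact/flip_id_continuous/continuous_horner.
  apply: cvgM; first exact: cvg_cst.
  exact/flip_id_continuous/continuous_horner.
have dD k x : 0 < x < 1 -> x \notin s ++ (ts ++ ts') -> is_derive x 1 (D k) 0.
  move=> x01; rewrite !mem_cat !negb_or => /andP[xs /andP[xts xts']].
  have h1 := @flip_derive _ P _ _ xts.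
  have h2 := @flip_derive _ P _ _ xts'.
  have -> : D k = k \*: (flip (horner P) ts - r \*: flip (horner P) ts') by [].
  apply: is_derive_eq; have := H x x01 xs; rewrite /GRing.scale/=.
  have : Num.sg (root_prod ts x) * Num.sg (root_prod ts x) = 1.
    by rewrite -expr2 sqr_sg root_prod_eq0 (negbTE xts).
  move: (Num.sg (root_prod ts x)) (Num.sg (root_prod ts' x)) => a b aa ab.
  rewrite mulrA -mulrBl mulrA.
  suff -> : a = r * b by rewrite subrr mulr0 mul0r.
  by rewrite -[LHS]mulr1 -ab -[RHS]mul1r -aa; ring.
have D0 k : D k 0 = 0 by rewrite /D !flip0//; ring.
have le k : 0 <= D k 1.
  by have := @monotone_off_finite _ (D k) (fun=> 0) _ 0 1 ler01 (cD k) (dD k)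
    (fun _ _ _ => lexx 0); rewrite D0.
have := le 1; have := le (-1); rewrite /D; lra.
Qed.

Lemma root_prodE ts x : root_prod ts x = (\prod_(t <- ts) ('X - t%:P)).[x].
Proof.
by rewrite /root_prod horner_prod; apply: eq_bigr => t _; rewrite hornerXsubC.
Qed.

(* Pair with the polynomial whose roots are the jumps. *)
Lemma moment_ray_inj n r ts ts' : unit_seq ts -> unit_seq ts' ->
  (size ts <= n)%N -> (size ts' <= n)%N -> r != 0 ->
  (forall i, (i <= n)%N -> moment i ts = r * moment i ts') ->
  same_sign r ts ts'.
Proof.
(* Only a factor of absolute value at most 1 is an admissible competitor for the maximiser.
   Otherwise the two lists exchange roles, with the inverse factor. *)
wlog r1 : r ts ts' / `|r| <= 1.
  move=> W u u' s s' r0 H; have [r1|r1] := leP `|r| 1; first exact: W.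
  rewrite -[r]invrK; apply: same_sign_sym; apply: W => //.
  - by rewrite normfV invf_le1 ?ltW// (lt_trans ltr01).
  - by rewrite invr_eq0.
  - by move=> i /H ->; rewrite mulKf.
move=> u u' s s' r0 H.
have [|c cE] := @deriv_moment_poly_surj n.+1 (\prod_(t <- ts) ('X - t%:P)).
  by rewrite size_prod_XsubC.
exists (ts ++ ts').
apply: (@flip_eq_sg _ (moment_poly c)) => //.
- exact: moment_poly0.
- exact: unit_seq_ge0.
- exact: unit_seq_ge0.
- move=> x _ xts; rewrite cE -root_prodE -expr2 exprn_even_gt0//=.
  by rewrite root_prod_eq0.
rewrite !flip_moment_poly mulr_sumr; apply: eq_bigr => i _.
by rewrite H 1?mulrCA// -ltnS.
Qed.

(** If all these moments vanished, the competitor with [d = 0] would tie with the maximiser, against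
    [flip_eq_sg]. *)
Lemma moment_neq0 n ts : unit_seq ts -> (size ts <= n)%N ->
  exists2 i, (i <= n)%N & moment i ts != 0.
Proof.
move=> u s; apply: contrapT => H.
have [|c cE] := @deriv_moment_poly_surj n.+1 (\prod_(t <- ts) ('X - t%:P)).
  by rewrite size_prod_XsubC.
have d1 : `|0 : R| <= 1 by rewrite normr0 ler01.
have Pts x : 0 < x < 1 -> x \notin ts -> 0 < (moment_poly c)^`().[x] * root_prod ts x.
  move=> _ xts; rewrite cE -root_prodE -expr2 exprn_even_gt0//=.
  by rewrite root_prod_eq0.
have := @flip_eq_sg _ _ ts [::] 0 (moment_poly0 c) (unit_seq_ge0 u) isT d1 Pts.
have -> : flip (horner (moment_poly c)) ts 1 = 0.
  rewrite flip_moment_poly big1// => i _.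
  have [->|m0] := eqVneq (moment i ts) 0; first by rewrite mulr0.
  by case: H; exists i => //; rewrite -ltnS.
rewrite mul0r => /(_ erefl).
have [x x01 xs] := @generic_point 0 1 (ts ++ [::]) ltr01.
by move/(_ x x01 xs)/eqP; rewrite !mul0r eq_sym oner_eq0.
Qed.

(* The maximiser is the sign of the polynomial with coefficients [c]. *)
Lemma moment_exposed n (c : 'I_n.+1 -> R) (i : 'I_n.+1) : c i != 0 ->
  exists ts (e : R), [/\ size ts = n, unit_seq ts, `|e| = 1,
   0 < \sum_(i < n.+1) c i * (e * moment i ts) &
   forall ts' (e' : R), unit_seq ts' -> `|e'| = 1 ->
    \sum_(i < n.+1) c i * (e' * moment i ts') <= \sum_(i < n.+1) c i * (e * moment i ts)
    /\ (\sum_(i < n.+1) c i * (e' * moment i ts') = \sum_(i < n.+1) c i * (e * moment i ts) ->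
        forall j, e' * moment j ts' = e * moment j ts)].
Proof.
move=> ci.
have [|ts [e [sts uts e1 H]]] := @poly_sign_pattern n (moment_poly c)^`()
   (deriv_moment_poly_neq0 ci).
  exact: size_deriv_moment_poly.
have sqr1 (a : R) : `|a| = 1 -> a * a = 1.
  by move=> a1; rewrite -expr2 -real_normK ?num_real// a1 expr1n.
have ee := sqr1 e e1.
(* With [e] moved into the coefficients, [P'] has exactly the sign of the jumps [ts], and a
   competitor with sign [e'] enters with the factor [e' * e]. *)
pose P := moment_poly (fun i => e * c i).
have P' x : P^`().[x] = e * (moment_poly c)^`().[x].
  rewrite /P /moment_poly -hornerZ -derivZ scaler_sumr.
  by under eq_bigr do rewrite -scalerA.
have Pts x : 0 < x < 1 -> x \notin ts -> 0 < P^`().[x] * root_prod ts x.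
  by move=> x01 xts; rewrite P' H.
have Pf ts0 : flip (horner P) ts0 1 = e * \sum_(i < n.+1) c i * moment i ts0.
  by rewrite flip_moment_poly mulr_sumr; apply: eq_bigr => j _; rewrite mulrA.
have cE (e0 : R) ts0 : \sum_(i < n.+1) c i * (e0 * moment i ts0) =
    (e0 * e) * flip (horner P) ts0 1.
  rewrite Pf -mulrA (mulrA e e) ee mul1r mulr_sumr.
  by apply: eq_bigr => j _; ring.
have E0 : \sum_(i < n.+1) c i * (e * moment i ts) = flip (horner P) ts 1.
  by rewrite cE ee mul1r.
have u0 := unit_seq_ge0 uts.
have d0 : `|0 : R| <= 1 by rewrite normr0 ler01.
exists ts, e; split => //.
  rewrite E0 lt_neqAle; apply/andP; split.
    apply/eqP => P0; have := @flip_eq_sg _ P ts [::] 0 (moment_poly0 _) u0 isT d0 Pts.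
    rewrite mul0r => /(_ P0).
    have [x x01 xs] := @generic_point 0 1 (ts ++ [::]) ltr01.
    by move/(_ x x01 xs)/eqP; rewrite !mul0r eq_sym oner_eq0.
  by have := @flip_le _ P ts [::] 0 (moment_poly0 _) u0 isT d0 Pts; rewrite mul0r.
move=> ts' e' uts' e'1; rewrite E0 cE.
have d1 : `|e' * e| <= 1 by rewrite normrM e1 e'1 mulr1.
have u0' := unit_seq_ge0 uts'.
split; first exact: (@flip_le _ P ts ts' _ (moment_poly0 _)).
move=> /(@flip_eq_sg _ P ts ts' _ (moment_poly0 _) u0 u0' d1 Pts) ss j.
have {}ss : same_sign (e' * e) ts ts' by exists (ts ++ ts').
rewrite (same_sign_moment j uts uts' ss) -[LHS]mul1r -ee; ring.
Qed.

End Moments.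

(** * Compact sets with exposed points *)

Section CompactQuotient.

(* [e] restricted to the compact set [K] is a closed map, hence a quotient map
   onto its image. *)
Lemma compact_quotient_continuous (Q Z W : topologicalType) (K : set Q)
    (e : Q -> Z) (g : Q -> W) (H : Z -> W) (z0 : Z) :
  hausdorff_space Z -> compact K -> continuous e -> continuous g ->
  (forall q, K q -> H (e q) = g q) -> nbhs z0 (e @` K) -> {for z0, continuous H}.
Proof.
move=> hZ cK ce cg Hg nz0 U; rewrite nbhsE => -[V [oV Vz0] VU].
have clK' : closed (e @` (K `&` g @^-1` (~` V))).
  apply: compact_closed => //; apply: continuous_compact.
    exact: continuous_subspaceT.
  apply: compact_closedI => //; apply: closed_comp; last exact: open_closedC.
  by move=> x _; exact: cg.
have : nbhs z0 (~` (e @` (K `&` g @^-1` (~` V)))).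
  apply: open_nbhs_nbhs; split; first exact: closed_openC.
  by move=> [q [Kq /= nV] eq]; apply: nV; rewrite -Hg// eq.
move: nz0; apply: filterS2 => z [q Kq <-] nq; apply: VU.
by rewrite Hg//; apply: contrapT => nV; apply: nq; exists q.
Qed.

End CompactQuotient.

Lemma continuous_sum (R : realType) (T : topologicalType) (I : Type) (r : seq I)
    (F : I -> T -> R) :
  (forall i, continuous (F i)) -> continuous (fun x => \sum_(i <- r) F i x).
Proof.
by move=> cF; apply: continuous_big => [|i _]; [exact: add_continuous|exact: cF].
Qed.

Lemma at_right0_ex (R : realType) (P : R -> Prop) :
  (\forall e \near 0^'+, P e) -> exists2 e : R, 0 < e & P e.
Proof.
by move=> h; near (0 : R)^'+ => e; exists e => //; near: e; exact: h.
Unshelve. all: by end_near. Qed.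

Section StrictlyExposed.
Variable R : realType.

Definition dot n (p x : 'rV[R]_n) : R := \sum_i p ord0 i * x ord0 i.

Lemma dotC n (p x : 'rV[R]_n) : dot p x = dot x p.
Proof. by apply: eq_bigr => i _; rewrite mulrC. Qed.

Lemma dotDr n (p x y : 'rV[R]_n) : dot p (x + y) = dot p x + dot p y.
Proof. by rewrite /dot -big_split; apply: eq_bigr => i _; rewrite mxE mulrDr. Qed.

Lemma dotZr n (p x : 'rV[R]_n) (a : R) : dot p (a *: x) = a * dot p x.
Proof. by rewrite /dot mulr_sumr; apply: eq_bigr => i _; rewrite mxE mulrCA. Qed.

Lemma dotDl n (p q x : 'rV[R]_n) : dot (p + q) x = dot p x + dot q x.
Proof. by rewrite dotC dotDr !(dotC x). Qed.

Lemma dotZl n (p x : 'rV[R]_n) (a : R) : dot (a *: p) x = a * dot p x.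
Proof. by rewrite dotC dotZr (dotC x). Qed.

Lemma dot_gt0 n (x : 'rV[R]_n) : x != 0 -> 0 < dot x x.
Proof.
move=> x0; rewrite lt_neqAle; apply/andP; split; last first.
  by apply: sumr_ge0 => i _; rewrite -expr2 sqr_ge0.
rewrite eq_sym; apply: contraNneq x0 => /eqP.
rewrite psumr_eq0 => [/allP h|i _]; last by rewrite -expr2 sqr_ge0.
apply/eqP/rowP => i; rewrite mxE.
by have := h i (mem_index_enum i); rewrite /= mulf_eq0 orbb => /eqP.
Qed.

Lemma dot_continuous n (p : 'rV[R]_n) : continuous (dot p).
Proof.
apply: (@continuous_sum _ _ _ _ (fun i (x : 'rV[R]_n) => p ord0 i * x ord0 i)).
move=> i x; apply: continuousM; first exact: cst_continuous.
exact: coord_continuous.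
Qed.

Lemma dotl_continuous n (x : 'rV[R]_n) : continuous (fun p => dot p x).
Proof.
suff -> : (fun p => dot p x) = dot x by exact: dot_continuous.
by apply/funext => p; rewrite dotC.
Qed.

Section Rays.
Variables (n : nat) (M : set 'rV[R]_n).
Hypothesis M_compact : compact M.
Hypothesis M_exposed : forall p : 'rV[R]_n, p != 0 -> exists x,
  [/\ M x, 0 < dot p x, forall y, M y -> dot p y <= dot p x &
      forall y, M y -> dot p y = dot p x -> y = x].

(** The polar body stands in for the convex hull of [M]: an extremal problem over it can be solved
    by compactness, without separation theorems. *)
Let polar : set 'rV[R]_n := [set p | forall x, M x -> dot p x <= 1].

Let polar_compact : compact polar.
Proof.
apply: bounded_closed_compact; last first.
  have -> : polar = \bigcap_(x in M) [set p | dot p x <= 1].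
    by apply/seteqP; split.
  apply: closed_bigI => x _; apply: (closed_comp (f := (fun p => dot p x)) (D := [set z | z <= 1])).
      by move=> p _; exact: dotl_continuous.
    exact: closed_le.
have unitK : compact [set p : 'rV[R]_n | `|p| = 1].
  apply: bounded_closed_compact.
    exists 1; split; first exact: num_real.
    by move=> e e1 p /= ->; exact: ltW.
  apply: (closed_comp (f := fun p : 'rV[R]_n => `|p|) (D := [set 1])).
    by move=> p _; exact: norm_continuous.
  exact: closed_eq.
(* A uniform [c]: every unit vector pairs positively with the point it exposes, and by compactness
   these pairings can be bounded below at once. The polar body then lies in the ball of radius
   [c^-1]. *)
have near_c : \forall c \near 0^'+, forall p : 'rV[R]_n, `|p| = 1 ->
    exists2 x, M x & c < dot p x.
  move/compact_near_coveringP: unitK => /(_ _ (0^'+)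
    (fun c p => exists2 x, M x & c < dot p x)); apply => p0 /= p01.
  have [|x0 [Mx0 px0 _ _]] := @M_exposed p0.
    by apply: contra_eq_neq p01 => ->; rewrite normr0 eq_sym oner_eq0.
  exists ([set p | dot p0 x0 / 2 < dot p x0], [set c | c < dot p0 x0 / 2]).
    split => /=.
      by apply: (cvgr_gt (dot p0 x0) (@dotl_continuous _ x0 p0)); rewrite ltr_pdivrMr// ltr_pMr//
        ltr1n.
    by apply: nbhs_right_lt; rewrite divr_gt0.
  by case=> p c /= [h1 h2]; exists x0 => //; exact: lt_trans h2 h1.
have [c c0 Hc] := at_right0_ex near_c.
exists c^-1; split; first exact: num_real.
move=> b cb p Dp; apply: le_trans (ltW cb).
have [->|p0] := eqVneq p 0; first by rewrite normr0 invr_ge0 ltW.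
have [|x Mx] := Hc (`|p|^-1 *: p).
  by rewrite normrZ normfV normr_id mulVf// normr_eq0.
have np : 0 < `|p| by rewrite normr_gt0.
rewrite dotZl ltr_pdivlMl// => h.
by rewrite -[leRHS]mul1r ler_pdivlMr//; exact: le_trans (ltW h) (Dp _ Mx).
Qed.

(* Maximise [dot p v] over the polar body of [M]: at a maximum [p], the vector [v]
   is a multiple of the point of [M] exposed by [p]. *)
Lemma compact_ray (v : 'rV[R]_n) : v != 0 ->
  exists x, M x /\ exists2 r, 0 < r & v = r *: x.
Proof.
move=> v0.
have [||p Dp pmax] := @compact_EVT_max _ _ (fun p => dot p v) polar _ polar_compact.
- by exists 0 => x _; rewrite /dot big1// => i _; rewrite mxE mul0r.
- exact/continuous_subspaceT/dotl_continuous.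
move: Dp; rewrite inE => Dp.
have pmax' q : polar q -> dot q v <= dot p v by move=> Dq; apply: pmax; rewrite inE.
have [x1 [Mx1 vx1 x1max _]] := M_exposed v0.
have c0 : 0 < dot p v.
  apply: (@lt_le_trans _ _ (dot ((dot v x1)^-1 *: v) v)).
    by rewrite dotZl mulr_gt0 ?invr_gt0// dot_gt0.
  by apply: pmax' => y My; rewrite dotZl ler_pdivrMl// mulr1 x1max.
have p0 : p != 0.
  apply: contraTneq c0 => ->; rewrite /dot big1 ?ltxx// => i _.
  by rewrite mxE mul0r.
have [x [Mx px xmax xuniq]] := M_exposed p0.
(* Otherwise [p] could be scaled up inside the polar body, increasing the pairing with [v]. *)
have px1 : dot p x = 1.
  apply/eqP; rewrite eq_le Dp//=.
  have : dot ((dot p x)^-1 *: p) v <= dot p v.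
    by apply: pmax' => y My; rewrite dotZl ler_pdivrMl// mulr1 xmax.
  by rewrite dotZl ler_pdivrMl// ler_pMl.
set c := dot p v in c0 pmax'.
exists x; split => //; exists c => //.
apply/eqP/negPn/negP => /eqP/eqP vcx; pose q0 := v - c *: x.
have q00 : 0 < dot q0 q0 by apply: dot_gt0; rewrite subr_eq0.
(* The direction [q] below is to pair negatively with [x] and positively with [v]. The multiple of
   [p] makes [dot q x] equal to [- d], and this [d] leaves half of [dot q0 q0] for [dot q v]. *)
pose d := dot q0 q0 / (2 * c).
have d0 : 0 < d by rewrite divr_gt0// mulr_gt0.
pose q := q0 + (- (dot q0 x + d)) *: p.
have qx : dot q x = - d by rewrite dotDl dotZl px1; ring.
have qv : 0 < dot q v.
  have -> : dot q v = dot q0 q0 / 2.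
    have E : dot q0 q0 = dot q0 v - c * dot q0 x.
      by rewrite {2}/q0 dotDr -scaleNr dotZr; ring.
    rewrite dotDl dotZl -/c mulNr mulrDl.
    have -> : d * c = dot q0 q0 / 2.
      by rewrite /d; field; rewrite gt_eqF.
    by rewrite E; field.
  by rewrite divr_gt0.
(* The vector [p + e *: q] stays in the polar body for small [e]: near [x] because [q] is negative
   there, elsewhere because [p] exposes only [x], so its constraint is strict. Compactness of [M]
   makes [e] uniform. This contradicts the maximality of [p]. *)
have : \forall e \near 0^'+, forall y, M y -> M y -> dot (p + e *: q) y <= 1.
  move/compact_near_coveringP: M_compact => /(_ _ (0^'+)
    (fun e y => M y -> dot (p + e *: q) y <= 1)); apply => y0 My0.
  have [->|yx] := eqVneq y0 x.
    exists ([set y | dot q y < 0], [set e | 0 < e]).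
      split => /=; last exact: nbhs_right_gt.
      by apply: (cvgr_lt (dot q x) (@dot_continuous _ q x)); rewrite qx oppr_lt0.
    case=> y e /= [qy e0] My; rewrite dotDl dotZl.
    by rewrite -[leRHS]addr0 lerD ?Dp// ltW// pmulr_rlt0.
  have py0 : dot p y0 < 1.
    rewrite lt_neqAle Dp// andbT; apply: contraNneq yx => h.
    by apply/eqP; apply: xuniq => //; rewrite h px1.
  pose eta := (1 - dot p y0) / 2.
  have eta0 : 0 < eta by rewrite divr_gt0// subr_gt0.
  pose b := `|dot q y0| + 1.
  have b0 : 0 < b by rewrite ltr_wpDl.
  exists ([set y | dot p y < 1 - eta /\ dot q y < b], [set e | 0 < e /\ e < eta / b]).
    split => /=.
      apply: filterI.
        by apply: (cvgr_lt (dot p y0) (@dot_continuous _ p y0)); rewrite /eta; move: py0; lra.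
      by apply: (cvgr_lt (dot q y0) (@dot_continuous _ q y0)); rewrite /b (le_lt_trans (ler_norm
        _))// ltrDl.
    apply: filterI; first exact: nbhs_right_gt.
    by apply: nbhs_right_lt; rewrite divr_gt0.
  case=> y e /= [[py qy] [e0]]; rewrite ltr_pdivlMr// => eb _.
  rewrite dotDl dotZl.
  have : e * dot q y < e * b by rewrite ltr_pM2l.
  by move: py eb; lra.
move=> /at_right0_ex[e e0 He].
have : dot (p + e *: q) v <= c by apply: pmax' => y My; exact: He.
by rewrite dotDl dotZl -/c gerDl leNgt mulr_gt0.
Qed.

End Rays.

End StrictlyExposed.

(** * The space of step functions *)

Section TopologyTools.

Lemma continuous_rV (R : realType) (T : topologicalType) n (f : T -> 'rV[R]_n) :
  (forall i, continuous (fun t => f t ord0 i)) -> continuous f.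
Proof.
move=> cf t P [Q nQ QP].
suff : \forall s \near t, forall i j, Q i j (f s i j).
  by apply: filterS => s h; exact: QP.
apply: filter_forall => i; apply: filter_forall => j.
by have := nQ i j; rewrite !ord1 => h; exact: (cf j t _ h).
Qed.

Lemma hausdorff_inj (X Y : topologicalType) (f : X -> Y) :
  injective f -> continuous f -> hausdorff_space Y -> hausdorff_space X.
Proof.
move=> fi cf hY p q pq; apply/fi/hY => A B nA nB.
have [x [Ax Bx]] := pq _ _ (cf p _ nA) (cf q _ nB).
by exists (f x).
Qed.

Lemma continuous_set_type (X T : topologicalType) (A : set X) (f : T -> A) :
  continuous (set_val \o f) -> continuous f.
Proof. exact: continuous_comp_initial. Qed.

Lemma set_val_continuous (X : topologicalType) (A : set X) :
  continuous (set_val : A -> X).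
Proof. exact: initial_continuous. Qed.

Lemma compact_setT_surj (X Y : topologicalType) (K : set X) (f : X -> Y) :
  compact K -> continuous f -> (forall y, exists2 x, K x & f x = y) ->
  compact [set: Y].
Proof.
move=> cK cf fs; have -> : [set: Y] = f @` K.
  by apply/seteqP; split => // y _; have [x Kx <-] := fs y; exists x.
by apply: continuous_compact => //; exact: continuous_subspaceT.
Qed.

Lemma fst_continuous (X Y : topologicalType) : continuous (@fst X Y).
Proof. by move=> [x y]; exact: cvg_fst. Qed.

Lemma snd_continuous (X Y : topologicalType) : continuous (@snd X Y).
Proof. by move=> [x y]; exact: cvg_snd. Qed.

End TopologyTools.

Section StepStates.
Variable R : realType.
Notation I := (unit_itv R).

Lemma clamp_itv (x : R) : [set t : R | 0 <= t <= 1] (Num.max 0 (Num.min 1 x)).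
Proof. by rewrite /= le_max lexx ge_max ler01 ge_min lexx. Qed.

(** A retraction of the line onto the interval, so that paths and homotopies can be parametrised by
    all of [R]. *)
Definition clamp (x : R) : I := SigSub (mem_set (clamp_itv x)).

Lemma unit_itvP (t : I) : 0 <= set_val t <= 1.
Proof. exact: (set_valP t). Qed.

Lemma clampK (t : I) : clamp (set_val t) = t.
Proof.
apply: val_inj => /=; have /andP[t0 t1] := unit_itvP t.
by rewrite (min_idPr t1) (max_idPr t0).
Qed.

Lemma clampE (x : R) : 0 <= x <= 1 -> set_val (clamp x) = x.
Proof. by move=> /andP[x0 x1] /=; rewrite set_valE/= (min_idPr x1) (max_idPr x0). Qed.

Lemma clamp_continuous : continuous clamp.
Proof.
apply: continuous_set_type => x.
have h : {for x, continuous ((cst 0 : R -> R^o) \max ((cst 1 : R -> R^o) \min id))}.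
  apply: continuous_max; first exact: cst_continuous.
  by apply: continuous_min; [exact: cst_continuous|exact: cvg_id].
exact: h.
Qed.

Lemma unit_itv_compact : compact [set: I].
Proof.
apply: (compact_setT_surj (@segment_compact R 0 1) clamp_continuous) => t.
by exists (set_val t); [rewrite /= in_itv/= unit_itvP|exact: clampK].
Qed.

Definition cube n : topologicalType := {ptws 'I_n -> I}.

Lemma cube_compact n : compact [set: cube n].
Proof.
have := @tychonoff 'I_n (fun=> I) (fun=> setT) (fun=> unit_itv_compact).
by have -> : [set f : cube n | forall i, [set: I] (f i)] = setT
  by apply/seteqP; split.
Qed.

Lemma cube_coord_continuous n (i : 'I_n) : continuous (fun t : cube n => t i).
Proof. exact: (@proj_continuous 'I_n (fun=> I) i). Qed.

Definition breaks n (t : 'I_n -> I) : seq R := [seq set_val (t i) | i <- enum 'I_n].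

Lemma size_breaks n (t : 'I_n -> I) : size (breaks t) = n.
Proof. by rewrite size_map size_enum_ord. Qed.

Lemma unit_seq_breaks n (t : 'I_n -> I) : unit_seq (breaks t).
Proof. by apply/allP => _ /mapP[i _ ->]; exact: unit_itvP. Qed.

Lemma breaks_surj n (ts : seq R) : size ts = n -> unit_seq ts ->
  exists t : 'I_n -> I, breaks t = ts.
Proof.
move=> sts uts; exists (fun i => clamp (nth 0 ts i)).
apply: (@eq_from_nth _ 0); first by rewrite size_breaks.
move=> i; rewrite size_breaks => ilt.
have h : 0 <= ts`_i <= 1 by apply: (allP uts ts`_i); rewrite mem_nth// sts.
by rewrite (nth_map (Ordinal ilt)) ?size_enum_ord//= nth_enum_ord// clampE.
Qed.

(* A sign and [n] unordered jumps: a step function with values +1 and -1 on [0, 1].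
   Jumps at 0 do not matter, jumps at 1 change the sign, and equal jumps cancel. *)
Definition state n : topologicalType := (bool * cube n)%type.

Lemma state_compact n : compact [set: state n].
Proof.
rewrite -setXTT; apply: compact_setX; [exact: bool_compact|exact: cube_compact].
Qed.

Definition smoment i n (y : state n) : R := (-1) ^+ y.1 * moment i (breaks y.2).

Lemma smoment_continuous i n : continuous (@smoment i n).
Proof.
have c1 : continuous (fun y : bool * cube n => (-1) ^+ y.1 : R).
  move=> y; apply: (@continuous_comp (bool * cube n)%type bool R fst (fun b : bool => (-1) ^+ b)).
    exact: fst_continuous.
  by move=> P nP; apply/principal_filterP; exact: nbhs_singleton nP.
move=> y; apply: (@continuousM _ _ (fun y : bool * cube n => (-1) ^+ y.1)
  (fun y : bool * cube n => moment i (breaks y.2))).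
  exact: c1.
apply: (@continuous_comp (bool * cube n)%type _ _ snd (fun t : cube n => moment i (breaks t))).
  exact: snd_continuous.
apply: (@flip_continuous R (cube n) 'I_n _ (fun i (t : cube n) => set_val (t i))).
- by move=> x; exact: exprn_continuous.
- move=> j t; apply: (@continuous_comp _ _ _ (fun t : cube n => t j) set_val).
    exact: cube_coord_continuous.
  exact: set_val_continuous.
- by move=> t; exact: cst_continuous.
Qed.

Definition mvec k n (y : state n) : 'rV[R]_k := \row_(i < k) smoment i y.

Lemma mvec_continuous k n : continuous (@mvec k n).
Proof.
apply: continuous_rV => i.
have -> : (fun y : state n => mvec k y ord0 i) = @smoment i n.
  by apply/funext => y; rewrite mxE.
exact: smoment_continuous.
Qed.

End StepStates.

(** * The next moment as a function of the preceding ones *)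

Section Predictor.
Variable R : realType.
Notation state := (state R).

Lemma signr_sq (b : bool) : (-1) ^+ b * (-1) ^+ b = 1 :> R.
Proof. by rewrite -signr_addb addbb. Qed.

Lemma norm1_signr (e : R) : `|e| = 1 -> exists b : bool, e = (-1) ^+ b.
Proof.
move=> /eqP; rewrite eqr_norml ler01 andbT => /orP[/eqP->|/eqP->].
  by exists false; rewrite expr0.
by exists true; rewrite expr1.
Qed.

(** The two bits turn the positive ratio [r] into a signed ratio, which is 1 or -1; hence [r] is 1.
    The common bound [N] allows states with different numbers of jumps to be compared. *)
Lemma smoment_ray n m N (y : state n) (z : state m) (r : R) :
  (n <= N)%N -> (m <= N)%N -> 0 < r ->
  (forall i, (i <= N)%N -> smoment i y = r * smoment i z) ->
  r = 1 /\ forall i, smoment i y = smoment i z.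
Proof.
move=> nN mN r0 H; pose c := (-1) ^+ y.1 * r * (-1) ^+ z.1.
have c0 : c != 0 by rewrite !mulf_neq0 ?signr_eq0 ?gt_eqF.
have ss : same_sign c (breaks y.2) (breaks z.2).
  apply: (@moment_ray_inj _ N) => //; rewrite ?size_breaks//.
  - exact: unit_seq_breaks.
  - exact: unit_seq_breaks.
  move=> i /H; rewrite /smoment => h.
  by rewrite -[LHS]mul1r -(signr_sq y.1) -mulrA h /c; ring.
have r1 : r = 1.
  have : `|c| = 1.
    by case: (same_sign_norm ss) => ->; rewrite ?normrN normr1.
  by rewrite /c !normrM !normr_sign mul1r mulr1 gtr0_norm.
split => // i; rewrite /smoment.
rewrite (same_sign_moment i (unit_seq_breaks _) (unit_seq_breaks _) ss) /c r1.
by rewrite !mulrA signr_sq mulr1 mul1r.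
Qed.

Lemma mvec_neq0 n N (y : state n) : (n <= N)%N -> mvec N.+1 y != 0.
Proof.
move=> nN; have := @moment_neq0 _ N (breaks y.2) (unit_seq_breaks _).
rewrite size_breaks => /(_ nN)[i iN]; rewrite -ltnS in iN.
apply: contraNneq => /rowP/(_ (Ordinal iN)); rewrite !mxE => /eqP.
by rewrite /smoment mulf_eq0 signr_eq0.
Qed.

(** The moment vectors form a compact set whose exposed points are supplied by [moment_exposed];
    this is what [compact_ray] asks for. *)
Lemma state_rays n (v : 'rV[R]_n.+1) : v != 0 ->
  exists y : state n, exists2 r, 0 < r & v = r *: mvec n.+1 y.
Proof.
have cM : compact (@mvec R n.+1 n @` [set: state n]).
  apply: continuous_compact; last exact: state_compact.
  exact/continuous_subspaceT/mvec_continuous.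
have sE (p : 'rV[R]_n.+1) b (t : 'I_n -> unit_itv R) :
    dot p (mvec n.+1 ((b, t) : state n)) =
    \sum_(i < n.+1) p ord0 i * ((-1) ^+ b * moment i (breaks t)).
  by apply: eq_bigr => i _; rewrite mxE.
move=> v0; have [|_ [[y _ <-] [r r0 ->]]] := compact_ray cM _ v0; last first.
  by exists y, r.
move=> p p0; have [i pi] : exists i, p ord0 i != 0.
  apply: contrapT => h; case/eqP: p0; apply/rowP => i; rewrite mxE.
  by apply/eqP/negPn/negP => pi; apply: h; exists i.
have [ts [e [sts uts e1 pos H]]] := moment_exposed pi.
have [b eb] := norm1_signr e1; have [t tts] := breaks_surj sts uts.
exists (mvec n.+1 ((b, t) : state n)); rewrite !sE tts -eb; split.
- by exists (b, t).
- by [].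
- move=> _ [[b' t'] _ <-]; rewrite sE.
  by apply: (H _ _ (unit_seq_breaks _) _).1; rewrite normr_sign.
- move=> _ [[b' t'] _ <-]; rewrite sE => E; apply/rowP => j; rewrite !mxE.
  rewrite /smoment/= tts -eb.
  by apply: (H _ _ (unit_seq_breaks t') _).2 => //; rewrite normr_sign.
Qed.

(** The missing jumps are put at 0. *)
Lemma state_pad n m (y : state n) : (n <= m)%N ->
  exists z : state m, forall i, smoment i z = smoment i y.
Proof.
move=> nm; have [||t tE] := @breaks_surj R m (nseq (m - n) 0 ++ breaks y.2).
- by rewrite size_cat size_nseq size_breaks subnK.
- rewrite /unit_seq all_cat; apply/andP; split; last exact: unit_seq_breaks.
  by apply/allP => x /nseqP[-> _]; rewrite lexx ler01.
exists (y.1, t) => i; rewrite /smoment tE; congr (_ * _).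
elim: (m - n)%N => [//|k <-]; rewrite /moment flip_cons0 ?expr0n//.
rewrite all_cat (unit_seq_ge0 (unit_seq_breaks _)) andbT.
by apply/allP => x /nseqP[-> _].
Qed.

Definition sopp n (y : state n) : state n := (~~ y.1, y.2).

Lemma smoment_opp i n (y : state n) : smoment i (sopp y) = - smoment i y.
Proof. by rewrite /smoment /= signrN mulNr. Qed.

Lemma mvec_opp k n (y : state n) : mvec k (sopp y) = - mvec k y.
Proof. by apply/rowP => i; rewrite !mxE smoment_opp. Qed.

Lemma state_inhabited n : state n.
Proof. by split; [exact: true|move=> _; exact: clamp 0]. Qed.

(* The next moment of a step function with at most [n] jumps is determined by
   its first [n + 1] moments; extend it by homogeneity to all vectors. *)
Lemma next_moment n : exists H : 'rV[R]_n.+1 -> R, continuous H /\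
  forall (y : state n) r, 0 <= r -> H (r *: mvec n.+1 y) = r * smoment n.+1 y.
Proof.
have /choice[H HE] : forall v : 'rV[R]_n.+1, exists z, forall (y : state n) r,
    0 <= r -> v = r *: mvec n.+1 y -> z = r * smoment n.+1 y.
  move=> v; have [->|v0] := eqVneq v 0.
    (* Moment vectors are nonzero, so only [r = 0] represents the origin and the value 0 is
       consistent. *)
    exists 0 => y r _ /esym/eqP; rewrite scaler_eq0 (negbTE (mvec_neq0 _ _))// orbF.
    by move=> /eqP ->; rewrite mul0r.
  have [y0 [r0 r00 v0E]] := state_rays v0.
  exists (r0 * smoment n.+1 y0) => y r; rewrite le_eqVlt => /orP[/eqP<-|rpos vE].
    by rewrite scale0r => /eqP; rewrite (negbTE v0).
  have [||||rr ->] := @smoment_ray n n n y y0 (r0 / r) => //.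
    by rewrite divr_gt0.
    move=> i; rewrite -ltnS => ilt.
    have /rowP/(_ (Ordinal ilt)) : r0 *: mvec n.+1 y0 = r *: mvec n.+1 y.
      by rewrite -vE.
    rewrite !mxE /= => h; rewrite mulrAC h mulrC mulKf// gt_eqF//.
  have -> // : r0 = r by rewrite -[r0](@mulfVK _ r) ?gt_eqF// rr mul1r.
exists H; have HH (y : state n) r : 0 <= r -> H (r *: mvec n.+1 y) = r * smoment n.+1 y.
  by move=> r0; exact: (HE _ y r r0 erefl).
split => //.
(* A positive lower bound for the norms of the moment vectors: it keeps the radial parameter bounded
   near any given [v]. *)
have [c c0 cle] : exists2 c : R, 0 < c & forall y : state n, c <= `|mvec n.+1 y|.
  have [|||y _ ymin] := @compact_EVT_min _ _ (fun y : state n => `|mvec n.+1 y|) setT.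
  - by exists (state_inhabited n).
  - exact: state_compact.
  - apply: continuous_subspaceT => y.
    apply: (@continuous_comp (state n) _ R (@mvec R n.+1 n) (fun v => `|v|)).
      exact: mvec_continuous.
    exact: norm_continuous.
  exists `|mvec n.+1 y|; first by rewrite normr_gt0 mvec_neq0.
  by move=> z; apply: ymin; rewrite inE.
(* Every vector of norm less than that of [v] plus 1 is [r *: mvec n.+1 y] with [r <= rho]. So the
   compact set of pairs with radius in [[0, rho]] covers a neighbourhood of [v]. *)
move=> v; pose rho := (`|v| + 1) / c.
have rho0 : 0 <= rho by rewrite divr_ge0// ltW.
apply: (@compact_quotient_continuous (R * state n)%type _ _ (`[0, rho] `*` setT)
  (fun q => q.1 *: mvec n.+1 q.2) (fun q => q.1 * smoment n.+1 q.2)).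
- exact: norm_hausdorff.
- by apply: compact_setX; [exact: segment_compact|exact: state_compact].
- move=> q; apply: (@continuousZ _ _ _ fst (fun q : R * state n => mvec n.+1 q.2)).
    exact: fst_continuous.
  apply: (@continuous_comp (R * state n)%type _ _ snd (@mvec R n.+1 n)).
    exact: snd_continuous.
  exact: mvec_continuous.
- move=> q; apply: (@continuousM _ _ fst (fun q : R * state n => smoment n.+1 q.2)).
    exact: fst_continuous.
  apply: (@continuous_comp (R * state n)%type _ _ snd (@smoment R n.+1 n)).
    exact: snd_continuous.
  exact: smoment_continuous.
- by move=> [r y] /= [+ _]; rewrite in_itv/= => /andP[r0 _]; rewrite HH.
have : \forall u \near v, `|u| < `|v| + 1.
  by apply: (cvgr_lt `|v| (@norm_continuous _ _ v)); rewrite ltrDl.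
apply: filterS => u uv; have [->|u0] := eqVneq u 0.
  exists (0, state_inhabited n); last by rewrite scale0r.
  by split => //=; rewrite in_itv/= lexx rho0.
have [y [r r0 uE]] := state_rays u0.
exists (r, y) => //; split => //=; rewrite in_itv/= (ltW r0)/= ler_pdivlMr//.
apply: le_trans (ltW uv); rewrite uE normrZ gtr0_norm//.
by rewrite ler_wpM2l// ltW.
Qed.

(** With no preceding moments the prediction is 0, the only value compatible with oddness. *)
Definition predictor k : 'rV[R]_k -> R :=
  if k is n.+1 then sval (cid (next_moment n)) else fun=> 0.

Lemma predictor_continuous k : continuous (@predictor k).
Proof.
case: k => [|n]; first exact: cst_continuous.
by rewrite /predictor; case: cid => H [].
Qed.

Lemma predictorE n (y : state n) (r : R) : 0 <= r ->
  predictor (r *: mvec n.+1 y) = r * smoment n.+1 y.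
Proof. by move=> r0; rewrite /predictor; case: cid => H [_ h] /=; exact: h. Qed.

Lemma predictor0 k : @predictor k 0 = 0.
Proof.
case: k => [//|n]; have := @predictorE n (state_inhabited n) 0 (lexx _).
by rewrite scale0r mul0r.
Qed.

Lemma predictorZ k (r : R) (v : 'rV[R]_k) : 0 <= r ->
  predictor (r *: v) = r * predictor v.
Proof.
move=> r0; case: k v => [|n] v; first by rewrite /= mulr0.
have [->|v0] := eqVneq v 0; first by rewrite scaler0 predictor0 mulr0.
have [y [s s0 ->]] := state_rays v0.
by rewrite scalerA !predictorE ?mulrA ?mulr_ge0 ?(ltW s0).
Qed.

Lemma predictorN k (v : 'rV[R]_k) : predictor (- v) = - predictor v.
Proof.
case: k v => [|n] v; first by rewrite /= oppr0.
have [->|v0] := eqVneq v 0; first by rewrite oppr0 predictor0 oppr0.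
have [y [s s0 ->]] := state_rays v0.
by rewrite -scalerN -mvec_opp !predictorE ?(ltW s0)// smoment_opp mulrN.
Qed.

End Predictor.

(** * Step functions parametrise the spheres *)

Section DirectLimits.
Context (X : nat -> topologicalType) (f : forall k, X k -> X k.+1).
Arguments f {k}.

Lemma dirlim_ex (z : dirlim (@f)) : exists k (x : X k), z = dirlim_inj (@f) x.
Proof.
rewrite -[z]quot_proj_repr; case: (repr z) => k x.
by exists k, x.
Qed.

Lemma dirlim_injS k (x : X k) : dirlim_inj (@f) (f x) = dirlim_inj (@f) x.
Proof. by apply/esym/quot_projP; apply: Relation_Operators.rst_step. Qed.

Lemma dirlim_inj_lift k m (x : X k) : (k <= m)%N ->
  exists x' : X m, dirlim_inj (@f) x' = dirlim_inj (@f) x.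
Proof.
move=> /subnK <-; elim: (m - k)%N => [|d [x' <-]]; first by exists x.
by exists (f x'); rewrite dirlim_injS.
Qed.

Lemma dirlim_openP (U : set (dirlim (@f))) :
  open U <-> forall k, open (@dirlim_inj _ (@f) k @^-1` U).
Proof.
split=> [/quot_open/sigT_openP h k|h]; first exact: h.
by apply/quot_open/sigT_openP.
Qed.

Lemma dirlim_inj_continuous k : continuous (@dirlim_inj _ (@f) k).
Proof. by apply/continuousP => U /dirlim_openP. Qed.

Lemma dirlim_continuous (Y : topologicalType) (g : dirlim (@f) -> Y) :
  (forall k, continuous (fun x : X k => g (dirlim_inj (@f) x))) -> continuous g.
Proof.
move=> cg; apply/continuousP => U oU; apply/dirlim_openP => k.
exact: (iffLR (continuousP _) (cg k)).
Qed.

Lemma dirlim_lift (Y : Type) (g : forall k, X k -> Y) :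
  (forall k (x : X k), g k.+1 (f x) = g k x) ->
  exists h : dirlim (@f) -> Y, forall k (x : X k), h (dirlim_inj (@f) x) = g k x.
Proof.
move=> gf; exists (fun z => let a := repr z in g (projT1 a) (projT2 a)) => k x.
have : generated (dirlim_step (@f)) (repr (dirlim_inj (@f) x)) (existT X k x).
  by apply/quot_projP; rewrite quot_proj_repr.
move=> h; rewrite -[RHS]/(g (projT1 (existT X k x)) (projT2 (existT X k x))).
elim: h => {k x} //= [a b ->|x y z _ -> _ ->] //=.
Qed.

End DirectLimits.

Section SphereCoordinates.
Variable R : realType.
Notation Soo := (sphere_infty R).

Definition scoord k (x : sphere R k) (i : nat) : R :=
  if insub i is Some j then set_val x ord0 j else 0.

Lemma scoord_ord k (x : sphere R k) (i : 'I_k.+1) : scoord x i = set_val x ord0 i.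
Proof. by rewrite /scoord valK. Qed.

Lemma scoord_out k (x : sphere R k) i : (k < i)%N -> scoord x i = 0.
Proof. by move=> ki; rewrite /scoord insubN// -leqNgt. Qed.

Lemma scoord_incl k (x : sphere R k) i : scoord (sphere_incl x) i = scoord x i.
Proof.
rewrite /scoord; case: insubP => [j _ ji|]; first by rewrite /= set_valE/= mxE ji.
by rewrite -leqNgt => ki; rewrite insubN// -leqNgt (leq_trans _ ki).
Qed.

Lemma scoord_continuous k i : continuous (fun x : sphere R k => scoord x i).
Proof.
rewrite /scoord; case: insubP => [j _ _|_]; last by move=> x; exact: cst_continuous.
move=> x; apply: (@continuous_comp _ 'rV[R]_k.+1 _ set_val (fun v => v ord0 j)).
  exact: set_val_continuous.
exact: coord_continuous.
Qed.

Definition icoord : Soo -> nat -> R := sval (cid (dirlim_lift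
  (fun k (x : sphere R k) => funext (scoord_incl x)))).

Lemma icoordE k (x : sphere R k) : icoord (dirlim_inj _ x) = scoord x.
Proof. by rewrite /icoord; case: cid. Qed.

Lemma icoord_continuous i : continuous (fun z => icoord z i).
Proof.
apply: dirlim_continuous => k.
have -> : (fun x => icoord (dirlim_inj _ x) i) = (fun x : sphere R k => scoord x i).
  by apply/funext => x; rewrite icoordE.
exact: scoord_continuous.
Qed.

Lemma scoord_inj k (x y : sphere R k) : scoord x = scoord y -> x = y.
Proof.
move=> xy; apply: val_inj; apply/rowP => i.
by have := congr1 (fun g => g (i : nat)) xy; rewrite !scoord_ord.
Qed.

Lemma icoord_inj : injective icoord.
Proof.
move=> z z'; have [k [x ->]] := dirlim_ex z; have [m [y ->]] := dirlim_ex z'.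
have [x' <-] := dirlim_inj_lift (@sphere_incl R) x (leq_maxl k m).
have [y' <-] := dirlim_inj_lift (@sphere_incl R) y (leq_maxr k m).
by rewrite !icoordE => /scoord_inj ->.
Qed.

Lemma sphere_sum k (x : sphere R k) : \sum_i set_val x ord0 i ^+ 2 = 1.
Proof. exact: (set_valP x). Qed.

Lemma sphere_hausdorff k : hausdorff_space (sphere R k).
Proof.
apply: (@hausdorff_inj (sphere R k) 'rV[R]_k.+1 set_val).
- exact: val_inj.
- exact: set_val_continuous.
- exact: norm_hausdorff.
Qed.

Definition mk_sphere k (v : 'rV[R]_k.+1) (h : \sum_i v ord0 i ^+ 2 = 1) : sphere R k :=
  SigSub (mem_set (h : [set x : 'rV[R]_k.+1 | \sum_i x ord0 i ^+ 2 = 1] v)).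

Lemma mk_sphereE k (v : 'rV[R]_k.+1) (h : \sum_i v ord0 i ^+ 2 = 1) :
  set_val (mk_sphere h) = v.
Proof. by []. Qed.

End SphereCoordinates.

Section StatesToSpheres.
Variable R : realType.
Notation state := (state R).
Notation Soo := (sphere_infty R).

(* [residual k] vanishes on the step functions with fewer than [k] jumps; normalised,
   the residuals are therefore compatible coordinates on all the spheres at once. *)
Definition residual k n (y : state n) : R := smoment k y - predictor (mvec k y).

Lemma residual_continuous k n : continuous (@residual k n).
Proof.
move=> y; apply: (@continuousB _ _ _ (@smoment R k n) (fun y : state n => predictor (mvec k y))).
  exact: smoment_continuous.
apply: (@continuous_comp (state n) _ _ (@mvec R k n) (@predictor R k)).
  exact: mvec_continuous.
exact: predictor_continuous.
Qed.

(** Padding brings the number of jumps up to exactly one less than the order of the moment, where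
    the prediction is exact. *)
Lemma residual_out k n (y : state n) : (n < k)%N -> residual k y = 0.
Proof.
case: k => [//|k]; rewrite ltnS => nk; have [z zy] := state_pad y nk.
have -> : residual k.+1 y = residual k.+1 z.
  by rewrite /residual zy; congr (_ - predictor _); apply/rowP => i; rewrite !mxE zy.
apply/eqP; rewrite subr_eq0; have := predictorE z (@ler01 R).
by rewrite scale1r mul1r => ->.
Qed.

Lemma residual_opp k n (y : state n) : residual k (sopp y) = - residual k y.
Proof. by rewrite /residual smoment_opp mvec_opp predictorN opprB opprK addrC. Qed.

(** The passage from moments to residuals is triangular, so it can be inverted order by order;
    homogeneity of the predictor carries the factor [r] along. *)
Lemma residual_smoment n m (y : state n) (z : state m) (r : R) N : 0 <= r ->
  (forall k, (k <= N)%N -> residual k y = r * residual k z) ->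
  forall k, (k <= N)%N -> smoment k y = r * smoment k z.
Proof.
move=> r0 H; elim/ltn_ind => k ih kN.
have E : mvec k y = r *: mvec k z.
  by apply/rowP => i; rewrite !mxE; apply: ih => //; rewrite ltnW// (leq_trans _ kN).
have := H k kN; rewrite /residual E predictorZ// mulrBr => /eqP.
by rewrite subr_eq subrK => /eqP.
Qed.

Definition residual_norm n (y : state n) : R :=
  Num.sqrt (\sum_(i < n.+1) residual i y ^+ 2).

Lemma residual_norm_gt0 n (y : state n) : 0 < residual_norm y.
Proof.
rewrite sqrtr_gt0 lt_neqAle; apply/andP; split; last first.
  by apply: sumr_ge0 => i _; rewrite sqr_ge0.
rewrite eq_sym; apply/negP; rewrite psumr_eq0 => [/allP h|i _]; last by rewrite sqr_ge0.
have h0 k : (k <= n)%N -> residual k y = 0 * residual k y.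
  rewrite -ltnS => kn; have := h (Ordinal kn) (mem_index_enum _).
  by rewrite /= sqrf_eq0 mul0r => /eqP.
have := residual_smoment (lexx _) h0 => {}h0.
have := mvec_neq0 y (leqnn n); apply/negP/negPn/eqP/rowP => i; rewrite !mxE.
by rewrite h0 ?mul0r// -ltnS.
Qed.

Lemma residual_sphere n (y : state n) :
  \sum_i (\row_(i < n.+1) (residual i y / residual_norm y)) ord0 i ^+ 2 = 1.
Proof.
under eq_bigr do rewrite mxE expr_div_n.
rewrite -mulr_suml sqr_sqrtr; last by apply: sumr_ge0 => i _; rewrite sqr_ge0.
rewrite divff// gt_eqF// -sqrtr_gt0; exact: residual_norm_gt0.
Qed.

Definition to_sphere n (y : state n) : sphere R n := mk_sphere (residual_sphere y).

Lemma to_sphere_coord n (y : state n) i :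
  scoord (to_sphere y) i = residual i y / residual_norm y.
Proof.
have [ni|] := ltnP n i; first by rewrite scoord_out// residual_out// mul0r.
by rewrite -ltnS => ni; rewrite -[i]/(val (Ordinal ni)) scoord_ord mk_sphereE mxE.
Qed.

Lemma to_sphere_continuous n : continuous (@to_sphere n).
Proof.
apply: continuous_set_type; apply: continuous_rV => i.
have -> : (fun y => (set_val \o @to_sphere n) y ord0 i) =
    fun y : state n => residual i y / residual_norm y.
  by apply/funext => y; rewrite /= mk_sphereE mxE.
move=> y; apply: (@continuousM _ _ (@residual i n) (fun y : state n => (residual_norm y)^-1)).
  exact: residual_continuous.
apply: (@continuousV _ _ (@residual_norm n)); first by rewrite gt_eqF// residual_norm_gt0.
apply: (@continuous_comp (state n) R R (fun y => \sum_(i < n.+1) residual i y ^+ 2) (@Num.sqrt R)).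
  apply: continuous_sum => j {}y; apply: (@continuous_comp (state n) R R (@residual j n) (fun x
    => x ^+ 2)).
    exact: residual_continuous.
  exact: exprn_continuous.
exact: sqrt_continuous.
Qed.

(** The triangular system is solved for a moment vector with the prescribed residuals, [state_rays]
    provides a state on its ray, and normalisation removes the scale. *)
Lemma to_sphere_surj n (x : sphere R n) : exists y, to_sphere y = x.
Proof.
(* The residual of an arbitrary sequence, which need not consist of moments of a state. *)
pose rest (a : nat -> R) k := a k - predictor (\row_(i < k) a i).
have [a aE] : exists a : nat -> R, forall j, (j <= n)%N -> rest a j = scoord x j.
  suff h N : exists a : nat -> R, forall j, (j < N)%N -> rest a j = scoord x j.
    by have [a aE] := h n.+1; exists a => j; rewrite -ltnS; exact: aE.
  elim: N => [|N [a aE]]; first by exists (fun=> 0).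
  pose b j := if (j < N)%N then a j else scoord x N + predictor (\row_(i < N) a i).
  have bE j : (j <= N)%N -> \row_(i < j) b i = \row_(i < j) a i.
    by move=> jN; apply/rowP => i; rewrite !mxE /b (leq_trans (ltn_ord i)).
  exists b => j; rewrite ltnS leq_eqVlt => /orP[/eqP->|jN].
    by rewrite /rest bE// /b ltnn addrK.
  by rewrite /rest bE ?(ltnW jN)// /b jN; exact: aE.
pose v := \row_(i < n.+1) a i.
have v0 : v != 0.
  apply/negP => /eqP v0.
  have x0 j : (j <= n)%N -> scoord x j = 0.
    move=> jn; rewrite -aE// /rest.
    have z i : (i <= n)%N -> a i = 0.
      by rewrite -ltnS => ilt; have /rowP/(_ (Ordinal ilt)) := v0; rewrite !mxE.
    have -> : \row_(i < j) a i = 0.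
      by apply/rowP => i; rewrite !mxE z// (leq_trans _ jn)// ltnW.
    by rewrite z// predictor0 subr0.
  have := sphere_sum x; rewrite big1 => [/eqP|i _]; first by rewrite eq_sym oner_eq0.
  by rewrite -scoord_ord x0 ?expr0n// -ltnS.
have [y [r r0 vE]] := state_rays v0.
have aM i : (i <= n)%N -> a i = r * smoment i y.
  by rewrite -ltnS => ilt; have /rowP/(_ (Ordinal ilt)) := vE; rewrite !mxE.
have res i : (i <= n)%N -> scoord x i = r * residual i y.
  move=> ilt; rewrite -aE// /rest aM// /residual mulrBr -predictorZ ?(ltW r0)//.
  congr (_ - predictor _); apply/rowP => j; rewrite !mxE aM//.
  by rewrite (leq_trans _ ilt)// ltnW.
(* Both [x] and the normalised residual vector of [y] have length 1, which fixes the scale. *)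
have nE : r * residual_norm y = 1.
  have E : \sum_i set_val x ord0 i ^+ 2 = r ^+ 2 * \sum_(i < n.+1) residual i y ^+ 2.
    rewrite mulr_sumr; apply: eq_bigr => i _.
    by rewrite -exprMn -res -1?ltnS// scoord_ord.
  by rewrite -[RHS]sqrtr1 -(sphere_sum x) E sqrtrM ?sqr_ge0// sqrtr_sqr gtr0_norm.
exists y; apply: scoord_inj; apply/funext => i; rewrite to_sphere_coord.
have [ni|ni] := ltnP n i; first by rewrite scoord_out// residual_out// mul0r.
have n0 := residual_norm_gt0 y.
by rewrite res// -[r](@mulfK _ (residual_norm y)) ?gt_eqF// nE mul1r mulrC.
Qed.

Definition to_Soo n (y : state n) : Soo := dirlim_inj _ (to_sphere y).

Lemma to_Soo_coord n (y : state n) i :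
  icoord (to_Soo y) i = residual i y / residual_norm y.
Proof. by rewrite icoordE to_sphere_coord. Qed.

Lemma to_Soo_continuous n : continuous (@to_Soo n).
Proof.
move=> y; apply: (@continuous_comp _ _ _ (@to_sphere n)).
  exact: to_sphere_continuous.
exact: dirlim_inj_continuous.
Qed.

Lemma residual_norm_wide n N (y : state n) : (n <= N)%N ->
  residual_norm y = Num.sqrt (\sum_(i < N.+1) residual i y ^+ 2).
Proof.
move=> nN; congr Num.sqrt; rewrite -!(big_mkord xpredT (fun i => residual i y ^+ 2)).
rewrite [RHS](@big_cat_nat _ _ _ n.+1)//=.
rewrite [X in _ + X]big_nat_cond [X in _ + X]big1 ?addr0// => i /andP[/andP[ni _] _].
by rewrite residual_out// expr0n.
Qed.

Lemma eq_residual n m (y : state n) (z : state m) :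
  (forall i, smoment i y = smoment i z) -> forall i, residual i y = residual i z.
Proof.
move=> yz i; rewrite /residual yz; congr (_ - predictor _).
by apply/rowP => j; rewrite !mxE yz.
Qed.

(** Equal images have proportional residuals, hence proportional moments; moment vectors on a common
    ray coincide. *)
Lemma to_Soo_eqP n m (y : state n) (z : state m) :
  to_Soo y = to_Soo z <-> forall i, smoment i y = smoment i z.
Proof.
split=> [E|yz]; last first.
  have rE := eq_residual yz; apply: icoord_inj; apply/funext => i.
  rewrite !to_Soo_coord rE; congr (_ / _).
  rewrite (residual_norm_wide y (leq_maxl n m)) (residual_norm_wide z (leq_maxr n m)).
  by congr Num.sqrt; apply: eq_bigr => j _; rewrite rE.
have y0 := residual_norm_gt0 y; have z0 := residual_norm_gt0 z.
pose r := residual_norm y / residual_norm z.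
have r0 : 0 < r by rewrite divr_gt0.
have rE k : residual k y = r * residual k z.
  have := congr1 (fun s => icoord s k) E; rewrite !to_Soo_coord /r => h.
  by rewrite mulrAC -mulrA -h mulrC mulfVK// gt_eqF.
have := residual_smoment (N := maxn n m) (ltW r0) (fun k _ => rE k).
by move/(smoment_ray (leq_maxl n m) (leq_maxr n m) r0) => [].
Qed.

Lemma to_Soo_opp n (y : state n) i : icoord (to_Soo (sopp y)) i = - icoord (to_Soo y) i.
Proof.
rewrite !to_Soo_coord residual_opp mulNr; congr (- (_ / _)).
by congr Num.sqrt; apply: eq_bigr => j _; rewrite residual_opp sqrrN.
Qed.

(** Odd numbers of jumps are cofinal, so the states that have a configuration already fill the
    infinite sphere. *)
Lemma to_Soo_surj (z : Soo) : exists k (y : state k.*2.+1), to_Soo y = z.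
Proof.
have [n [x ->]] := dirlim_ex z.
have nn : (n <= n.*2.+1)%N by rewrite -addnn leqW// leq_addr.
have [x' <-] := dirlim_inj_lift (@sphere_incl R) x nn.
by have [y yx] := to_sphere_surj x'; exists n, y; rewrite /to_Soo yx.
Qed.

End StatesToSpheres.

(** * Configurations up to cancellation *)

Section SignPatterns.
Variable R : realType.
Implicit Types (ts : seq R).

Lemma sg_root_prod ts (x : R) :
  Num.sg (root_prod ts x) = \prod_(t <- ts) Num.sg (x - t).
Proof. by rewrite /root_prod (big_morph _ (@sgrM R) (@sgr1 R)). Qed.

(** Equality of step functions up to a global sign: this will be equality of configurations, once
    these are read as lists of jumps. *)
Definition sim ts ts' := exists r, same_sign r ts ts'.

Lemma sg_sq (x : R) : x != 0 -> Num.sg x * Num.sg x = 1.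
Proof. by move=> x0; rewrite -expr2 sqr_sg x0. Qed.

Lemma eq_sim ts ts' (s : seq R) (r : R) : r * r = 1 ->
  (forall x, 0 < x < 1 -> x \notin s ->
    Num.sg (root_prod ts x) = r * Num.sg (root_prod ts' x)) -> sim ts ts'.
Proof.
move=> rr H; exists r, (ts ++ s) => x x01.
rewrite mem_cat negb_or => /andP[xts xs].
have h := H x x01 xs; have : Num.sg (root_prod ts x) * Num.sg (root_prod ts x) = 1.
  by rewrite sg_sq// root_prod_eq0.
by rewrite {2}h => <-; ring.
Qed.

Lemma sim_refl ts : sim ts ts.
Proof. by apply: (@eq_sim _ _ [::] 1) => [|x _ _]; rewrite mul1r. Qed.

Lemma sim_sym ts ts' : sim ts ts' -> sim ts' ts.
Proof. by move=> [r /same_sign_sym h]; exists r^-1. Qed.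

Lemma sim_trans ts2 ts1 ts3 : sim ts1 ts2 -> sim ts2 ts3 -> sim ts1 ts3.
Proof.
move=> [r1 [s1 H1]] [r2 [s2 H2]]; exists (r1 * r2), (ts2 ++ s1 ++ s2) => x x01.
rewrite !mem_cat !negb_or => /and3P[xts xs1 xs2].
have h1 := H1 x x01 xs1; have h2 := H2 x x01 xs2.
have h : Num.sg (root_prod ts2 x) * Num.sg (root_prod ts2 x) = 1.
  by rewrite sg_sq// root_prod_eq0.
move: (Num.sg (root_prod ts1 x)) (Num.sg (root_prod ts2 x)) (Num.sg (root_prod ts3 x))
  h1 h2 h => a b c h1 h2 h.
transitivity (r1 * a * b * (r2 * b * c)); last by rewrite h1 h2 mulr1.
by rewrite -[LHS]mulr1 -[X in _ * X = _]h; ring.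
Qed.

Lemma sim_perm ts ts' : perm_eq ts ts' -> sim ts ts'.
Proof.
move=> p; apply: (@eq_sim _ _ [::] 1) => [|x _ _]; rewrite mul1r// !sg_root_prod.
exact: perm_big.
Qed.

Lemma sim_pair t ts : sim [:: t, t & ts] ts.
Proof.
apply: (@eq_sim _ _ [:: t] 1) => [|x _ xt]; rewrite mul1r// !sg_root_prod !big_cons.
by rewrite mulrA sg_sq ?mul1r// subr_eq0; move: xt; rewrite inE.
Qed.

Lemma sim_cat ts1 ts1' ts2 ts2' :
  sim ts1 ts1' -> sim ts2 ts2' -> sim (ts1 ++ ts2) (ts1' ++ ts2').
Proof.
move=> [r1 [s1 H1]] [r2 [s2 H2]]; exists (r1 * r2), (s1 ++ s2) => x x01.
rewrite mem_cat negb_or => /andP[xs1 xs2].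
rewrite !sg_root_prod !big_cat -!sg_root_prod /=.
have h1 := H1 x x01 xs1; have h2 := H2 x x01 xs2.
by rewrite -[RHS]mulr1 -[X in _ = X * _]h1 -[X in _ = _ * X]h2; ring.
Qed.

Lemma sim_map (J : Type) (l : seq J) (f g : J -> R) :
  (forall j, sim [:: f j] [:: g j]) -> sim [seq f j | j <- l] [seq g j | j <- l].
Proof.
move=> fg; elim: l => [|j l ih]; first exact: sim_refl.
exact: (sim_cat (fg j) ih).
Qed.

End SignPatterns.

Section ConfigurationClasses.
Variable R : realType.
Notation I := (unit_itv R).

(** The gluing of 0 with 1 is compatible with [sim] at the cost of a sign: a jump at 0 gives the
    constant 1 and a jump at 1 the constant -1. *)
Lemma sim_RP1 (s t : I) : RP1_pt s = RP1_pt t -> sim [:: set_val s] [:: set_val t].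
Proof.
move/quot_projP; elim => {s t} [s t [-> ->]|s|s t _|s t u _ st _ tu].
- apply: (@eq_sim _ _ _ [::] (-1)) => [|x /andP[x0 x1] _]; first by rewrite mulN1r opprK.
  rewrite !sg_root_prod !big_seq1 subr0 gtr0_sg// ltr0_sg ?subr_lt0//.
  by rewrite mulN1r opprK.
- exact: sim_refl.
- exact: sim_sym.
- exact: sim_trans st tu.
Qed.

Definition reps n (x : 'I_n -> RP1 R) : seq R := breaks (fun i => repr (x i) : I).

Lemma reps_pt n (t : 'I_n -> I) : sim (reps (fun i => RP1_pt (t i))) (breaks t).
Proof. by apply: sim_map => i; apply: sim_RP1; exact: quot_proj_repr. Qed.

(** A coinciding pair contributes a square to the product of signs, whatever its position. *)
Lemma sim_same_config n (x y : 'I_n -> RP1 R) : same_config x y -> sim (reps x) (reps y).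
Proof.
case=> [[s xy]|[i [j [ij xij yij xy]]]].
  have -> : reps y = [seq set_val (repr (x i) : I) | i <- [seq s i | i <- enum 'I_n]].
    by rewrite -map_comp; apply: eq_map => i /=; rewrite xy.
  apply: sim_perm; apply: perm_map; apply: uniq_perm.
  - exact: enum_uniq.
  - by rewrite map_inj_uniq ?enum_uniq//; exact: perm_inj.
  move=> k; rewrite mem_enum; apply/esym/mapP; exists ((s^-1)%g k).
    by rewrite mem_enum.
  by rewrite permKV.
pose rest := [seq k <- enum 'I_n | (k != i) && (k != j)].
have pe : perm_eq (enum 'I_n) [:: i, j & rest].
  apply: uniq_perm; first exact: enum_uniq.
    by rewrite /= !inE !mem_filter !eqxx/= andbF orbF ij/= filter_uniq// enum_uniq.
  move=> k; rewrite mem_enum !inE mem_filter mem_enum andbT.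
  by case: (k == i) => //=; case: (k == j).
have red (z : 'I_n -> RP1 R) : z i = z j ->
    sim (reps z) [seq set_val (repr (z k) : I) | k <- rest].
  move=> zij; apply: sim_trans (sim_perm (perm_map _ pe)) _.
  by rewrite /= zij; exact: sim_pair.
apply: sim_trans (red x xij) _; apply: sim_trans (sim_sym (red y yij)).
have -> : [seq set_val (repr (x k) : I) | k <- rest] =
    [seq set_val (repr (y k) : I) | k <- rest]; last exact: sim_refl.
apply/eq_in_map => k; rewrite mem_filter => /andP[/andP[ki kj] _].
by rewrite xy.
Qed.

Lemma sim_generated n (x y : {ptws 'I_n -> RP1 R}) :
  generated (@same_config R n) x y -> sim (reps x) (reps y).
Proof.
elim=> {x y} [x y /sim_same_config//|x|x y _|x y z _ xy _ yz].
- exact: sim_refl.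
- exact: sim_sym.
- exact: sim_trans xy yz.
Qed.

Lemma sim_adjoin n (x : 'I_n -> RP1 R) (b : RP1 R) :
  sim (reps (adjoin_pair x b)) (reps x).
Proof.
have E : reps (adjoin_pair x b) =
    rcons (rcons (reps x) (set_val (repr b : I))) (set_val (repr b : I)).
  rewrite /reps /breaks !enum_ordSr !map_rcons -!map_comp /adjoin_pair.
  congr (rcons (rcons _ _) _).
  - by apply: eq_map => i /=; rewrite valK.
  - by rewrite /= insubN// -leqNgt.
  - by rewrite /= insubN// -leqNgt.
rewrite E; apply: sim_trans (sim_pair (set_val (repr b : I)) _).
apply: sim_perm; rewrite -!cats1 -catA/= perm_catC//.
Qed.

Lemma sim_Cinf k m (x : 'I_k.*2.+1 -> RP1 R) (y : 'I_m.*2.+1 -> RP1 R) :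
  Cinf_class x = Cinf_class y -> sim (reps x) (reps y).
Proof.
pose L (a : {k & Cfin R k}) := reps (repr (projT2 a) : 'I__ -> RP1 R).
have LE k0 (z : 'I_k0.*2.+1 -> RP1 R) : sim (L (existT _ k0 (Cfin_class z))) (reps z).
  by apply: sim_generated; apply/quot_projP; exact: quot_proj_repr.
move/quot_projP => xy; apply: sim_trans (sim_sym (LE _ _)) _; apply: sim_trans (LE _ _).
elim: xy => {x y} [a b ->|a|a b _|a b c _ ab _ bc].
- rewrite {2}/L /=; apply: sim_sym; apply: sim_trans (LE _ _) _.
  exact: sim_adjoin.
- exact: sim_refl.
- exact: sim_sym.
- exact: sim_trans ab bc.
Qed.

Lemma Cinf_class_perm k (x : 'I_k.*2.+1 -> RP1 R) (s : 'S_k.*2.+1) :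
  Cinf_class (fun i => x (s i)) = Cinf_class x.
Proof.
congr dirlim_inj; apply/quot_projP/Relation_Operators.rst_sym.
by apply: Relation_Operators.rst_step; left; exists s.
Qed.

(** A coinciding pair is permuted into the last two places, where it is an adjoined pair and
    disappears in the direct limit; this ends by induction on the number of points. *)
Lemma Cinf_normal_form k (x : 'I_k.*2.+1 -> RP1 R) :
  exists m (y : 'I_m.*2.+1 -> RP1 R), injective y /\ Cinf_class x = Cinf_class y.
Proof.
elim: k x => [|k ih] x.
  by exists 0%N, x; split => // i j _; rewrite (ord1 i) (ord1 j).
have [xi|] := pselect (injective x); first by exists k.+1, x.
move=> /existsNP[i /existsNP[j /not_implyP[xij ij]]].
have {}ij : i != j by apply/eqP.
pose a : 'I_k.*2.+3 := inord k.*2.+1; pose b : 'I_k.*2.+3 := inord k.*2.+2.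
have va : val a = k.*2.+1 by exact: inordK.
have vb : val b = k.*2.+2 by exact: inordK.
have ab : a != b by apply/eqP => /(congr1 val); rewrite va vb => /n_Sn.
have [s [sa sb]] : exists s : 'S_k.*2.+3, s a = i /\ s b = j.
  (* The first transposition sends [a] to [i]; the second moves the image of [b] to [j] and leaves
     [i] alone. *)
  exists (tperm a i * tperm (tperm a i b) j)%g; rewrite !permM tpermL; split; last first.
    by rewrite tpermL.
  rewrite (@tpermD _ (tperm a i b) j i)//; apply/eqP => h; last by move: ij; rewrite h eqxx.
  by case/eqP: ab; apply: (@perm_inj _ (tperm a i)); rewrite tpermL h.
have [m [y [yi E]]] := ih (fun i => x (s (widen_ord (leqW (leqnSn _)) i))).
exists m, y; split => //; rewrite -E -(@Cinf_class_perm k.+1 x s).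
transitivity (dirlim_inj (@Cfin_incl R)
  (@Cfin_class R k.+1 (adjoin_pair (fun i => x (s (widen_ord (leqW (leqnSn _)) i))) (x i)))).
  congr dirlim_inj; congr Cfin_class; apply/funext => l; rewrite /adjoin_pair.
  case: insubP => [l' _ l'l|].
    by congr (x (s _)); apply: val_inj.
  rewrite -leqNgt leq_eqVlt => /orP[/eqP kl|kl].
    by rewrite (_ : l = a) ?sa//; apply: val_inj; rewrite va -kl.
  rewrite (_ : l = b) ?sb//; apply: val_inj; rewrite vb.
  by apply/eqP; rewrite eqn_leq kl andbT -ltnS ltn_ord.
by rewrite -(@Cfin_inclE R k) dirlim_injS.
Qed.

End ConfigurationClasses.

Section ConfigurationsByParity.
Variable R : realType.
Notation I := (unit_itv R).

Lemma straddle (a u0 b : R) (l s : seq R) : a < u0 -> u0 < b ->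
  exists u1 u2, [/\ a < u1 < u0, u0 < u2 < b, u1 \notin s, u2 \notin s &
    forall p, p \in l -> p != u0 -> p < u1 \/ u2 < p].
Proof.
move=> au ub.
have [d d0 dl] : exists2 d : R, 0 < d & forall p, p \in l -> p != u0 -> d <= `|p - u0|.
  elim: l => [|p l [d d0 ih]]; first by exists 1.
  have [->|pu] := eqVneq p u0.
    by exists d => // q; rewrite inE => /orP[/eqP->|]; [rewrite eqxx|exact: ih].
  exists (Num.min d `|p - u0|); first by rewrite lt_min d0 normr_gt0 subr_eq0.
  move=> q; rewrite inE => /orP[/eqP->|ql qu]; first by rewrite ge_min lexx orbT.
  by rewrite ge_min ih.
have [|u1 /andP[u1a u1u] u1s] := @generic_point R (Num.max a (u0 - d)) u0 s.
  by rewrite gt_max au ltrBlDr ltrDl.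
have [|u2 /andP[u2u u2b] u2s] := @generic_point R u0 (Num.min b (u0 + d)) s.
  by rewrite lt_min ub ltrDl.
move: u1a u2b; rewrite gt_max lt_min => /andP[u1a u1d] /andP[u2b u2d].
exists u1, u2; split; rewrite ?u1a ?u2b ?u1u ?u2u//.
move=> p pl pu; have := dl p pl pu; have [h|h] := ltP p u0.
  by rewrite ltr0_norm ?subr_lt0// => h'; left; lra.
by rewrite ger0_norm ?subr_ge0// => h'; right; lra.
Qed.

Lemma sg_straddle (u1 u0 u2 : R) (ts : seq R) : u1 < u0 -> u0 < u2 ->
  (forall p, p \in ts -> p != u0 -> p < u1 \/ u2 < p) ->
  Num.sg (root_prod ts u1) * Num.sg (root_prod ts u2) = (-1) ^+ count_mem u0 ts.
Proof.
move=> u10 u02; rewrite !sg_root_prod; elim: ts => [|t ts ih] H.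
  by rewrite !big_nil mulr1.
rewrite !big_cons mulrACA ih => [|p pts]; last by apply: H; rewrite inE pts orbT.
rewrite /= exprD; congr (_ * _); have [->|tu] := eqVneq t u0.
  by rewrite ltr0_sg ?subr_lt0// gtr0_sg ?subr_gt0// mulr1.
have [h|h] := H t (mem_head _ _) tu.
  by rewrite !gtr0_sg ?mulr1// subr_gt0// (lt_trans h)// (lt_trans u10).
by rewrite !ltr0_sg ?mulrNN ?mulr1// subr_lt0// (lt_trans _ h)// (lt_trans u10).
Qed.

(** The sign changes across [u0] exactly when its multiplicity is odd. Comparing one point on each
    side, the global factor [r] occurs twice and cancels. *)
Lemma sim_parity (ts ts' : seq R) (u0 : R) : sim ts ts' -> 0 < u0 < 1 ->
  odd (count_mem u0 ts) = odd (count_mem u0 ts').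
Proof.
move=> [r rr]; have r1 := same_sign_norm rr; move: rr => [s H] /andP[u00 u01].
have [u1 [u2 [/andP[u1a u1b] /andP[u2a u2b] u1s u2s l]]] :=
  straddle (ts ++ ts') s u00 u01.
have h1 := H u1 _ u1s; have h2 := H u2 _ u2s.
rewrite u1a (lt_trans u1b u01) in h1; rewrite u2b (lt_trans u00 u2a) in h2.
have {}h1 := h1 isT; have {}h2 := h2 isT.
have e1 := @sg_straddle u1 u0 u2 ts u1b u2a
  (fun p pt => l p ltac:(by rewrite mem_cat pt)).
have e2 := @sg_straddle u1 u0 u2 ts' u1b u2a
  (fun p pt => l p ltac:(by rewrite mem_cat pt orbT)).
have : (-1) ^+ count_mem u0 ts * (-1) ^+ count_mem u0 ts' = 1 :> R.
  rewrite -e1 -e2 -[RHS]mulr1 -[X in _ = X * _]h1 -[X in _ = _ * X]h2.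
  by case: r1 => ->; ring.
rewrite -exprD -signr_odd oddD; case: (odd _) (odd _) => [] [] //=;
  rewrite expr1 => /eqP; by rewrite eqNr oner_eq0.
Qed.

Lemma reprI_inj : injective (fun a : RP1 R => set_val (repr a : I)).
Proof.
move=> a b /val_inj ab.
by rewrite -[a]quot_proj_repr -[b]quot_proj_repr ab.
Qed.

Lemma RP1_base_or (a : RP1 R) :
  a = RP1_base R \/ 0 < set_val (repr a : I) < 1.
Proof.
have /andP[] := unit_itvP (repr a : I); rewrite le_eqVlt => /orP[/eqP a0|a0].
  move=> _; left; rewrite -[a]quot_proj_repr; apply: RP1_pt_ends.
    by left; rewrite -a0.
  by left.
rewrite le_eqVlt => /orP[/eqP a1|a1]; last by right; rewrite a0 a1.
left; rewrite -[a]quot_proj_repr; apply: RP1_pt_ends; first by right.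
by left.
Qed.

Lemma count_reps n (y : 'I_n -> RP1 R) (a : RP1 R) : injective y ->
  count_mem (set_val (repr a : I)) (reps y) = (a \in codom y).
Proof.
move=> yi; have E : reps y = [seq set_val (repr b : I) | b <- codom y].
  by rewrite /codom /image_mem -map_comp.
rewrite E count_uniq_mem; last first.
  by rewrite (map_inj_uniq reprI_inj) map_inj_uniq// enum_uniq.
by rewrite (mem_map reprI_inj).
Qed.

(** Signs on the open interval determine all points except the base point, which they cannot see.
    Both cardinalities being odd, the base point lies in both sets or in neither. *)
Lemma sim_Cinf_class k m (x : 'I_k.*2.+1 -> RP1 R) (y : 'I_m.*2.+1 -> RP1 R) :
  injective x -> injective y -> sim (reps x) (reps y) -> range x = range y.
Proof.
move=> xi yi xy.
have mem_ne a : a != RP1_base R -> (a \in codom x) = (a \in codom y).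
  move=> ab; have [E|a01] := RP1_base_or a; first by rewrite E eqxx in ab.
  have := sim_parity xy a01; rewrite !count_reps//.
  by case: (a \in _); case: (a \in _).
have ux : uniq (codom x) by rewrite map_inj_uniq ?enum_uniq.
have uy : uniq (codom y) by rewrite map_inj_uniq ?enum_uniq.
(* If the base point were in [u] only, the sizes would differ by one, yet both are odd. *)
have bxy n l (u v : seq (RP1 R)) : uniq u -> uniq v -> size u = n.*2.+1 ->
    size v = l.*2.+1 -> (forall a, a != RP1_base R -> (a \in u) = (a \in v)) ->
    RP1_base R \in u -> RP1_base R \in v.
  move=> uu uv su sv H bu; apply/negPn/negP => bv.
  have : perm_eq u (RP1_base R :: v).
    apply: uniq_perm => //=; first by rewrite bv.
    move=> a; rewrite inE; have [->|ab] := eqVneq a (RP1_base R); first by rewrite bu.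
    exact: H.
  move/perm_size; rewrite /= su sv => /(congr1 odd).
  by rewrite /= !odd_double.
have sx : size (codom x) = k.*2.+1 by rewrite size_codom card_ord.
have sy : size (codom y) = m.*2.+1 by rewrite size_codom card_ord.
have mem a : (a \in codom x) = (a \in codom y).
  have [->|ab] := eqVneq a (RP1_base R); last exact: mem_ne.
  apply/idP/idP; [apply: (bxy k m)|apply: (bxy m k)] => //.
  by move=> c cb; rewrite mem_ne.
have rE n (z : 'I_n -> RP1 R) : range z = [set a | a \in codom z].
  apply/seteqP; split => [_ [i _ <-] /=|a /codomP[i ->]]; first exact: codom_f.
  by exists i.
by rewrite !rE; apply/seteqP; split => a /=; rewrite mem.
Qed.

Definition config k (t : cube R k.*2.+1) : Cinf R := Cinf_class (fun i => RP1_pt (t i)).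

(** From right to left, both configurations are first brought to injective form, where [sim]
    determines the underlying finite set. *)
Lemma config_simP k m (t : cube R k.*2.+1) (t' : cube R m.*2.+1) :
  config t = config t' <-> sim (breaks t) (breaks t').
Proof.
split=> [/sim_Cinf h|h].
  by apply: sim_trans (sim_sym (reps_pt t)) _; apply: sim_trans (reps_pt t').
have [k' [x [xi tx]]] := Cinf_normal_form (fun i => RP1_pt (t i)).
have [m' [y [yi ty]]] := Cinf_normal_form (fun i => RP1_pt (t' i)).
rewrite /config tx ty -(Cinf_of_setE xi) -(Cinf_of_setE yi).
congr Cinf_of_set; apply: sim_Cinf_class => //.
apply: sim_trans (sim_sym (sim_Cinf tx)) _; apply: sim_trans (sim_Cinf ty).
apply: sim_trans (reps_pt t) _; apply: sim_trans (sim_sym (reps_pt t')).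
exact: h.
Qed.

Lemma sim_momentP k m (t : cube R k) (t' : cube R m) :
  sim (breaks t) (breaks t') <->
  exists b : bool, forall i, moment i (breaks t) = (-1) ^+ b * moment i (breaks t').
Proof.
split=> [[r rr]|[b H]].
  have [b rb] : exists b : bool, r = (-1) ^+ b.
    by apply: norm1_signr; case: (same_sign_norm rr) => ->; rewrite ?normrN normr1.
  rewrite {}rb in rr.
  exists b => i; apply: same_sign_moment.
  - exact: unit_seq_breaks.
  - exact: unit_seq_breaks.
  - by [].
exists ((-1) ^+ b); apply: (@moment_ray_inj _ (maxn k m)).
- exact: unit_seq_breaks.
- exact: unit_seq_breaks.
- by rewrite size_breaks leq_maxl.
- by rewrite size_breaks leq_maxr.
- by rewrite signr_eq0.
- by move=> i _; exact: H.
Qed.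

Lemma config_surj (c : Cinf R) : exists k (t : cube R k.*2.+1), config t = c.
Proof.
have [k [d ->]] := dirlim_ex c; exists k.
exists (fun i => repr ((repr d : 'I__ -> RP1 R) i) : I).
rewrite /config /Cinf_class; congr dirlim_inj.
rewrite -[RHS]quot_proj_repr /Cfin_class; congr quot_proj; apply/funext => i.
exact: quot_proj_repr.
Qed.

End ConfigurationsByParity.

(** * Double coverings *)

Section FreeInvolution.
Variables (X B : topologicalType) (q : X -> B) (nu : X -> X).
Hypothesis nu_continuous : continuous nu.
Hypothesis nuK : involutive nu.
Hypothesis nu_free : forall x, exists U : set X,
  [/\ open U, U x & forall z, U z -> ~ U (nu z)].
Hypothesis q_surj : forall b, exists x, q x = b.
Hypothesis q_eq : forall x y, q x = q y <-> y = x \/ y = nu x.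
Hypothesis q_open : forall V : set B, open V <-> open (q @^-1` V).

Lemma quotient_by_involution_continuous : continuous q.
Proof. by apply/continuousP => V /q_open. Qed.

Lemma quotient_by_involution_nu x : q (nu x) = q x.
Proof. by apply/esym/q_eq; right. Qed.

Lemma quotient_by_involution_open (U : set X) : open U -> open (q @` U).
Proof.
move=> oU; apply/q_open.
have -> : q @^-1` (q @` U) = U `|` nu @^-1` U.
  apply/seteqP; split => [x [y Uy /q_eq[->|->]]|x [Ux|Ux]].
  - by left.
  - by right; rewrite /preimage /= nuK.
  - by exists x.
  - by exists (nu x) => //; exact: quotient_by_involution_nu.
apply: openU => //; apply: open_comp => // x _; exact: nu_continuous.
Qed.

Lemma quotient_by_involution_double_covering : double_covering q.
Proof.
move=> b; have [x0 x0b] := q_surj b; have [U [oU Ux0 Unu]] := nu_free x0.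
exists (q @` U); first by split; [exact: quotient_by_involution_open|exists x0].
have oU' : open (nu @^-1` U) by apply: open_comp => // x _; exact: nu_continuous.
exists U, (nu @^-1` U).
have Uinj x y : U x -> U y -> q x = q y -> x = y.
  by move=> Ux Uy /q_eq[->//|yx]; case: (Unu x Ux); rewrite -yx.
pose g c := xget x0 [set z | U z /\ q z = c].
have gE c : (q @` U) c -> U (g c) /\ q (g c) = c.
  by move=> [z Uz zc]; apply: (xgetPex x0 (P := [set z | U z /\ q z = c])); exists z.
have gq z : U z -> g (q z) = z.
  move=> Uz; have [|Ug qg] := gE (q z); first by exists z.
  exact: Uinj.
have gc : {in q @` U, continuous g}.
  move=> c; rewrite inE => -[z Uz <-] W; rewrite gq// nbhsE => -[W' [oW' W'z] W'W].
  apply: (@filterS _ _ _ (q @` (U `&` W'))).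
    by move=> _ [y [Uy W'y] <-]; rewrite /= gq//; exact: W'W.
  apply: open_nbhs_nbhs; split; last by exists z.
  exact/quotient_by_involution_open/openI.
split => //.
- by apply/seteqP; split => // z [Uz /(Unu z Uz)].
- apply/seteqP; split => [z [y Uy /q_eq[->|->]]|z [Uz|Uz]].
  + by left.
  + by right; rewrite /preimage /= nuK.
  + by exists z.
  + by exists (nu z) => //; exact: quotient_by_involution_nu.
- exists g; split => //.
  + by move=> _ [c /gE[Ug _] <-].
  + split=> c; rewrite inE; first exact: gq.
    by move=> /gE[].
  + exact/continuous_subspaceT/quotient_by_involution_continuous.
  + exact: continuous_in_subspaceT.
- exists (nu \o g); split.
  + move=> _ [z Uz <-]; exists (nu z) => //; exact: quotient_by_involution_nu.
  + by move=> _ [c /gE[Ug _] <-]; rewrite /preimage /= nuK.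
  + split=> c; rewrite inE => h /=.
      by rewrite -(quotient_by_involution_nu c) gq// nuK.
    by rewrite quotient_by_involution_nu; apply: (gE c h).2.
  + exact/continuous_subspaceT/quotient_by_involution_continuous.
  + apply: continuous_in_subspaceT => c /gc cg.
    by apply: continuous_comp => //; exact: nu_continuous.
Qed.

End FreeInvolution.

Section DoubleCoverings.
Variables (E B : topologicalType) (p : E -> B).
Hypothesis p_cov : double_covering p.

(** Indexing the sheets by booleans lets negation exchange them. Since the sheets and their base are
    open, continuity within them becomes continuity at points. *)
Lemma covering_sheets (b : B) : exists (V : set B) (A : bool -> set E) (g : bool -> B -> E),
  [/\ open V /\ V b, forall i, open (A i), forall e, V (p e) <-> A true e \/ A false e,
      forall e, ~ (A true e /\ A false e) &
      (forall i c, V c -> [/\ A i (g i c), p (g i c) = c & {for c, continuous (g i)}]) /\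
      (forall i e, A i e -> g i (p e) = e /\ {for e, continuous p})].
Proof.
have [V [oV Vb] [A1 [A2 [[oA1 oA2] A12 pV [g1 [pA1 gV1 [c1 d1] pc1 gc1]] [g2 [pA2 gV2 [c2 d2] pc2
  gc2]]]]]] := p_cov b.
exists V, (fun i : bool => if i then A1 else A2), (fun i : bool => if i then g1 else g2).
split => //.
- by case.
- by move=> e; rewrite -[V (p e)]/((p @^-1` V) e) pV; split.
- by move=> e [a1 a2]; have : (A1 `&` A2) e by []; rewrite A12.
have inV c : V c -> c \in V by rewrite inE.
split=> [[] c Vc|[] e Ae]; split.
- by apply: gV1; exists c.
- by apply: d1; exact: inV.
- by move: gc1; rewrite continuous_open_subspace// => /(_ c); rewrite inE; apply.
- by apply: gV2; exists c.
- by apply: d2; exact: inV.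
- by move: gc2; rewrite continuous_open_subspace// => /(_ c); rewrite inE; apply.
- by apply: c1; rewrite inE.
- by move: pc1; rewrite continuous_open_subspace// => /(_ e); rewrite inE; apply.
- by apply: c2; rewrite inE.
- by move: pc2; rewrite continuous_open_subspace// => /(_ e); rewrite inE; apply.
Qed.

Lemma covering_continuous : continuous p.
Proof.
move=> e; have [V [A [g [[_ Vb] _ VA _ [_ Ag]]]]] := covering_sheets (p e).
by case/VA: Vb => /Ag[].
Qed.

Lemma covering_sheet (e : E) : exists (V : set B) (A : set E) (g : B -> E),
  [/\ open V /\ V (p e), open A /\ A e,
      forall c, V c -> [/\ A (g c), p (g c) = c & {for c, continuous g}] &
      forall e', A e' -> V (p e') /\ g (p e') = e'].
Proof.
have [V [A [g [[oV Vb] oA VA _ [gV Ag]]]]] := covering_sheets (p e).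
have [i Ai] : exists i, A i e by case/VA: (Vb) => h; [exists true|exists false].
exists V, (A i), (g i); split => //; first exact: gV.
by move=> e' Ae'; split; [apply/VA; case: i {Ai} Ae'; [left|right]|case: (Ag i e' Ae')].
Qed.

Lemma covering_separated (e e' : E) : p e = p e' -> e <> e' ->
  exists A A' : set E, [/\ open A /\ A e, open A' /\ A' e' & forall x, ~ (A x /\ A' x)].
Proof.
move=> ee ne; have [V [A [g [[oV Vb] oA VA dA [gV Ag]]]]] := covering_sheets (p e).
have inA i : ~ (A i e /\ A i e').
  by move=> [/Ag[h1 _] /Ag[h2 _]]; apply: ne; rewrite -h1 -h2 ee.
have Vb' : V (p e') by rewrite -ee.
case/VA: Vb => h; case/VA: Vb' => h'.
- by case: (inA true).
- by exists (A true), (A false); split.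
- by exists (A false), (A true); split => // x [? ?]; exact: (dA x).
- by case: (inA false).
Qed.

(** The other point of each fibre; near a point it is the section of the other sheet after [p],
    hence continuous. *)
Lemma covering_swap : exists sw : E -> E,
  [/\ continuous sw, forall e, sw e <> e, forall e, p (sw e) = p e &
      forall e e', p e = p e' -> e' = e \/ e' = sw e].
Proof.
have /choice[sw swE] : forall e, exists e', [/\ e' <> e, p e' = p e &
    forall e'', p e = p e'' -> e'' = e \/ e'' = e'].
  move=> e; have [V [A [g [[oV Vb] oA VA dA [gV Ag]]]]] := covering_sheets (p e).
  have [i Ai] : exists i, A i e by case/VA: (Vb) => h; [exists true|exists false].
  have [Ag' pg' _] := gV (~~ i) _ Vb.
  exists (g (~~ i) (p e)); split => //.
    move=> ge; rewrite ge in Ag'.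
    by apply: (dA e); case: i Ai Ag' {ge pg'} => Ai Ag'.
  move=> e'' ee; have : V (p e'') by rewrite -ee.
  case/VA => /[dup] h /Ag[] <- _; rewrite -ee.
    by case: i Ai {Ag' pg'} => Ai; [left; case: (Ag _ _ Ai)|right].
  by case: i Ai {Ag' pg'} => Ai; [right|left; case: (Ag _ _ Ai)].
exists sw; split => [e|e|e|e e']; [|by case: (swE e)..|by case: (swE e) => _ _; exact].
have [V [A [g [[oV Vb] oA VA dA [gV Ag]]]]] := covering_sheets (p e).
have [i Ai] : exists i, A i e by case/VA: (Vb) => h; [exists true|exists false].
have swg x : A i x -> sw x = g (~~ i) (p x).
  move=> Ax; have Vx : V (p x) by apply/VA; case: i {Ai} Ax; [left|right].
  have [Ag' pg' _] := gV (~~ i) _ Vx.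
  have [_ _ h] := swE x; have [gx|//] := h _ (esym pg').
  by rewrite gx in Ag'; case: (dA x); case: i {Ai} Ax Ag' {gx pg'} => Ax Ag'.
have cg : {for e, continuous (g (~~ i) \o p)}.
  by apply: continuous_comp; [exact: covering_continuous|case: (gV (~~ i) _ Vb)].
move=> W; rewrite swg// => nW.
have := cg W nW; have : nbhs e (A i) by exact: open_nbhs_nbhs.
by apply: filterS2 => x Ax; rewrite /= swg.
Qed.

(** The coincidence set is open because lifts stay in one sheet, and closed because distinct points
    of a fibre are separated. *)
Lemma unique_lift (X : topologicalType) (f g : X -> E) (a : X) :
  connected [set: X] -> continuous f -> continuous g ->
  (forall x, p (f x) = p (g x)) -> f a = g a -> forall x, f x = g x.
Proof.
move=> cX cf cg fg fa.
have o1 : open [set x | f x = g x].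
  rewrite openE => x /= fgx.
  have [V [A [h [_ [oA Ae] _ Ah]]]] := covering_sheet (f x).
  have n1 : nbhs x (f @^-1` A) by apply: cf; exact: open_nbhs_nbhs.
  have n2 : nbhs x (g @^-1` A) by apply: cg; rewrite -fgx; exact: open_nbhs_nbhs.
  move: n1 n2; apply: filterS2 => y Af Ag.
  by rewrite /= -(Ah _ Af).2 -(Ah _ Ag).2 fg.
have c1 : closed [set x | f x = g x].
  rewrite -openC openE => x /= fgx.
  have [A [A' [[oA Ae] [oA' Ae'] dA]]] := covering_separated (fg x) fgx.
  have n1 : nbhs x (f @^-1` A) by apply: cf; exact: open_nbhs_nbhs.
  have n2 : nbhs x (g @^-1` A') by apply: cg; exact: open_nbhs_nbhs.
  move: n1 n2; apply: filterS2 => y Af Ag /= h.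
  by apply: (dA (f y)); split => //; rewrite h.
have E0 := cX [set x | f x = g x] (ex_intro _ a fa)
  (ex_intro2 _ _ _ o1 (esym (setTI _))) (ex_intro2 _ _ _ c1 (esym (setTI _))).
by move=> x; have : [set: X] x by []; rewrite -E0.
Qed.

(** * Homotopy lifting for double coverings *)

Section HomotopyLifting.
Variables (R : realType) (X : topologicalType) (K : X * R -> B) (e0 : E).
Hypothesis cK : continuous K.
Hypothesis K_start : forall x (s : R), s <= 0 -> K (x, s) = p e0.

(** Time runs over all of [R], with the homotopy constant for [s <= 0], so that there is no initial
    endpoint to treat apart; the value [e0] there is the initial condition. *)
Let is_lift (N : set X) (t : R) (L : X * R -> E) :=
  forall x s, N x -> s < t ->
    [/\ {for (x, s), continuous L}, p (L (x, s)) = K (x, s) & (s <= 0 -> L (x, s) = e0)].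

Let liftable (x0 : X) (t : R) := exists N L, [/\ open N, N x0 & is_lift N t L].

(** The step [d] depends on [x0] and [t] but not on [t']; this is what the supremum argument below
    needs. *)
Let lift_step (x0 : X) (t : R) : exists2 d : R, 0 < d &
  forall t', t - d < t' -> liftable x0 t' -> liftable x0 (t + d).
Proof.
have [V [A [g [[oV Vb] oA VA dA [gV Ag]]]]] := covering_sheets (K (x0, t)).
have : nbhs (x0, t) (K @^-1` V) by apply: cK; exact: open_nbhs_nbhs.
case=> -[/= N1 T] [nN1 nT] NT.
have [d d0 dT] : exists2 d : R, 0 < d & forall s, t - d < s -> s < t + d -> T s.
  move: nT => /nbhs_ballP[d d0 dT]; exists d => // s h1 h2.
  by apply: dT; rewrite /ball/= ltr_distlC h1 h2.
exists d => // t' tt' [N [L [oN Nx0 HL]]].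
(* A time at which the old lift is still defined and the evenly covered set already applies; the two
   lifts are glued there. *)
pose s0 := (t - d + Num.min t' (t + d)) / 2.
have [ts0 s0t' s0t] : [/\ t - d < s0, s0 < t' & s0 < t + d].
  have h : t - d < Num.min t' (t + d) by rewrite lt_min tt'; move: d0; lra.
  have := midf_lt h; rewrite -/s0 lt_min => -[-> /andP[-> ->]].
  by [].
have Vs0 : V (p (L (x0, s0))).
  have [_ -> _] := HL x0 s0 Nx0 s0t'; apply: (NT (x0, s0)); split => /=.
    exact: nbhs_singleton nN1.
  exact: dT.
have [i Ai] : exists i, A i (L (x0, s0)).
  by case/VA: (Vs0) => h; [exists true|exists false].
have nN2 : nbhs x0 [set x | A i (L (x, s0))].
  have [cL _ _] := HL x0 s0 Nx0 s0t'.
  have : nbhs (x0, s0) (L @^-1` A i) by apply: cL; exact: open_nbhs_nbhs.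
  case=> -[/= N2 T2] [nN2 nT2] h; apply: filterS nN2 => x N2x.
  by apply: (h (x, s0)); split => //=; exact: nbhs_singleton nT2.
pose M := N `&` (interior N1 `&` interior [set x | A i (L (x, s0))]).
pose L' (z : X * R) := if z.2 <= s0 then L z else g i (K z).
have VK x s : M x -> t - d < s -> s < t + d -> V (K (x, s)).
  move=> [_ [/interior_subset N1x _]] h1 h2.
  by apply: (NT (x, s)); split => //; exact: dT.
have glue x : M x -> g i (K (x, s0)) = L (x, s0).
  move=> [Nx [_ /interior_subset Ax]].
  by have [_ <- _] := HL x s0 Nx s0t'; case: (Ag i _ Ax).
exists M, L'; split.
- by do ![apply: openI => //; try exact: open_interior].
- by split => //; split.
move=> x s Mx st; have Nx : N x by case: Mx.
have [ss0|s0s|ss0] := ltgtP s s0.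
- have [cL pL sL] := HL x s Nx (lt_trans ss0 s0t').
  have LE : L' (x, s) = L (x, s) by rewrite /L' /= (ltW ss0).
  split; rewrite ?LE// => W; rewrite LE => /cL; rewrite /nbhs/=.
  have : nbhs (x, s) [set z : X * R | z.2 < s0].
    by apply: (cvgr_lt s (@snd_continuous X R (x, s))).
  by apply: filterS2 => z zs; rewrite /= /L' (ltW zs).
- have Vs : V (K (x, s)) by apply: VK => //; exact: lt_trans ts0 s0s.
  have [Ags pgs cgs] := gV i _ Vs.
  have LE : L' (x, s) = g i (K (x, s)) by rewrite /L' /= leNgt s0s.
  split; rewrite ?LE//.
    have cgK : {for (x, s), continuous (g i \o K)}.
      by apply: continuous_comp => //; exact: cK.
    move=> W; rewrite LE => /cgK; rewrite /nbhs/=.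
    have : nbhs (x, s) [set z : X * R | s0 < z.2].
      by apply: (cvgr_gt s (@snd_continuous X R (x, s))).
    by apply: filterS2 => z zs; rewrite /= /L' leNgt zs.
  (* If the gluing time is itself nonpositive, the homotopy is constant up to [s], and the new sheet
     still gives [e0]. *)
  move=> sle; have s00 : s0 <= 0 by exact: ltW (lt_le_trans s0s sle).
  rewrite (K_start x sle) -(K_start x s00) glue//.
  by have [_ _ ->] := HL x s0 Nx s0t'.
subst s; have [cL pL sL] := HL x s0 Nx s0t'.
have LE : L' (x, s0) = L (x, s0) by rewrite /L' /= lexx.
split; rewrite ?LE// => W; rewrite LE => nW.
have Vs : V (K (x, s0)) by apply: VK.
have [Ags pgs cgs] := gV i _ Vs.
have cgK : {for (x, s0), continuous (g i \o K)}.
  by apply: continuous_comp => //; exact: cK.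
have n1 := cL W nW; have n2 : nbhs (x, s0) ((g i \o K) @^-1` W).
  by apply: cgK; rewrite /= glue.
suff : nbhs (x, s0) (L' @^-1` W) by [].
move: n1 n2; rewrite /nbhs/=; apply: filterS2 => z Lz gz.
by rewrite /= /L'; case: ifP.
Qed.

(** Were some time out of reach, the supremum of the liftable times could be exceeded by
    [lift_step]. *)
Let liftable_all (x0 : X) (t : R) : liftable x0 t.
Proof.
apply: contrapT => nt.
have mono a b : a <= b -> liftable x0 b -> liftable x0 a.
  move=> ab [N [L [oN Nx HL]]]; exists N, L; split => // x s Nx' sa.
  by apply: HL => //; exact: lt_le_trans ab.
have lift0 : liftable x0 0.
  exists setT, (fun=> e0); split => //; first exact: openT.
  move=> x s _ s0; split => //; first exact: cst_continuous.
  by rewrite K_start// ltW.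
have hs : has_sup [set s | liftable x0 s].
  split; first by exists 0.
  exists t => s /= ls; rewrite leNgt; apply/negP => ts; apply: nt.
  exact: mono (ltW ts) ls.
have [d d0 Hd] := lift_step x0 (sup [set s | liftable x0 s]).
have [s ls ds] := sup_adherent d0 hs.
have h := Hd s ds ls.
have := sup_upper_bound hs h.
by rewrite gerDl leNgt d0.
Qed.

(** Local lifts around different points agree at time 1, by uniqueness of lifts along the time line,
    and therefore glue. *)
Lemma homotopy_lifting :
  exists2 L : X -> E, continuous L & forall x, p (L x) = K (x, 1).
Proof.
(* Lifting up to time 2 makes time 1 interior. *)
have /choice[N /choice[L NL]] := fun x => liftable_all x 2.
have path_unique x y z : N x z -> N y z -> L x (z, 1) = L y (z, 1).
  move=> Nxz Nyz.
  (* The path is frozen after time 1, since the lift is controlled only before time 2. *)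
  pose a w (s : R) := L w (z, Num.min s 1).
  have ca w : N w z -> continuous (a w).
    move=> Nwz s; have [oN _ HL] := NL w.
    have [|cL _ _] := HL z (Num.min s 1) Nwz; first by rewrite gt_min ltr1n orbT.
    apply: (@continuous_comp R (X * R)%type E (fun s => (z, Num.min s 1)) (L w)) => //.
    apply: (@cvg_pair _ _ _ (nbhs s) (nbhs z) (nbhs (Num.min s 1)) _ _ _
      (fun=> z) (fun s => Num.min s 1)); first exact: cst_continuous.
    have cm : {for s, continuous ((id : R -> R^o) \min (cst 1 : R -> R^o))}.
      by apply: continuous_min; [exact: cvg_id|exact: cst_continuous].
    exact: cm.
  have cR : connected [set: R] by apply/connected_intervalP.
  have -> : L x (z, 1) = a x 1 by rewrite /a minxx.
  have -> : L y (z, 1) = a y 1 by rewrite /a minxx.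
  have m2 (s : R) : Num.min s 1 < 2 by rewrite gt_min ltr1n orbT.
  apply: (unique_lift (a := 0) cR (ca x Nxz) (ca y Nyz)).
    move=> s; have [_ _ HL] := NL x; have [_ -> _] := HL z _ Nxz (m2 s).
    by have [_ _ HL'] := NL y; have [_ -> _] := HL' z _ Nyz (m2 s).
  have [_ _ HL] := NL x; have [_ _ HL'] := NL y.
  rewrite /a min_l//.
  have [|_ _ ->//] := HL z 0 Nxz; first by rewrite ltr0n.
  by have [|_ _ ->//] := HL' z 0 Nyz; first by rewrite ltr0n.
exists (fun x => L x (x, 1)).
  move=> x W; have [oN Nx HL] := NL x.
  have [|cL _ _] := HL x 1 Nx; first by rewrite ltr1n.
  move=> nW; have := cL W nW; case=> -[/= M T] [nM nT] MT.
  have : nbhs x (N x) by exact: open_nbhs_nbhs.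
  move: nM; apply: filterS2 => y My Ny.
  have [_ Nyy _] := NL y.
  rewrite /= (path_unique y x y)//; apply: (MT (y, 1)); split => //=.
  exact: nbhs_singleton nT.
by move=> x; have [_ Nx HL] := NL x; have [|_ -> _] := HL x 1 Nx; rewrite ?ltr1n.
Qed.

End HomotopyLifting.

End DoubleCoverings.

(** * The infinite sphere covers the configurations *)

Section QuotientTools.

Lemma quot_lift (T : topologicalType) (r : T -> T -> Prop) (Z : topologicalType)
    (f : T -> Z) : (forall x y, r x y -> f x = f y) -> continuous f ->
  exists2 h : quot_space r -> Z, continuous h & forall x, h (quot_proj r x) = f x.
Proof.
move=> fr cf; pose h (z : quot_space r) := f (repr z).
have gen a b : generated r a b -> f a = f b.
  by elim=> {a b} [a b /fr|a|a b _ ->|a b c _ -> _ ->].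
have hE x : h (quot_proj r x) = f x.
  by apply: gen; apply/quot_projP; exact: quot_proj_repr.
exists h => //; apply/continuousP => U oU; apply/quot_open.
have -> : quot_proj r @^-1` (h @^-1` U) = f @^-1` U.
  by apply/seteqP; split => x; rewrite /preimage /= hE.
exact: (iffLR (continuousP _) cf).
Qed.

Lemma quot_proj_continuous (T : topologicalType) (r : T -> T -> Prop) :
  continuous (quot_proj r).
Proof. by apply/continuousP => U /quot_open. Qed.

Lemma hausdorff_separated (R : realType) (X : topologicalType) :
  (forall p q : X, p <> q -> exists2 f : X -> R, continuous f & f p <> f q) ->
  hausdorff_space X.
Proof.
move=> H p q pq; apply: contrapT => /H[f cf]; apply.
apply: (@Rhausdorff R) => A B nA nB.
have [x [Ax Bx]] := pq _ _ (cf p _ nA) (cf q _ nB).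
by exists (f x).
Qed.

Lemma continuous_ptws (X : topologicalType) (J : eqType) (Y : topologicalType)
    (f : X -> {ptws J -> Y}) :
  (forall j, continuous (fun x => f x j)) -> continuous f.
Proof.
move=> cf x; apply/cvg_sup => j; apply/cvg_image.
  by apply/seteqP; split => // y _; exists (fun=> y).
move=> A /= nA; rewrite /nbhs/=; exists ((fun g : {ptws J -> Y} => g j) @^-1` A).
  exact: (cf j x).
by apply/seteqP; split => [z [g Ag <-]//|z Az]; exists (fun=> z).
Qed.

End QuotientTools.

Section ProjectiveConfigurations.
Variable R : realType.
Notation I := (unit_itv R).

(** Two polynomials agreeing at 0 and 1 separate points: [P1] determines [x] up to [x |-> 1 - x],
    and [P2], which is odd under this reflection, tells the two apart except at the glued ends. *)
Lemma RP1_hausdorff : hausdorff_space (RP1 R).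
Proof.
have lift_fun (P : R -> R) : continuous P -> P 0 = P 1 ->
    exists2 h : RP1 R -> R, continuous h & forall t, h (RP1_pt t) = P (set_val t).
  move=> cP P01; apply: quot_lift => [s t [-> ->]//|t].
  apply: (@continuous_comp I R R set_val P); first exact: set_val_continuous.
  exact: cP.
pose P1 (x : R) := x * (1 - x); pose P2 (x : R) := x * (1 - x) * (1 - 2 * x).
have c1 : continuous P1.
  move=> x; apply: cvgM; first exact: cvg_id.
  by apply: cvgB; [exact: cvg_cst|exact: cvg_id].
have c2 : continuous P2.
  move=> x; apply: cvgM; first exact: c1.
  apply: cvgB; first exact: cvg_cst.
  by apply: cvgM; [exact: cvg_cst|exact: cvg_id].
have [|h1 ch1 h1E] := lift_fun P1 c1; first by rewrite /P1; ring.
have [|h2 ch2 h2E] := lift_fun P2 c2; first by rewrite /P2; ring.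
apply: (@hausdorff_separated R) => a b ab.
apply: contrapT => H.
have e1 : h1 a = h1 b by apply: contrapT => h; apply: H; exists h1.
have e2 : h2 a = h2 b by apply: contrapT => h; apply: H; exists h2.
have aE : RP1_pt (repr a : I) = a by exact: quot_proj_repr.
have bE : RP1_pt (repr b : I) = b by exact: quot_proj_repr.
move: (repr a : I) (repr b : I) aE bE => s t aE bE.
apply: ab; move: e1 e2; rewrite -aE -bE !h1E !h2E.
have -> : P2 (set_val s) = P1 (set_val s) * (1 - 2 * set_val s) by [].
have -> : P2 (set_val t) = P1 (set_val t) * (1 - 2 * set_val t) by [].
move=> e1; rewrite e1.
have : (set_val s - set_val t) * (1 - set_val s - set_val t) = 0.
  by move: e1; rewrite /P1 => e1; nra.
move/eqP; rewrite mulf_eq0 => /orP[/eqP st _|/eqP st].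
  by congr RP1_pt; apply: val_inj; rewrite -!set_valE; lra.
move/eqP; rewrite -subr_eq0 -mulrBr mulf_eq0 => /orP[|/eqP e3]; last first.
  by congr RP1_pt; apply: val_inj; rewrite -!set_valE; lra.
rewrite /P1 mulf_eq0 => /orP[] /eqP t0; apply: RP1_pt_ends.
- by right; lra.
- by left.
- by left; lra.
- by right; lra.
Qed.

Lemma config_pt_continuous n :
  continuous ((fun t i => RP1_pt (t i)) : cube R n -> {ptws 'I_n -> RP1 R}).
Proof.
apply: continuous_ptws => j t.
apply: (@continuous_comp (cube R n) I (RP1 R) (fun t => t j) (@RP1_pt R)).
  exact: cube_coord_continuous.
exact: quot_proj_continuous.
Qed.

Lemma config_continuous k : continuous (@config R k).
Proof.
move=> t; apply: (@continuous_comp (cube R k.*2.+1) {ptws 'I_k.*2.+1 -> RP1 R} (Cinf R)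
  (fun t i => RP1_pt (t i)) (@Cinf_class R k)).
  exact: config_pt_continuous.
apply: (@continuous_comp {ptws 'I_k.*2.+1 -> RP1 R} (Cfin R k) (Cinf R)
  (@Cfin_class R k) (@dirlim_inj _ (@Cfin_incl R) k)).
  exact: quot_proj_continuous.
exact: dirlim_inj_continuous.
Qed.

(** The cube is compact and the power of the projective line is Hausdorff, so the projection between
    them is closed, and openness can be tested on the cube. *)
Lemma config_quotient (V : set (Cinf R)) :
  (forall k, open (@config R k @^-1` V)) -> open V.
Proof.
move=> H; apply/dirlim_openP => k; apply/quot_open.
set W := (X in open X).
pose pr := (fun t i => RP1_pt (t i)) : cube R k.*2.+1 -> {ptws 'I_k.*2.+1 -> RP1 R}.
have prs x : exists t, pr t = x.
  by exists (fun i => repr (x i) : I); apply/funext => i; exact: quot_proj_repr.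
have -> : W = ~` (pr @` ~` (@config R k @^-1` V)).
  apply/seteqP; split => [x Wx [t nt tx]|x nx].
    by apply: nt; rewrite /preimage /=; move: Wx; rewrite -tx.
  have [t tx] := prs x; apply: contrapT => nW; apply: nx; exists t => //.
  by move=> ct; apply: nW; rewrite -tx.
apply: closed_openC; apply: compact_closed.
  exact: (@hausdorff_product 'I_k.*2.+1 (fun=> RP1 R) (fun=> RP1_hausdorff)).
apply: continuous_compact.
  exact/continuous_subspaceT/config_pt_continuous.
rewrite -[X in compact X]setTI; apply: compact_closedI; first exact: cube_compact.
exact: open_closedC.
Qed.

End ProjectiveConfigurations.

Section SphereOverConfigurations.
Variable R : realType.
Notation I := (unit_itv R).
Notation Soo := (sphere_infty R).

Lemma sphere_incl_continuous k : continuous (@sphere_incl R k).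
Proof.
apply: continuous_set_type; apply: continuous_rV => i.
have -> : (fun x => (set_val \o @sphere_incl R k) x ord0 i) =
    (fun x : sphere R k => scoord x i).
  by apply/funext => x; rewrite -(scoord_incl x) scoord_ord.
exact: scoord_continuous.
Qed.

(** By compactness [to_sphere] is a closed surjection, so continuity on a sphere can be tested on
    states. *)
Lemma Soo_continuous (T : topologicalType) (h : Soo -> T) :
  (forall k, continuous (fun y : state R k.*2.+1 => h (to_Soo y))) -> continuous h.
Proof.
move=> ch; apply: dirlim_continuous.
have odd_case j : continuous (fun x : sphere R j.*2.+1 => h (dirlim_inj _ x)).
  move=> x0; apply: (@compact_quotient_continuous (state R j.*2.+1) _ _ setT
    (@to_sphere R _) (fun y => h (to_Soo y))).
  - exact: sphere_hausdorff.
  - exact: state_compact.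
  - exact: to_sphere_continuous.
  - exact: ch.
  - by [].
  have -> : to_sphere (n:=j.*2.+1) @` setT = [set: sphere R j.*2.+1]; last exact: filterT.
  by apply/seteqP; split => // x _; have [y yx] := to_sphere_surj x; exists y.
move=> k; rewrite -(odd_double_half k); case: (odd k) => /=; first exact: odd_case.
(* An even-dimensional sphere is handled through its inclusion in the next one. *)
rewrite add0n.
have -> : (fun x : sphere R (k./2).*2 => h (dirlim_inj (@sphere_incl R) x)) =
  (fun x => h (dirlim_inj (@sphere_incl R) x)) \o @sphere_incl R _.
  by apply/funext => x; rewrite /= dirlim_injS.
move=> x; apply: continuous_comp; first exact: sphere_incl_continuous.
exact: odd_case.
Qed.

Lemma Soo_antipode : exists nu : Soo -> Soo,
  [/\ continuous nu, (forall z i, icoord (nu z) i = - icoord z i) &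
      forall k (y : state R k), nu (to_Soo y) = to_Soo (sopp y)].
Proof.
have /choice[nu nuE] : forall z : Soo, exists z', forall i, icoord z' i = - icoord z i.
  move=> z; have [k [y <-]] := to_Soo_surj z.
  by exists (to_Soo (sopp y)) => i; rewrite to_Soo_opp.
have nuS k (y : state R k) : nu (to_Soo y) = to_Soo (sopp y).
  by apply: icoord_inj; apply/funext => i; rewrite nuE to_Soo_opp.
exists nu; split => //; apply: Soo_continuous => k y.
have -> : (fun y : state R k.*2.+1 => nu (to_Soo y)) = (@to_Soo R _) \o (@sopp R _).
  by apply/funext => z; rewrite nuS.
apply: (@continuous_comp (state R k.*2.+1) (state R k.*2.+1)); last exact: to_Soo_continuous.
have cneg : continuous (fun y : bool * cube R k.*2.+1 => ~~ y.1).
  move=> z; apply: (@continuous_comp (bool * cube R k.*2.+1)%type bool bool fst negb).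
    exact: fst_continuous.
  by move=> P nP; apply/principal_filterP; exact: nbhs_singleton nP.
case: y => b t; apply: (@cvg_pair _ _ _ (nbhs (b, t)) (nbhs (~~ b)) (nbhs t) _ _ _
  (fun y : bool * cube R k.*2.+1 => ~~ y.1) (fun y => y.2)); last exact: cvg_snd.
exact: (cneg (b, t)).
Qed.

(** The map [q] forgets the bit of a state. Two states have the same configuration exactly when
    their moments agree up to a global sign, that is, when their points are equal or antipodal. *)
Lemma sphere_double_covers_configurations :
  exists (q : Soo -> Cinf R) (nu : Soo -> Soo),
  [/\ [/\ continuous nu, involutive nu &
        forall x, exists U : set Soo, [/\ open U, U x & forall z, U z -> ~ U (nu z)]],
      (forall b, exists x, q x = b),
      (forall x y, q x = q y <-> y = x \/ y = nu x) &
      (forall V : set (Cinf R), open V <-> open (q @^-1` V))].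
Proof.
have [nu [cnu nuE nuS]] := Soo_antipode.
have same k m (y : state R k.*2.+1) (z : state R m.*2.+1) :
    config y.2 = config z.2 <-> to_Soo z = to_Soo y \/ to_Soo z = nu (to_Soo y).
  split=> [/config_simP/sim_momentP[b H]|H].
    have e : y.1 (+) b (+) z.1 = false \/ y.1 (+) b (+) z.1 = true.
      by case: (_ (+) _ (+) _); [right|left].
    have E i : smoment i y = (-1) ^+ (y.1 (+) b (+) z.1) * smoment i z.
      by rewrite /smoment H !signr_addb -!mulrA (mulrA (_ ^+ z.1)) signr_sq mul1r.
    case: e E => -> E; [left|right]; rewrite ?nuS; apply/to_Soo_eqP => i.
      by rewrite E expr0 mul1r.
    by rewrite smoment_opp E expr1 mulN1r opprK.
  apply/config_simP/sim_momentP.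
  have E (b : bool) : (forall i, smoment i z = (-1) ^+ b * smoment i y) ->
    exists b : bool, forall i, moment i (breaks y.2) = (-1) ^+ b * moment i (breaks z.2).
    move=> h; exists (y.1 (+) b (+) z.1) => i.
    have := h i; rewrite /smoment !signr_addb -!mulrA => ->.
    by rewrite (mulrA (_ ^+ b)) signr_sq mul1r mulrA signr_sq mul1r.
  case: H => [/to_Soo_eqP H|]; first by apply: (E false) => i; rewrite expr0 mul1r.
  rewrite nuS => /to_Soo_eqP H; apply: (E true) => i.
  by rewrite expr1 mulN1r -smoment_opp.
have /choice[q qz] : forall z : Soo, exists c, forall k (y : state R k.*2.+1),
    to_Soo y = z -> c = config y.2.
  move=> z; have [k [y yz]] := to_Soo_surj z; exists (config y.2) => m y' y'z.
  by apply/same; left; rewrite y'z.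
have qE k (y : state R k.*2.+1) : q (to_Soo y) = config y.2 by exact: qz.
have cq : continuous q.
  apply: Soo_continuous => k y.
  have -> : (fun y : state R k.*2.+1 => q (to_Soo y)) = (@config R k) \o snd.
    by apply/funext => z; rewrite qE.
  apply: (@continuous_comp (bool * cube R k.*2.+1)%type); first exact: snd_continuous.
  exact: config_continuous.
exists q, nu; split.
- split => // [z|x].
    by apply: icoord_inj; apply/funext => i; rewrite !nuE opprK.
  have [n [x0 xE]] := dirlim_ex x.
  (* The open hemisphere centred at [x] is disjoint from its antipode; finitely many coordinates
     suffice because those of [x] vanish beyond [n]. *)
  pose ip (z : Soo) := \sum_(i < n.+1) icoord x i * icoord z i.
  have cip : continuous ip.
    apply: (@continuous_sum R Soo _ _ (fun (i : 'I_n.+1) z => icoord x i * icoord z i)) => i z.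
    apply: (@continuousM R Soo (fun=> icoord x i) (fun z => icoord z i)).
      exact: cst_continuous.
    exact: icoord_continuous.
  exists (ip @^-1` [set r | 0 < r]); split.
  - by apply: open_comp; [move=> z _; exact: cip|exact: open_gt].
  - have ip1 : ip x = 1.
      rewrite -(sphere_sum x0); apply: eq_bigr => i _.
      by rewrite xE icoordE scoord_ord expr2.
    by rewrite /preimage /= ip1.
  move=> z; rewrite /preimage /= => z0.
  have -> : ip (nu z) = - ip z.
    by rewrite /ip -sumrN; apply: eq_bigr => i _; rewrite nuE mulrN.
  by rewrite oppr_gt0 => /(lt_trans z0); rewrite ltxx.
- move=> c; have [k [t tc]] := config_surj c.
  by exists (to_Soo ((true, t) : state R k.*2.+1)); rewrite qE.
- move=> x y; have [k [a <-]] := to_Soo_surj x; have [m [b <-]] := to_Soo_surj y.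
  by rewrite !qE; exact: same.
move=> V; split=> [oV|oV]; first by apply: open_comp => // z _; exact: cq.
apply: config_quotient => k.
have -> : @config R k @^-1` V =
    (fun t : cube R k.*2.+1 => to_Soo ((true, t) : state R k.*2.+1)) @^-1` (q @^-1` V).
  by apply/seteqP; split => t; rewrite /preimage /= qE.
apply: open_comp => // t _.
apply: (@continuous_comp (cube R k.*2.+1) (state R k.*2.+1) Soo (fun t => (true, t))).
  apply: (@cvg_pair _ _ _ (nbhs t) (nbhs true) (nbhs t) _ _ _ (fun=> true) id).
    exact: cst_continuous.
  exact: cvg_id.
exact: to_Soo_continuous.
Qed.

End SphereOverConfigurations.

(** * Uniqueness of the connected double covering *)

Section ConnectedSpheres.
Variable R : realType.
Notation I := (unit_itv R).

Lemma connectedR : connected [set: R].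
Proof. by apply/connected_intervalP. Qed.

Lemma connected_range (T : topologicalType) (f : R -> T) : continuous f -> connected (range f).
Proof.
move=> cf; apply: connected_continuous_connected; first exact: connectedR.
exact: continuous_subspaceT.
Qed.

Lemma connected_star (T : topologicalType) (a : T) :
  (forall x, exists C : set T, [/\ connected C, C a & C x]) -> connected [set: T].
Proof.
move=> /choice[C HC]; have -> : [set: T] = \bigcup_(x in [set: T]) C x.
  by apply/seteqP; split => // x _; exists x => //; case: (HC x).
apply: bigcup_connected; last by move=> x _; case: (HC x).
by exists a => x _; case: (HC x).
Qed.

Let ray n (t : cube R n) (s : R) : cube R n := fun i => clamp (s * set_val (t i)).

Let ray_continuous n (t : cube R n) : continuous (ray t).
Proof.
apply: (@continuous_ptws R 'I_n I) => j s.
apply: (@continuous_comp R R I (fun s => s * set_val (t j)) (@clamp R)).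
  by apply: (@continuousM _ _ id (fun=> set_val (t j))); [exact: cvg_id|exact: cst_continuous].
exact: clamp_continuous.
Qed.

Let to_sphere_path n (b : bool) (t : cube R n) :
  exists C : set (sphere R n), [/\ connected C, C (to_sphere ((b, (fun=> clamp 0)) : state R n)) &
    C (to_sphere ((b, t) : state R n))].
Proof.
exists (range (fun s => to_sphere ((b, ray t s) : state R n))); split.
- apply: connected_range => s.
  apply: (@continuous_comp R (state R n) _ (fun s => (b, ray t s))); last exact:
    to_sphere_continuous.
  apply: (@cvg_pair _ _ _ (nbhs s) (nbhs b) (nbhs (ray t s)) _ _ _ (fun=> b)).
    exact: cst_continuous.
  exact: ray_continuous.
- by exists 0 => //; congr (to_sphere (_, _)); apply/funext => i; rewrite /ray mul0r.
- by exists 1 => //; congr (to_sphere (_, _)); apply/funext => i; rewrite /ray mul1r clampK.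
Qed.

(** Shrinking all jumps to 0 joins each state to a constant function, and moving one jump from 0 to
    1 joins the two constants. The latter requires a jump, hence positive dimension. *)
Lemma sphere_connected n : connected [set: sphere R n.+1].
Proof.
pose z b := to_sphere ((b, (fun=> clamp 0)) : state R n.+1).
(* A single jump at 1 reverses the sign everywhere: with positive bit this is the constant -1. *)
pose t1 : cube R n.+1 := fun i => if i == ord0 then clamp 1 else clamp 0.
have zt1 : to_sphere ((false, t1) : state R n.+1) = z true.
  have : to_Soo ((false, t1) : state R n.+1) = to_Soo ((true, (fun=> clamp 0)) : state R n.+1).
    apply/to_Soo_eqP => i; rewrite /smoment /= expr0 expr1 mul1r mulN1r.
    have c0 : set_val (clamp (0 : R)) = 0 by rewrite clampE// lexx ler01.
    have c1 : set_val (clamp (1 : R)) = 1 by rewrite clampE// lexx ler01.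
    rewrite /breaks enum_ordSl /= /t1 eqxx c0 c1.
    have -> : [seq set_val (if j == ord0 then clamp 1 else clamp 0) | j <- [seq lift ord0 j | j
      <- enum 'I_n]]
        = [seq (0 : R) | j <- [seq lift ord0 j | j <- enum 'I_n]].
      by apply/eq_in_map => _ /mapP[j _ ->]; rewrite c0.
    rewrite /moment flip_cons1 flip_cons0 ?expr0n//.
    by apply/allP => x /mapP[j _ ->].
  move=> h; apply: scoord_inj; apply/funext => i.
  by rewrite -!icoordE -/(to_Soo _) h.
apply: (@connected_star _ (z true)) => x; have [[b t] <-] := to_sphere_surj x.
have [C [cC Cz Ct]] := to_sphere_path b t.
case: b cC Cz Ct => cC Cz Ct; first by exists C.
have [D [cD Dz Dt1]] := to_sphere_path false t1.
exists (D `|` C); split; [|by left; rewrite -zt1|by right].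
by apply: connectedU => //; exists (z false).
Qed.

Lemma sphere0_inhabited : sphere R 0.
Proof. exact: (to_sphere (state_inhabited R 0)). Qed.

Lemma Soo_connected : connected [set: sphere_infty R].
Proof.
pose a : sphere_infty R := dirlim_inj _ sphere0_inhabited.
apply: (@connected_star _ a) => z; have [k [x ->]] := dirlim_ex z.
exists (range (@dirlim_inj _ (@sphere_incl R) k.+1)); split.
- apply: connected_continuous_connected; first exact: sphere_connected.
  exact/continuous_subspaceT/dirlim_inj_continuous.
- have [x' x'a] := dirlim_inj_lift (@sphere_incl R) sphere0_inhabited (leq0n k.+1).
  by exists x'.
- by exists (sphere_incl x) => //; rewrite dirlim_injS.
Qed.

End ConnectedSpheres.

Section Cones.
Variable R : realType.

Definition cone_vec k (x : 'rV[R]_k.+1) (s : R) : 'rV[R]_k.+2 :=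
  \row_i (if insub (val i) is Some j then s * x ord0 j else Num.sqrt (1 - s ^+ 2)).

Lemma cone_vec_sphere k (x : sphere R k) (s : unit_itv R) :
  \sum_i cone_vec (set_val x) (set_val s) ord0 i ^+ 2 = 1.
Proof.
have /andP[s0 s1] := unit_itvP s.
rewrite big_ord_recr /= mxE insubN ?ltnn// sqr_sqrtr ?subr_ge0 ?expr_le1//.
have -> : \sum_(i < k.+1) cone_vec (set_val x) (set_val s) ord0 (widen_ord (leqnSn k.+1) i) ^+ 2
    = set_val s ^+ 2.
  transitivity (set_val s ^+ 2 * \sum_i set_val x ord0 i ^+ 2); last first.
    by rewrite sphere_sum mulr1.
  by rewrite mulr_sumr; apply: eq_bigr => i _; rewrite mxE /= valK exprMn.
by rewrite addrC subrK.
Qed.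

(* A null-homotopy of the inclusion of the sphere in the next one. *)
Definition cone k (z : sphere R k * R) : sphere R k.+1 :=
  mk_sphere (cone_vec_sphere z.1 (clamp z.2)).

Lemma cone_continuous k : continuous (@cone k).
Proof.
have cs : continuous (fun z : sphere R k * R => set_val (clamp z.2)).
  move=> z; apply: (@continuous_comp (sphere R k * R)%type R R snd (fun s => set_val (clamp s))).
    exact: snd_continuous.
  apply: (@continuous_comp R (unit_itv R) R (@clamp R) set_val).
    exact: clamp_continuous.
  exact: set_val_continuous.
apply: continuous_set_type; apply: continuous_rV => i.
case: (insubP 'I_k.+1 (val i)) => [j _ ji|ni].
  have -> : (fun z => (set_val \o @cone k) z ord0 i) =
      (fun z : sphere R k * R => set_val (clamp z.2) * set_val z.1 ord0 j).
    by apply/funext => z; rewrite /= mk_sphereE mxE -ji valK.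
  move=> z; apply: (@continuousM R (sphere R k * R)%type _ (fun z => set_val z.1 ord0 j)).
    exact: cs.
  apply: (@continuous_comp (sphere R k * R)%type 'rV[R]_k.+1 R (fun z => set_val z.1)
    (fun v => v ord0 j)).
    apply: (@continuous_comp (sphere R k * R)%type (sphere R k) _ fst set_val).
      exact: fst_continuous.
    exact: set_val_continuous.
  exact: coord_continuous.
have -> : (fun z => (set_val \o @cone k) z ord0 i) =
    (fun z : sphere R k * R => Num.sqrt (1 - set_val (clamp z.2) ^+ 2)).
  by apply/funext => z; rewrite /= mk_sphereE mxE insubN.
move=> z; apply: (@continuous_comp (sphere R k * R)%type R R (fun z => 1 - set_val (clamp z.2) ^+
  2)); last exact: sqrt_continuous.
apply: (@continuousB R R (sphere R k * R)%type (fun=> 1)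
  (fun z => set_val (clamp z.2) ^+ 2)); first exact: cst_continuous.
apply: (@continuous_comp (sphere R k * R)%type R R (fun z => set_val (clamp z.2))
  (fun x => x ^+ 2)); first exact: cs.
exact: exprn_continuous.
Qed.

Lemma cone1 k (x : sphere R k) : cone (x, 1) = sphere_incl x.
Proof.
apply: scoord_inj; apply/funext => i.
have [ki|] := ltnP k.+1 i; first by rewrite !scoord_out.
rewrite -ltnS => ki; rewrite -[i]/(val (Ordinal ki)) !scoord_ord mk_sphereE /=.
rewrite clampE ?lexx ?ler01//.
have -> : set_val (sphere_incl x) = append0 (set_val x) by [].
rewrite !mxE; case: insubP => // [j _ _|_].
  by rewrite mul1r.
by rewrite expr1n subrr sqrtr0.
Qed.

(** All nonpositive times are included so that the cone meets the initial condition of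
    [homotopy_lifting]. *)
Lemma cone0 k (x y : sphere R k) (s : R) : s <= 0 -> cone (x, s) = cone (y, 0).
Proof.
move=> s0; apply: scoord_inj; apply/funext => i.
have [ki|] := ltnP k.+1 i; first by rewrite !scoord_out.
rewrite -ltnS => ki; rewrite -[i]/(val (Ordinal ki)) !scoord_ord !mk_sphereE /=.
have -> : clamp s = clamp 0.
  apply: val_inj => /=; rewrite !min_r ?ler01// ?(le_trans s0)//.
  by rewrite maxxx max_l.
rewrite clampE ?lexx ?ler01// !mxE; case: insubP => // j _ _.
by rewrite !mul0r.
Qed.

End Cones.

Section Classification.
Variables (R : realType) (E : topologicalType) (p : E -> Cinf R).
Notation Soo := (sphere_infty R).
Hypothesis p_cov : double_covering p.
Hypothesis E_conn : connected [set: E].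

(* Lift the double covering of the configurations by the sphere through [p].  If the
   lift identified antipodes, its image and the swapped image would disconnect [E]. *)
Lemma covering_homeomorphic : homeomorphic E Soo.
Proof.
have [q [nu [[cnu nuK nu_free] q_surj q_eq q_open]]] := sphere_double_covers_configurations R.
have cq := quotient_by_involution_continuous q_open.
have q_nu := quotient_by_involution_nu q_eq.
have q_im := quotient_by_involution_open cnu nuK q_eq q_open.
have cp := covering_continuous p_cov.
have [sw [csw sw_ne psw sw_eq]] := covering_swap p_cov.
have p_surj b : exists e, p e = b.
  have [V [A [g [[oV Vb] oA VA dA [gV Ag]]]]] := covering_sheets p_cov b.
  by have [_ h _] := gV true _ Vb; exists (g true b).
(* The map to the configurations extends over the cone, so it is homotopic to a constant and the
   constant lift can be carried along. *)
have lift_k k : exists2 L : sphere R k -> E, continuous L &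
    forall x, p (L x) = q (dirlim_inj _ x).
  have [x0 _] := to_sphere_surj (to_sphere (state_inhabited R k)).
  pose y0 := to_sphere x0.
  have [e0 e0E] := p_surj (q (dirlim_inj _ (cone (y0, 0)))).
  pose K (z : sphere R k * R) := q (dirlim_inj (@sphere_incl R) (cone z)).
  have cK : continuous K.
    move=> z; apply: (@continuous_comp _ _ _ (fun z => dirlim_inj (@sphere_incl R) (cone z)) q);
      last exact: cq.
    apply: (@continuous_comp _ _ _ (@cone R k)); first exact: cone_continuous.
    exact: dirlim_inj_continuous.
  have [|L cL LE] := @homotopy_lifting _ _ _ p_cov R _ K e0 cK.
    by move=> x s s0; rewrite e0E /K (cone0 _ y0 s0).
  by exists L => // x; rewrite LE /K cone1 dirlim_injS.
pose z0 : Soo := dirlim_inj _ (sphere0_inhabited R).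
have [e0 e0E] := p_surj (q z0).
(* A lift through the wrong point of the fibre is corrected by the swap. *)
have based k (x0 : sphere R k) : dirlim_inj _ x0 = z0 ->
    exists L : sphere R k -> E, [/\ continuous L,
    forall x, p (L x) = q (dirlim_inj _ x) & L x0 = e0].
  move=> x0z; have [L cL pL] := lift_k k.
  have [e|e] := sw_eq (L x0) e0 (etrans (pL x0) (etrans (congr1 q x0z) (esym e0E))).
    by exists L.
  exists (sw \o L); split => // [x|x /=]; last by rewrite psw.
  by apply: (@continuous_comp _ _ _ L sw); [exact: cL|exact: csw].
have xH k : exists x0 : sphere R k, dirlim_inj (@sphere_incl R) x0 = z0.
  exact: dirlim_inj_lift.
pose x_ k := sval (cid (xH k)); have x_E k : dirlim_inj (@sphere_incl R) (x_ k) = z0.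
  exact: (svalP (cid (xH k))).
pose L_ k := sval (cid (based k (x_ k) (x_E k))).
have L_E k : [/\ continuous (L_ k), forall x, p (L_ k x) = q (dirlim_inj _ x) &
    L_ k (x_ k) = e0] := svalP (cid (based k (x_ k) (x_E k))).
have x_S k : sphere_incl (x_ k) = x_ k.+1.
  by apply: scoord_inj; rewrite -!icoordE dirlim_injS !x_E.
have L_S k x : L_ k.+2 (sphere_incl x) = L_ k.+1 x.
  have [c1 p1 b1] := L_E k.+1; have [c2 p2 b2] := L_E k.+2.
  apply: (unique_lift p_cov (a := x_ k.+1) (@sphere_connected R k)
    (f := fun x => L_ k.+2 (sphere_incl x))) => //.
  - move=> y; apply: (@continuous_comp _ _ _ (@sphere_incl R k.+1)); last exact: c2.
    exact: sphere_incl_continuous.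
  - by move=> y; rewrite p1 p2 dirlim_injS.
  - by rewrite x_S b1 b2.
(* The shift by one is essential: the sphere of dimension 0 is disconnected, so its lift need not be
   compatible with the next. *)
have [L LE] := dirlim_lift (f := @sphere_incl R)
  (g := fun k (x : sphere R k) => L_ k.+1 (sphere_incl x)) (fun k x => L_S k (sphere_incl x)).
have cL : continuous L.
  apply: dirlim_continuous => k.
  have -> : (fun x : sphere R k => L (dirlim_inj (@sphere_incl R) x)) =
    (fun x => L_ k.+1 (sphere_incl x)) by apply/funext => x; rewrite LE.
  move=> y; have [c1 _ _] := L_E k.+1.
  apply: (@continuous_comp _ _ _ (@sphere_incl R k)); last exact: c1.
  exact: sphere_incl_continuous.
have pL z : p (L z) = q z.
  have [k [x ->]] := dirlim_ex z; rewrite LE.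
  by have [_ -> _] := L_E k.+1; rewrite dirlim_injS.
(* Since [q] is open and [p] is injective on a sheet, the lift is an open map. *)
have open_map (W : set Soo) z : open W -> W z -> nbhs (L z) (L @` W).
  move=> oW Wz; have [V [A [g [[oV Vb] [oA Ae] gV Ag]]]] := covering_sheet p_cov (L z).
  pose W' := W `&` L @^-1` A.
  have oW' : open W' by apply: openI => //; apply: open_comp => // x _; exact: cL.
  have n1 : nbhs (L z) (p @^-1` (q @` W')).
    apply: cp; apply: open_nbhs_nbhs; split; first exact: q_im.
    by exists z; rewrite ?pL.
  have n2 : nbhs (L z) A by exact: open_nbhs_nbhs.
  move: n1 n2; apply: filterS2 => e [w [Ww Aw] qw] Ax; exists w => //.
  by rewrite -(Ag _ Ax).2 -(Ag _ Aw).2 pL qw.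
(* The lifts [L] and [L \o nu] agree everywhere once they agree at one point; then the range of [L]
   would be open, closed and disjoint from its swap. *)
have L_nu z : L (nu z) = sw (L z).
  have cLnu : continuous (fun z => L (nu z)).
    by move=> y; apply: (@continuous_comp _ _ _ nu L); [exact: cnu|exact: cL].
  have eqp : p (L z) = p (L (nu z)) by rewrite !pL q_nu.
  case: (sw_eq _ _ eqp) => // Lz; exfalso.
  have Lnu y : L (nu y) = L y.
    apply: (unique_lift p_cov (a := z) (@Soo_connected R) cLnu cL) => // x.
    by rewrite !pL q_nu.
  have oR : open (range L).
    by rewrite openE => _ [x _ <-]; exact: open_map openT _.
  have disj x y : L x <> sw (L y).
    move=> h; have : q x = q y by rewrite -!pL h psw.
    case/q_eq => yx; move: h; rewrite yx ?Lnu => h; exact: (sw_ne (L x)).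
  have cR : closed (range L).
    have -> : range L = ~` (sw @^-1` range L).
      apply/seteqP; split => [_ [x _ <-] [y _ h]|e ne]; first exact: (disj y x).
      have [x xe] := q_surj (p e).
      have eqx : p (L x) = p e by rewrite pL.
      have [->|h] := sw_eq _ _ eqx; first by exists x.
      exfalso; apply: ne; exists x => //.
      have [|//] := sw_eq _ _ (esym eqx).
      by rewrite h => h'; case: (sw_ne (L x)).
    by apply: open_closedC; apply: open_comp => // x _; exact: csw.
  have RT := E_conn (ex_intro _ (L z) (ex_intro2 _ _ z I erefl))
    (ex_intro2 _ _ _ oR (esym (setTI _))) (ex_intro2 _ _ _ cR (esym (setTI _))).
  have : [set: E] (sw (L z)) by [].
  by rewrite -RT => -[x _ h]; exact: (disj x z).
have L_inj : injective L.
  move=> x y xy; have : q x = q y by rewrite -!pL xy.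
  case/q_eq => [->//|yx]; exfalso; move: xy; rewrite yx L_nu => h.
  exact: (sw_ne (L x)).
have L_surj e : exists z, L z = e.
  have [x xe] := q_surj (p e).
  have eqp : p (L x) = p e by rewrite pL.
  have [->|->] := sw_eq _ _ eqp; first by exists x.
  by exists (nu x); rewrite L_nu.
have /choice[M ME] := L_surj.
exists M, L; split => //.
- by move=> z; apply: L_inj; rewrite ME.
- move=> e W; rewrite nbhsE => -[W' [oW' W'e] W'W].
  have := open_map W' (M e) oW' W'e; rewrite ME; apply: filterS => _ [w W'w <-].
  by rewrite /=; have -> : M (L w) = w by [apply: L_inj; rewrite ME]; exact: W'W.
Qed.

End Classification.

(** * The circle *)

Section Circle.
Variable R : realType.
Notation S1 := (sphere R 1).
Notation I := (unit_itv R).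
Implicit Types (z w b : S1) (u : R).

Definition cx z : R := set_val z ord0 ord0.
Definition cy z : R := set_val z ord0 ord_max.

Lemma circle_eq1 z : cx z ^+ 2 + cy z ^+ 2 = 1.
Proof.
have := sphere_sum z; rewrite big_ord_recl big_ord1 => <-; congr (_ + _).
by congr (set_val z _ _ ^+ 2); apply: val_inj.
Qed.

Lemma row2P (v w : 'rV[R]_2) :
  v ord0 ord0 = w ord0 ord0 -> v ord0 ord_max = w ord0 ord_max -> v = w.
Proof.
move=> e0 e1; apply/rowP => -[[|[|//]] h].
  by rewrite (_ : Ordinal h = ord0)//; apply: val_inj.
by rewrite (_ : Ordinal h = ord_max)//; apply: val_inj.
Qed.

Lemma circle_ext z w : cx z = cx w -> cy z = cy w -> z = w.
Proof. by move=> e0 e1; apply: val_inj; exact: row2P. Qed.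

Definition pair_row (a c : R) : 'rV[R]_2 := \row_i (if i == ord0 then a else c).

Lemma pair_row_sphere (a c : R) : a ^+ 2 + c ^+ 2 = 1 ->
  \sum_i pair_row a c ord0 i ^+ 2 = 1.
Proof. by rewrite big_ord_recl big_ord1 !mxE. Qed.

Definition mk_circle (a c : R) (h : a ^+ 2 + c ^+ 2 = 1) : S1 :=
  mk_sphere (pair_row_sphere h).

Lemma cx_mk (a c : R) (h : a ^+ 2 + c ^+ 2 = 1) : cx (mk_circle h) = a.
Proof. by rewrite /cx mk_sphereE mxE. Qed.

Lemma cy_mk (a c : R) (h : a ^+ 2 + c ^+ 2 = 1) : cy (mk_circle h) = c.
Proof. by rewrite /cy mk_sphereE mxE. Qed.

Lemma cx_continuous : continuous cx.
Proof.
move=> z; apply: (@continuous_comp S1 'rV[R]_2 R set_val (fun v => v ord0 ord0)).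
  exact: set_val_continuous.
exact: coord_continuous.
Qed.

Lemma cy_continuous : continuous cy.
Proof.
move=> z; apply: (@continuous_comp S1 'rV[R]_2 R set_val (fun v => v ord0 ord_max)).
  exact: set_val_continuous.
exact: coord_continuous.
Qed.

Lemma continuous_circle (T : topologicalType) (f : T -> S1) :
  continuous (cx \o f) -> continuous (cy \o f) -> continuous f.
Proof.
move=> c0 c1; apply: continuous_set_type; apply: continuous_rV => -[[|[|//]] h].
  by rewrite (_ : Ordinal h = ord0)//; apply: val_inj.
by rewrite (_ : Ordinal h = ord_max)//; apply: val_inj.
Qed.

Lemma neg_subproof z : (- cx z) ^+ 2 + (- cy z) ^+ 2 = 1.
Proof. by rewrite !sqrrN circle_eq1. Qed.

Definition neg z : S1 := mk_circle (neg_subproof z).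

Lemma cx_neg z : cx (neg z) = - cx z. Proof. exact: cx_mk. Qed.
Lemma cy_neg z : cy (neg z) = - cy z. Proof. exact: cy_mk. Qed.

Lemma negK : involutive neg.
Proof. by move=> z; apply: circle_ext; rewrite ?cx_neg ?cy_neg opprK. Qed.

Lemma val_neg z : set_val (neg z) = - set_val z.
Proof. by apply: row2P; rewrite [RHS]mxE; [exact: cx_neg|exact: cy_neg]. Qed.

Lemma neg_continuous : continuous neg.
Proof.
apply: continuous_circle => z.
  have -> : cx \o neg = - cx by apply/funext => w; rewrite /= cx_neg.
  by apply: continuousN; exact: cx_continuous.
have -> : cy \o neg = - cy by apply/funext => w; rewrite /= cy_neg.
by apply: continuousN; exact: cy_continuous.
Qed.

(** Together with [ip] this gives the sine and cosine of the oriented angle from [b] to [z]. *)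
Definition det b z : R := cx b * cy z - cy b * cx z.
Definition ip b z : R := cx b * cx z + cy b * cy z.

Lemma det_continuous b : continuous (det b).
Proof.
move=> z; apply: (@continuousB _ _ _ (fun z => cx b * cy z) (fun z => cy b * cx z)).
  by apply: (@continuousM _ _ (fun=> cx b) cy); [exact: cst_continuous|exact: cy_continuous].
by apply: (@continuousM _ _ (fun=> cy b) cx); [exact: cst_continuous|exact: cx_continuous].
Qed.

Lemma ip_continuous b : continuous (ip b).
Proof.
move=> z; apply: (@continuousD _ _ _ (fun z => cx b * cx z) (fun z => cy b * cy z)).
  by apply: (@continuousM _ _ (fun=> cx b) cx); [exact: cst_continuous|exact: cx_continuous].
by apply: (@continuousM _ _ (fun=> cy b) cy); [exact: cst_continuous|exact: cy_continuous].
Qed.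

Lemma det_neg b z : det b (neg z) = - det b z.
Proof. by rewrite /det cx_neg cy_neg; ring. Qed.

Lemma det_negl b z : det (neg b) z = - det b z.
Proof. by rewrite /det cx_neg cy_neg; ring. Qed.

Lemma ip_neg b z : ip b (neg z) = - ip b z.
Proof. by rewrite /ip cx_neg cy_neg; ring. Qed.

Lemma ip_id z : ip z z = 1.
Proof. by rewrite /ip -!expr2 circle_eq1. Qed.

Lemma det_id z : det z z = 0.
Proof. by rewrite /det; ring. Qed.

Lemma ip_det b z : ip b z ^+ 2 + det b z ^+ 2 = 1.
Proof.
have := circle_eq1 b; have := circle_eq1 z => h1 h2.
have -> : ip b z ^+ 2 + det b z ^+ 2 = (cx b ^+ 2 + cy b ^+ 2) * (cx z ^+ 2 + cy z ^+ 2).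
  by rewrite /ip /det; ring.
by rewrite h1 h2 mulr1.
Qed.

Lemma frameE b z :
  cx z = ip b z * cx b - det b z * cy b /\ cy z = ip b z * cy b + det b z * cx b.
Proof.
have h := circle_eq1 b.
have e0 : ip b z * cx b - det b z * cy b = cx z * (cx b ^+ 2 + cy b ^+ 2).
  by rewrite /ip /det; ring.
have e1 : ip b z * cy b + det b z * cx b = cy z * (cx b ^+ 2 + cy b ^+ 2).
  by rewrite /ip /det; ring.
by rewrite e0 e1 h !mulr1.
Qed.

Lemma frame_ext b z w : ip b z = ip b w -> det b z = det b w -> z = w.
Proof.
move=> e0 e1; have [x1 y1] := frameE b z; have [x2 y2] := frameE b w.
by apply: circle_ext; rewrite ?x1 ?x2 ?y1 ?y2 e0 e1.
Qed.

Lemma det_eq0 b z : det b z = 0 <-> z = b \/ z = neg b.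
Proof.
split=> [d0|[->|->]]; rewrite ?det_neg ?det_id ?oppr0//.
have /eqP : ip b z ^+ 2 = 1 by have := ip_det b z; rewrite d0 expr0n addr0.
rewrite sqrf_eq1 => /orP[] /eqP i1; [left|right]; apply: (@frame_ext b).
- by rewrite i1 ip_id.
- by rewrite d0 det_id.
- by rewrite i1 ip_neg ip_id.
- by rewrite d0 det_neg det_id oppr0.
Qed.

Lemma neg_neq z : neg z <> z.
Proof. by move=> h; have := ip_id z; rewrite -{2}h ip_neg ip_id; lra. Qed.

Lemma chart_den u : 0 < Num.sqrt (1 + u ^+ 2).
Proof. by rewrite sqrtr_gt0 ltr_wpDr// sqr_ge0. Qed.

Lemma chart_subproof b u :
  ((cx b - u * cy b) / Num.sqrt (1 + u ^+ 2)) ^+ 2 +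
  ((cy b + u * cx b) / Num.sqrt (1 + u ^+ 2)) ^+ 2 = 1.
Proof.
have h := circle_eq1 b; rewrite !expr_div_n -mulrDl.
have -> : (cx b - u * cy b) ^+ 2 + (cy b + u * cx b) ^+ 2 =
    (1 + u ^+ 2) * (cx b ^+ 2 + cy b ^+ 2) by ring.
rewrite h mulr1 sqr_sqrtr; last by rewrite addr_ge0// sqr_ge0.
by rewrite divff// gt_eqF// ltr_wpDr// sqr_ge0.
Qed.

(* The central projection onto the tangent line at [b], inverted. *)
Definition chart b u : S1 := mk_circle (chart_subproof b u).

Lemma det_chart c b u : det c (chart b u) = (det c b + u * ip c b) / Num.sqrt (1 + u ^+ 2).
Proof. by rewrite {1}/det cx_mk cy_mk /det /ip; ring. Qed.

Lemma ip_chart c b u : ip c (chart b u) = (ip c b - u * det c b) / Num.sqrt (1 + u ^+ 2).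
Proof. by rewrite {1}/ip cx_mk cy_mk /det /ip; ring. Qed.

Lemma chart0 b : chart b 0 = b.
Proof.
apply: (@frame_ext b); first by rewrite ip_chart mul0r subr0 expr0n addr0 sqrtr1 divr1.
by rewrite det_chart mul0r addr0 expr0n addr0 sqrtr1 divr1.
Qed.

Lemma chart_neg b u : chart (neg b) u = neg (chart b u).
Proof.
by apply: (@frame_ext b); rewrite ?ip_chart ?det_chart ?ip_neg ?det_neg ?ip_chart ?det_chart; ring.
Qed.

Lemma chartE b z : 0 < ip b z -> z = chart b (det b z / ip b z).
Proof.
move=> i0; have i00 : ip b z != 0 by rewrite gt_eqF.
have E : Num.sqrt (1 + (det b z / ip b z) ^+ 2) = (ip b z)^-1.
  have -> : 1 + (det b z / ip b z) ^+ 2 = ((ip b z)^-1) ^+ 2.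
    by rewrite expr_div_n exprVn -[1](@divff _ (ip b z ^+ 2)) ?expf_neq0// -mulrDl ip_det div1r.
  by rewrite sqrtr_sqr gtr0_norm// invr_gt0.
apply: (@frame_ext b); rewrite ?ip_chart ?det_chart E invrK ip_id det_id.
  by rewrite mulr0 subr0 mul1r.
by rewrite add0r mulr1 mulfVK.
Qed.

Lemma chart_continuous b : continuous (chart b).
Proof.
have cV : continuous (fun u : R => (Num.sqrt (1 + u ^+ 2))^-1).
  move=> u; apply: (@continuousV _ _ (fun u => Num.sqrt (1 + u ^+ 2))).
    by rewrite gt_eqF// chart_den.
  apply: (@continuous_comp R R R (fun u => 1 + u ^+ 2)); last exact: sqrt_continuous.
  apply: (@continuousD R R R (fun=> 1) (fun u => u ^+ 2)); first exact: cst_continuous.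
  exact: exprn_continuous.
have lin (a c : R) : continuous (fun u : R => a + u * c).
  move=> u; apply: (@continuousD R R R (fun=> a) (fun u => u * c)); first exact: cst_continuous.
  by apply: (@continuousM _ _ id (fun=> c)); [exact: cvg_id|exact: cst_continuous].
apply: continuous_circle.
  have -> : cx \o chart b = fun u => (cx b + u * (- cy b)) * (Num.sqrt (1 + u ^+ 2))^-1.
    by apply/funext => u; rewrite /= cx_mk mulrN.
  by move=> u; apply: (@continuousM _ _ (fun u => cx b + u * (- cy b)));
      [exact: lin|exact: cV].
have -> : cy \o chart b = fun u => (cy b + u * cx b) * (Num.sqrt (1 + u ^+ 2))^-1.
  by apply/funext => u; rewrite /= cy_mk.
by move=> u; apply: (@continuousM _ _ (fun u => cy b + u * cx b));
  [exact: lin|exact: cV].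
Qed.

Lemma near_chart b (N : set S1) : nbhs b N ->
  exists2 u0 : R, 0 < u0 & forall u, `|u| < u0 -> N (chart b u).
Proof.
rewrite -{1}(chart0 b) => /(chart_continuous (b := b)) /nbhs_ballP[u0 u00 H].
by exists u0 => // u uu; apply: H; rewrite /ball/= sub0r normrN.
Qed.

Lemma chart_near b u0 : 0 < u0 ->
  nbhs b [set z | exists2 u, `|u| < u0 & z = chart b u].
Proof.
move=> u00.
have cq : {for b, continuous (fun z => det b z / ip b z)}.
  apply: (@continuousM _ _ (det b) (fun z => (ip b z)^-1)); first exact: det_continuous.
  by apply: (@continuousV _ _ (ip b)); [rewrite ip_id oner_neq0|exact: ip_continuous].
have n1 : \forall z \near b, `|det b z / ip b z| < u0.
  have cn : {for b, continuous (fun z => `|det b z / ip b z|)}.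
    apply: (@continuous_comp S1 R R (fun z => det b z / ip b z)); first exact: cq.
    exact: norm_continuous.
  by apply: (cvgr_lt `|det b b / ip b b| cn); rewrite det_id mul0r normr0.
have n2 : \forall z \near b, 0 < ip b z.
  by apply: (cvgr_gt (ip b b) (@ip_continuous b b)); rewrite ip_id.
move: n1 n2; apply: filterS2 => z h1 h2; exists (det b z / ip b z) => //.
exact: chartE.
Qed.

Lemma chart_connected (P : R -> Prop) b : is_interval [set u | P u] ->
  connected (chart b @` [set u | P u]).
Proof.
move=> iP; apply: connected_continuous_connected; first exact/connected_intervalP.
exact/continuous_subspaceT/chart_continuous.
Qed.

Lemma arc_circle (t : I) : cos (pi * set_val t) ^+ 2 + sin (pi * set_val t) ^+ 2 = 1.
Proof. exact: cos2Dsin2. Qed.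

Definition upper_arc (t : I) : S1 := mk_circle (arc_circle t).

Lemma val_arc (t : I) : set_val (upper_arc t) = arc_pt t.
Proof.
by have [e0 e1] := arc_ptE t; apply: row2P;
  [exact: etrans (cx_mk _) (esym e0)|exact: etrans (cy_mk _) (esym e1)].
Qed.

Lemma circle_arc z : exists t : I, z = upper_arc t \/ z = neg (upper_arc t).
Proof.
wlog y0 : z / 0 <= cy z.
  move=> H; have [y0|y0] := leP 0 (cy z); first exact: H.
  have [|t tz] := H (neg z); first by rewrite cy_neg oppr_ge0 ltW.
  by exists t; case: tz => h; [right|left]; rewrite -[z]negK h ?negK.
have x1 : -1 <= cx z <= 1.
  have := circle_eq1 z; have := sqr_ge0 (cy z) => h1 h2.
  by apply/andP; split; nra.
have [/andP[a0 api] ca] := acos_def x1.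
have h : 0 <= acos (cx z) / pi <= 1.
  rewrite divr_ge0 ?pi_ge0//= ler_pdivrMr ?pi_gt0// mul1r//.
exists (clamp (acos (cx z) / pi)); left.
have E : pi * set_val (clamp (acos (cx z) / pi)) = acos (cx z).
  by rewrite clampE// mulrC divfK// gt_eqF// pi_gt0.
apply: circle_ext; rewrite ?cx_mk ?cy_mk E//.
rewrite sin_acos// -[LHS]ger0_norm// -sqrtr_sqr; congr Num.sqrt.
by have := circle_eq1 z; lra.
Qed.

Notation rp := (@circle_to_RP1 R).

Lemma rp_arc (t : I) : rp (upper_arc t) = RP1_pt t.
Proof. by apply: circle_to_RP1E; left; exact: val_arc. Qed.

Lemma rp_neg z : rp (neg z) = rp z.
Proof.
have h (t : I) : rp (neg (upper_arc t)) = rp (upper_arc t).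
  by rewrite rp_arc; apply: circle_to_RP1E; right; rewrite val_neg val_arc.
by have [t [->|->]] := circle_arc z; rewrite ?negK h.
Qed.

Lemma arc_RP1 (s t : I) : RP1_pt s = RP1_pt t -> upper_arc s = upper_arc t \/ upper_arc s = neg
  (upper_arc t).
Proof.
move/quot_projP; elim => {s t} [s t [s0 t1]|s|s t _ [h|h]|s t v _ [h|h] _ [h'|h']].
- right; apply: circle_ext; rewrite ?cx_neg ?cy_neg ?cx_mk ?cy_mk s0 t1 mulr0 mulr1.
    by rewrite cos0 cospi opprK.
  by rewrite sin0 sinpi oppr0.
- by left.
- by left.
- by right; rewrite h negK.
- by left; rewrite h.
- by right; rewrite h.
- by right; rewrite h h'.
- by left; rewrite h h' negK.
Qed.

Lemma rp_eq z w : rp z = rp w <-> z = w \/ z = neg w.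
Proof.
split=> [|[->|->]//]; last exact: rp_neg.
have [s zs] := circle_arc z; have [t wt] := circle_arc w.
have -> : rp z = RP1_pt s by case: zs => ->; rewrite ?rp_neg rp_arc.
have -> : rp w = RP1_pt t by case: wt => ->; rewrite ?rp_neg rp_arc.
move/arc_RP1; case: zs => ->; case: wt => ->; case=> ->; rewrite ?negK; auto.
Qed.

(** The midpoint of an antipodal pair is the origin. Conversely, for two points [a], [b] that are
    not antipodal, the pairing with [a + b] is positive on both. *)
Lemma two_tameP (U : set S1) : two_tame U <-> forall z, U z -> ~ U (neg z).
Proof.
split=> [tU z Uz Unz|AF A AU A0 A2 bA].
  pose f (i : nat) : S1 := if i is 0%N then z else neg z.
  apply: (tU (f @` `I_2)).
  - by move=> _ [[|i] _ <-].
  - by exists z; exists 0%N.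
  - exact: card_image_le.
  move=> M [cM subM].
  have Mz : M (set_val z) by apply: subM; exists z => //; exists 0%N.
  have Mnz : M (set_val (neg z)) by apply: subM; exists (neg z) => //; exists 1%N.
  have h0 : 0 <= 2^-1 :> R by rewrite invr_ge0.
  have h1 : 2^-1 <= 1 :> R by rewrite invf_le1// ler1n.
  pose half : {i01 R} := Itv01 h0 h1.
  have := cM (set_val z) (set_val (neg z)) half; rewrite !inE.
  move=> /(_ Mz Mnz); rewrite val_neg.
  have -> : conv half (set_val z : convex_lmodType 'rV[R]_2) (- set_val z) =
      2^-1 *: set_val z + (1 - 2^-1) *: (- set_val z) by [].
  rewrite scalerN -scalerBl (_ : 2^-1 - (1 - 2^-1) = 0) ?scale0r//.
  by field.
have [a [b [Aa Ab Aab]]] : exists a b, [/\ A a, A b & forall c, A c -> c = a \/ c = b].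
  have [a Aa] := A0.
  have [h|] := pselect (forall c, A c -> c = a).
    by exists a, a; split => // c /h; left.
  move=> /existsNP[b /not_implyP[Ab ba]]; exists a, b; split => // c Ac.
  have /pcard_leP[f] := A2.
  have f2 x : A x -> (f x < 2)%N by move=> Ax; apply: (@funS _ _ _ _ f x).
  have finj := @inj _ _ _ f.
  have fa := f2 a Aa; have fb := f2 b Ab; have fc := f2 c Ac.
  have fab : f a <> f b by move=> h; apply: ba; apply/esym; apply: finj; rewrite ?inE.
  have [h|h] : f c = f a \/ f c = f b by lia.
    by left; apply: finj; rewrite ?inE.
  by right; apply: finj; rewrite ?inE.
have nba : b <> neg a by move=> ba; apply: (AF a (AU a Aa)); rewrite -ba; exact: AU.
have pab : 0 < 1 + ip a b.
  rewrite lt_neqAle; apply/andP; split; last first.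
    by have := ip_det a b; have := sqr_ge0 (det a b); nra.
  apply/eqP => h; have i1 : ip a b = -1 by lra.
  apply: nba; apply: (@frame_ext a); first by rewrite ip_neg ip_id.
  rewrite det_neg det_id oppr0; apply/eqP; rewrite -sqrf_eq0.
  by have h2 := ip_det a b; rewrite i1 in h2; apply/eqP; lra.
(* An open half-plane: convex, containing [A], and omitting the origin. *)
pose M : set 'rV[R]_2 := [set v | 0 < (cx a + cx b) * v ord0 ord0 + (cy a + cy b) * v ord0 ord_max].
have : M 0.
  apply: bA; split.
    apply/convex_setW => v w; rewrite !inE /M /= => Mv Mw k k0 k1.
    have E (v' w' : 'rV[R]_2) (i : 'I_2) : (conv k (v' : convex_lmodType 'rV[R]_2) w' : 'rV[R]_2)
      ord0 i =
        k%:num * v' ord0 i + (1 - k%:num) * w' ord0 i.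
      transitivity ((k%:num *: v' + (1 - k%:num) *: w') ord0 i); first by [].
      by rewrite !mxE.
    suff H : 0 < (cx a + cx b) * (k%:num * (v : 'rV[R]_2) ord0 ord0 + (1 - k%:num) * (w :
      'rV[R]_2) ord0 ord0) +
        (cy a + cy b) * (k%:num * (v : 'rV[R]_2) ord0 ord_max + (1 - k%:num) * (w : 'rV[R]_2)
          ord0 ord_max).
      rewrite -(E v w ord0) -(E v w ord_max) in H; apply/mem_set; exact: H.
    move: Mv Mw; move: (v : 'rV[R]_2) (w : 'rV[R]_2) => {E}{}v {}w Mv Mw.
    set l := k%:num in k0 k1 *.
    have -> : (cx a + cx b) * (l * v ord0 ord0 + (1 - l) * w ord0 ord0) +
      (cy a + cy b) * (l * v ord0 ord_max + (1 - l) * w ord0 ord_max) =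
      l * ((cx a + cx b) * v ord0 ord0 + (cy a + cy b) * v ord0 ord_max) +
      (1 - l) * ((cx a + cx b) * w ord0 ord0 + (cy a + cy b) * w ord0 ord_max) by ring.
    by rewrite addr_gt0// mulr_gt0// subr_gt0.
  move=> _ [c Ac <-]; rewrite /M /= -/(cx c) -/(cy c).
  have -> : (cx a + cx b) * cx c + (cy a + cy b) * cy c = ip a c + ip b c.
    by rewrite /ip; ring.
  have ipC : ip b a = ip a b by rewrite /ip; ring.
  by case: (Aab c Ac) => ->; rewrite ?ip_id ?ipC; lra.
by rewrite /M /= !mxE !mulr0 addr0 ltxx.
Qed.

End Circle.

(** * Maxtame sets *)

Section SignSets.
Variable R : realType.
Notation S1 := (sphere R 1).
Notation rp := (@circle_to_RP1 R).
Implicit Types (bs : seq S1) (z w b : S1) (u e : R).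

(** A product of linear forms, one for each antipodal pair, serving as a global sign function on the
    circle. *)
Definition psi bs z : R := \prod_(b <- bs) det b z.

Lemma psi_cons b bs z : psi (b :: bs) z = det b z * psi bs z.
Proof. by rewrite /psi big_cons. Qed.

Lemma psi_continuous bs : continuous (psi bs).
Proof.
elim: bs => [|b bs ih].
  have -> : psi [::] = fun=> 1 by apply/funext => z; rewrite /psi big_nil.
  exact: cst_continuous.
have -> : psi (b :: bs) = det b \* psi bs.
  by apply/funext => z; rewrite psi_cons.
by move=> z; apply: continuousM; [exact: det_continuous|exact: ih].
Qed.

Lemma psi_neg bs z : psi bs (neg z) = (-1) ^+ size bs * psi bs z.
Proof.
elim: bs => [|b bs ih]; first by rewrite /psi !big_nil expr0 mul1r.
by rewrite !psi_cons ih det_neg /= exprS; move: (_ ^+ size bs) => k; ring.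
Qed.

Lemma psi_eq0 bs z : psi bs z = 0 <-> rp z \in map rp bs.
Proof.
split=> [/eqP|/mapP[b bbs zb]].
  rewrite /psi prodf_seq_eq0 => /hasP[b bbs /eqP/det_eq0 zb].
  by apply/mapP; exists b => //; apply/rp_eq.
apply/eqP; rewrite /psi prodf_seq_eq0; apply/hasP; exists b => //.
by apply/eqP/det_eq0; apply/rp_eq.
Qed.

(** As the pairs are distinct, exactly one factor vanishes at [b]; in the chart it is a positive
    function times a nonzero multiple of [u], while the other factors keep their signs nearby. *)
Lemma psi_crossing bs b : uniq (map rp bs) -> psi bs b = 0 ->
  exists c, (c = 1 \/ c = -1) /\ exists2 u0, 0 < u0 &
    forall u, `|u| < u0 -> Num.sg (psi bs (chart b u)) = c * Num.sg u.
Proof.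
elim: bs => [|b' bs ih] /=; first by rewrite /psi big_nil => _ /eqP; rewrite oner_eq0.
move=> /andP[b'bs ubs] pb.
have psiE := psi_cons b' bs.
have sgs (x : R) : x != 0 -> Num.sg x = 1 \/ Num.sg x = -1.
  by rewrite neq_lt => /orP[h|h]; [right; rewrite ltr0_sg|left; rewrite gtr0_sg].
have cst_sg (f : S1 -> R) : continuous f -> f b != 0 -> exists2 u0, 0 < u0 &
    forall u, `|u| < u0 -> Num.sg (f (chart b u)) = Num.sg (f b).
  move=> cf fb0; suff n : nbhs b [set z | Num.sg (f z) = Num.sg (f b)].
    by have [u0 u00 H] := near_chart n; exists u0.
  move: fb0; rewrite neq_lt => /orP[fb|fb].
    have h : \forall z \near b, f z < 0 by apply: (cvgr_lt (f b) (cf b)).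
    by apply: filterS h => z h /=; rewrite !ltr0_sg.
  have h : \forall z \near b, 0 < f z by apply: (cvgr_gt (f b) (cf b)).
  by apply: filterS h => z h /=; rewrite !gtr0_sg.
have [d0|d0] := eqVneq (det b' b) 0.
  have p0 : psi bs b != 0.
    apply: contraNneq b'bs => /psi_eq0; have -> // : rp b = rp b'.
    by apply/rp_eq/det_eq0.
  have i0 : Num.sg (ip b' b) = 1 \/ Num.sg (ip b' b) = -1.
    apply: sgs; have := ip_det b' b; rewrite d0 expr0n addr0 => h.
    by apply: contra_eq_neq h => ->; rewrite expr0n eq_sym oner_eq0.
  have [u0 u00 H] := cst_sg _ (@psi_continuous bs) p0.
  exists (Num.sg (ip b' b) * Num.sg (psi bs b)); split.
    by case: i0 => ->; case: (sgs _ p0) => ->; rewrite ?mul1r ?mulN1r ?opprK; auto.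
  exists u0 => // u uu; rewrite psiE sgrM H// det_chart d0 add0r !sgrM.
  by rewrite (gtr0_sg (x := _^-1)) ?invr_gt0 ?chart_den//; ring.
have pb0 : psi bs b = 0.
  by move: pb; rewrite psiE => /eqP; rewrite mulf_eq0 (negbTE d0) => /eqP.
have [c [c1 [u1 u10 H1]]] := ih ubs pb0.
have [u2 u20 H2] := cst_sg _ (@det_continuous _ b') d0.
exists (Num.sg (det b' b) * c); split.
  by case: c1 => ->; case: (sgs _ d0) => ->; rewrite ?mul1r ?mulN1r ?opprK; auto.
exists (Num.min u1 u2); first by rewrite lt_min u10 u20.
by move=> u; rewrite lt_min => /andP[h1 h2]; rewrite psiE sgrM H1// H2//; ring.
Qed.

Lemma near_psi_neq0 bs z (N : set S1) : uniq (map rp bs) -> nbhs z N ->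
  exists2 w, N w & psi bs w != 0.
Proof.
move=> ubs nN; have [z0|z0] := eqVneq (psi bs z) 0; last first.
  by exists z => //; exact: nbhs_singleton nN.
have [c [c1 [u0 u00 H]]] := psi_crossing ubs z0.
have [u1 u10 H1] := near_chart nN.
have [|v /andP[h h2] _] := @generic_point R 0 (Num.min u0 u1) [::].
  by rewrite lt_min u00 u10.
have hn : `|v| = v by rewrite gtr0_norm.
exists (chart z v).
  by apply: H1; rewrite hn (lt_le_trans h2)// ge_min lexx orbT.
rewrite -sgr_eq0 H; last by rewrite hn (lt_le_trans h2)// ge_min lexx.
by rewrite gtr0_sg// mulr1; case: c1 => ->; rewrite ?oppr_eq0 oner_eq0.
Qed.

Lemma near_psi_sign bs z e (N : set S1) : uniq (map rp bs) -> psi bs z = 0 ->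
  (e = 1 \/ e = -1) -> nbhs z N -> exists2 w, N w & 0 < e * psi bs w.
Proof.
move=> ubs z0 e1 nN.
have [c [c1 [u0 u00 H]]] := psi_crossing ubs z0.
have [u1 u10 H1] := near_chart nN.
have [|v /andP[h h2] _] := @generic_point R 0 (Num.min u0 u1) [::].
  by rewrite lt_min u00 u10.
have vn : `|c * e * v| = v.
  by rewrite !normrM (gtr0_norm h); case: c1 => ->; case: e1 => ->;
    rewrite ?normrN normr1 !mul1r.
(* The side of [z] is chosen so that the sign of [psi] there is [e]. *)
exists (chart z (c * e * v)).
  by apply: H1; rewrite vn (lt_le_trans h2)// ge_min lexx orbT.
rewrite -sgr_gt0 sgrM H; last by rewrite vn (lt_le_trans h2)// ge_min lexx.
rewrite !sgrM (gtr0_sg h).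
by case: c1 => ->; case: e1 => ->; rewrite ?sgrN ?sgr1 ?mulN1r ?mul1r ?opprK ?mulrN ?mulr1 ?opprK
  ltr01.
Qed.

Definition sign_set bs e : set S1 := [set z | 0 < e * psi bs z].

Lemma sign_set_continuous bs e : continuous (fun z => e * psi bs z).
Proof.
move=> z; apply: (@continuousM _ _ (fun=> e) (psi bs)); first exact: cst_continuous.
exact: psi_continuous.
Qed.

Lemma sign_set_open bs e : open (sign_set bs e).
Proof.
apply: (@open_comp _ _ (fun z => e * psi bs z) [set r | 0 < r]).
  by move=> z _; exact: sign_set_continuous.
exact: open_gt.
Qed.

Lemma sign_set_neg bs e z : odd (size bs) -> sign_set bs e (neg z) <-> sign_set bs (- e) z.
Proof.
by move=> o; rewrite /sign_set /= psi_neg -signr_odd o expr1 mulN1r mulrN mulNr.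
Qed.

Lemma sign_set_two_tame bs e : odd (size bs) -> two_tame (sign_set bs e).
Proof.
move=> o; apply/two_tameP => z h /(sign_set_neg _ _ o); move: h.
by rewrite /sign_set /= mulNr oppr_gt0 => h /(lt_trans h); rewrite ltxx.
Qed.

Lemma norm_proj_subproof (a c : R) : 0 < a ^+ 2 + c ^+ 2 ->
  (a / Num.sqrt (a ^+ 2 + c ^+ 2)) ^+ 2 + (c / Num.sqrt (a ^+ 2 + c ^+ 2)) ^+ 2 = 1.
Proof.
move=> h; rewrite !expr_div_n -mulrDl sqr_sqrtr ?ltW// divff// gt_eqF//.
Qed.

(* Points with the same sign pattern lie in a common open convex cone. *)
Lemma sign_pattern_connected bs z0 b0 : b0 \in bs ->
  (forall b, b \in bs -> det b z0 != 0) ->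
  connected [set z | forall b, b \in bs -> 0 < det b z0 * det b z].
Proof.
move=> b0bs nz; set K' := (X in connected X).
have Kz0 : K' z0.
  by move=> b bbs; rewrite -expr2 exprn_even_gt0//= nz.
have step z : K' z -> exists C : set S1, [/\ connected C, C z0, C z & C `<=` K'].
  move=> Kz.
  pose X (s : R) := (1 - s) * cx z0 + s * cx z.
  pose Y (s : R) := (1 - s) * cy z0 + s * cy z.
  have dE b s : det b z0 * (cx b * Y s - cy b * X s) =
      (1 - s) * (det b z0 * det b z0) + s * (det b z0 * det b z).
    by rewrite /X /Y /det; ring.
  have dpos b s : b \in bs -> 0 <= s <= 1 -> 0 < det b z0 * (cx b * Y s - cy b * X s).
    move=> bbs /andP[s0 s1]; rewrite dE.
    have p1 := Kz0 b bbs; have p2 := Kz b bbs.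
    by move: s0; rewrite le_eqVlt => /orP[/eqP<-|s0]; nra.
  have npos s : 0 <= s <= 1 -> 0 < X s ^+ 2 + Y s ^+ 2.
    move=> s01; rewrite lt_neqAle; apply/andP; split; last by rewrite addr_ge0// sqr_ge0.
    rewrite eq_sym paddr_eq0 ?sqr_ge0// !sqrf_eq0; apply/negP => /andP[/eqP x0 /eqP y0].
    by have := dpos b0 s b0bs s01; rewrite x0 y0 !mulr0 subrr mulr0 ltxx.
  have ns s : 0 < X (set_val (clamp s)) ^+ 2 + Y (set_val (clamp s)) ^+ 2.
    exact/npos/unit_itvP.
  pose g (s : R) : S1 := mk_circle (norm_proj_subproof (ns s)).
  have cc : continuous (fun s : R => set_val (clamp s)).
    move=> s; apply: (@continuous_comp R (unit_itv R) R (@clamp R) set_val).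
      exact: clamp_continuous.
    exact: set_val_continuous.
  have lin (a c : R) : continuous (fun s : R => (1 - s) * a + s * c).
    move=> s; apply: cvgD; apply: cvgM; try exact: cvg_cst; last exact: cvg_id.
    by apply: cvgB; [exact: cvg_cst|exact: cvg_id].
  have cX : continuous (fun s => X (set_val (clamp s))).
    by move=> s; apply: (@continuous_comp R R R (fun s => set_val (clamp s)) X); [exact:
      cc|exact: lin].
  have cY : continuous (fun s => Y (set_val (clamp s))).
    by move=> s; apply: (@continuous_comp R R R (fun s => set_val (clamp s)) Y); [exact:
      cc|exact: lin].
  pose den (s : R) := Num.sqrt (X (set_val (clamp s)) ^+ 2 + Y (set_val (clamp s)) ^+ 2).
  have cV : continuous (fun s : R => (den s)^-1).
    move=> s; apply: (@continuousV _ _ den).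
      by rewrite gt_eqF// sqrtr_gt0.
    apply: (@continuous_comp R R R (fun s => X (set_val (clamp s)) ^+ 2 + Y (set_val (clamp s))
      ^+ 2)); last exact: sqrt_continuous.
    apply: cvgD.
      apply: (@continuous_comp R R R (fun s => X (set_val (clamp s))) (fun x => x ^+ 2)).
        exact: cX.
      exact: exprn_continuous.
    apply: (@continuous_comp R R R (fun s => Y (set_val (clamp s))) (fun x => x ^+ 2)).
      exact: cY.
    exact: exprn_continuous.
  have cg : continuous g.
    apply: continuous_circle.
      have -> : @cx R \o g = fun s => X (set_val (clamp s)) * (den s)^-1.
        by apply/funext => s; rewrite /= cx_mk.
      by move=> s; apply: (@continuousM R R (fun s => X (set_val (clamp s)))); [exact: cX|exact:
        cV].
    have -> : @cy R \o g = fun s => Y (set_val (clamp s)) * (den s)^-1.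
      by apply/funext => s; rewrite /= cy_mk.
    by move=> s; apply: (@continuousM R R (fun s => Y (set_val (clamp s)))); [exact: cY|exact: cV].
  exists (range g); split; first exact: connected_range.
  - exists 0 => //; apply: circle_ext; rewrite ?cx_mk ?cy_mk clampE ?lexx ?ler01// /X /Y;
      rewrite subr0 !mul1r !mul0r !addr0 circle_eq1 sqrtr1 divr1//.
  - exists 1 => //; apply: circle_ext; rewrite ?cx_mk ?cy_mk clampE ?lexx ?ler01// /X /Y;
      rewrite subrr !mul1r !mul0r !add0r circle_eq1 sqrtr1 divr1//.
  move=> _ [s _ <-] b bbs.
  have -> : det b z0 * det b (g s) = det b z0 * (cx b * Y (set_val (clamp s)) - cy b * X (set_val
    (clamp s)))
    / Num.sqrt (X (set_val (clamp s)) ^+ 2 + Y (set_val (clamp s)) ^+ 2).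
    by rewrite {2}/det cx_mk cy_mk; ring.
  rewrite divr_gt0 ?sqrtr_gt0//; apply: dpos => //; exact: unit_itvP.
pose C z := xget set0 [set C : set S1 | [/\ connected C, C z0, C z & C `<=` K']].
have CP z : K' z -> [/\ connected (C z), C z z0, C z z & C z `<=` K'].
  by move=> /step h; exact: (xgetPex set0 h).
have -> : K' = \bigcup_(z in K') C z.
  apply/seteqP; split => [z Kz|z [w Kw]]; first by exists z => //; case: (CP z Kz).
  by have [_ _ _ h] := CP w Kw; exact: h.
apply: bigcup_connected; last by move=> z /CP[].
by exists z0 => z /CP[].
Qed.

(** There are finitely many patterns of signs of the factors, and points with the same pattern lie
    in one component. *)
Lemma sign_set_finite_components bs e : odd (size bs) ->
  finite_set (connected_component (sign_set bs e) @` sign_set bs e).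
Proof.
move=> o; set U := sign_set bs e.
have [b0 b0bs] : exists b0, b0 \in bs by case: bs o {U} => // b bs _; exists b; rewrite mem_head.
have nz z : U z -> forall b, b \in bs -> det b z != 0.
  move=> Uz b bbs; apply: contraTneq Uz => d0; rewrite /U /sign_set /=.
  suff -> : psi bs z = 0 by rewrite mulr0 ltxx.
  by apply/psi_eq0/mapP; exists b => //; apply/rp_eq/det_eq0.
pose pat z : (size bs).-tuple bool := [tuple of [seq 0 < det b z | b <- in_tuple bs]].
(* The component of some point with the given pattern; patterns that do not occur get the default
   [set0]. *)
pose comp (t : (size bs).-tuple bool) := xget set0
  [set D | exists2 z, U z & pat z = t /\ D = connected_component U z].
apply: (@sub_finite_set _ _ (range comp)); last exact/finite_image/finite_finset.
move=> D [z Uz <-]; exists (pat z) => //; rewrite /comp.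
case: xgetP => [D' -> [w Uw [wz ->]]|/(_ (connected_component U z))]; last first.
  by case; exists z.
have same b : b \in bs -> (0 < det b w) = (0 < det b z).
  move=> bbs; have := congr1 (fun t : (size bs).-tuple bool => nth false t (index b bs)) wz.
  by rewrite /= !(nth_map b) ?index_mem// nth_index.
pose K := [set x | forall b, b \in bs -> 0 < det b z * det b x].
have Kc : connected K by exact: (sign_pattern_connected b0bs (nz z Uz)).
have sgpos (x y : R) : x != 0 -> y != 0 -> (0 < x) = (0 < y) -> 0 < x * y.
  move=> x0 y0 E; have [h|h] := ltP 0 x; first by rewrite mulr_gt0// -E.
  have yn : y <= 0 by rewrite leNgt -E -leNgt.
  by rewrite nmulr_rgt0 lt_neqAle ?x0 ?y0.
have Kz : K z by move=> b bbs; rewrite -expr2 exprn_even_gt0//= nz.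
have Kw : K w.
  by move=> b bbs; apply: sgpos; [exact: nz|exact: nz|rewrite same].
have KU : K `<=` U.
  move=> x Kx; rewrite /U /sign_set /=.
  have pp : 0 < psi bs z * psi bs x.
    rewrite /psi -big_split /= big_seq; apply: prodr_gt0 => b bbs; exact: Kx.
  have ez : 0 < e * psi bs z by [].
  by have : 0 < (e * psi bs x) * (psi bs z) ^+ 2; [nra|rewrite pmulr_lgt0//;
    rewrite exprn_even_gt0//=; apply: contraTneq pp => ->; rewrite mul0r ltxx].
have KD : K `<=` connected_component U w by exact: connected_component_max.
apply/seteqP; split => x h.
  by apply: connected_component_trans h; apply: connected_component_sym; exact: KD.
by apply: connected_component_trans h; exact: KD.
Qed.

(** A point of a larger open set outside the sign set has nearby points where [psi] has the opposite
    sign; the antipodes of these lie in the sign set because the number of factors is odd. *)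
Lemma sign_set_maxtame bs e : uniq (map rp bs) -> odd (size bs) ->
  (e = 1 \/ e = -1) -> maxtame (sign_set bs e).
Proof.
move=> ubs o e1; split.
- exact: sign_set_open.
- exact: sign_set_two_tame.
- exact: sign_set_finite_components.
move=> V oV /two_tameP tV UV; apply/seteqP; split => // z Vz.
have no w : V w -> ~ (0 < - e * psi bs w).
  by move=> Vw h; apply: (tV w Vw); apply: UV; apply/sign_set_neg.
have [z0|z0] := eqVneq (psi bs z) 0.
  have ne1 : - e = 1 \/ - e = -1 by case: e1 => ->; rewrite ?opprK; auto.
  have [w Vw h] := near_psi_sign ubs z0 ne1 (open_nbhs_nbhs (conj oV Vz)).
  by case: (no w Vw).
have ez : e * psi bs z != 0.
  by rewrite mulf_neq0//; case: e1 => ->; rewrite ?oppr_eq0 oner_eq0.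
move: ez; rewrite neq_lt => /orP[h|//].
by case: (no z Vz); rewrite mulNr oppr_gt0.
Qed.

Lemma sign_set_boundary bs e : uniq (map rp bs) -> (e = 1 \/ e = -1) ->
  boundary (sign_set bs e) = [set z | psi bs z = 0].
Proof.
move=> ubs e1; rewrite /boundary.
have -> : interior (sign_set bs e) = sign_set bs e.
  apply/seteqP; split => [z|z h]; first exact: interior_subset.
  by apply: open_nbhs_nbhs; split => //; exact: sign_set_open.
apply/seteqP; split => [z [cz nz] /=|z z0].
  apply/eqP/negPn/negP => z0.
  have ez : e * psi bs z != 0.
    by rewrite mulf_neq0//; case: e1 => ->; rewrite ?oppr_eq0 oner_eq0.
  move: ez; rewrite neq_lt => /orP[h|//].
  have n : \forall w \near z, e * psi bs w < 0.
    exact: (cvgr_lt (e * psi bs z) (@sign_set_continuous bs e z)).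
  have [w [Uw /= h']] := cz _ n.
  by have := lt_trans Uw h'; rewrite ltxx.
split; last by rewrite /sign_set /= z0 mulr0 ltxx.
move=> N nN; have [w Nw h] := near_psi_sign ubs z0 e1 nN.
by exists w.
Qed.

End SignSets.

(** * Every maxtame set is a sign set *)

Section MaxtameStructure.
Variable R : realType.
Notation S1 := (sphere R 1).
Notation rp := (@circle_to_RP1 R).
Implicit Types (z w b c : S1) (u e : R).

Lemma finite_subsingleton (T : Type) (A : set T) :
  (forall x y, A x -> A y -> x = y) -> finite_set A.
Proof.
move=> h; have [[x Ax]|nA] := pselect (A !=set0).
  by apply: (@sub_finite_set _ _ [set x]) => [y Ay /=|]; [exact: h|exact: finite_set1].
by apply: (@sub_finite_set _ _ set0) => // x Ax; apply: nA; exists x.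
Qed.

(* Stereographic projection from the antipode of [c]. *)
Definition stereo c z : R := det c z / (1 + ip c z).

Lemma stereo_den c z : z <> neg c -> 0 < 1 + ip c z.
Proof.
move=> zc; have h := ip_det c z; have h2 := sqr_ge0 (det c z).
rewrite lt_neqAle; apply/andP; split; last by nra.
apply/eqP => i0; have i1 : ip c z = -1 by lra.
apply: zc; apply: (@frame_ext _ c); first by rewrite ip_neg ip_id.
by rewrite det_neg det_id oppr0; apply/eqP; rewrite -sqrf_eq0; apply/eqP; nra.
Qed.

Lemma stereo_inj c z w : z <> neg c -> w <> neg c -> stereo c z = stereo c w -> z = w.
Proof.
move=> zc wc; have z0 := stereo_den zc; have w0 := stereo_den wc.
have param x : x <> neg c -> ip c x = (1 - stereo c x ^+ 2) / (1 + stereo c x ^+ 2) /\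
    det c x = stereo c x * (1 + ip c x).
  move=> xc; have x0 := stereo_den xc.
  have dE : det c x = stereo c x * (1 + ip c x) by rewrite /stereo mulfVK// gt_eqF.
  split => //; have h := ip_det c x; rewrite dE in h.
  have p : 0 < 1 + stereo c x ^+ 2 by rewrite ltr_wpDr// sqr_ge0.
  apply: (@mulIf _ (1 + stereo c x ^+ 2)); first by rewrite gt_eqF.
  rewrite mulfVK ?gt_eqF//.
  apply: (@mulIf _ (1 + ip c x)); first by rewrite gt_eqF.
  move: (stereo c x) (ip c x) h => s i h.
  have -> : i * (1 + s ^+ 2) * (1 + i) =
    (1 - s ^+ 2) * (1 + i) + (i ^+ 2 + (s * (1 + i)) ^+ 2 - 1) by ring.
  by rewrite h subrr addr0.
move=> E; have [i1 d1] := param z zc; have [i2 d2] := param w wc.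
by apply: (@frame_ext _ c); rewrite ?d1 ?d2 i1 i2 E.
Qed.

Lemma stereo_continuous c z : z <> neg c -> {for z, continuous (stereo c)}.
Proof.
move=> zc; apply: (@continuousM _ _ (det c) (fun z => (1 + ip c z)^-1)).
  exact: det_continuous.
apply: (@continuousV _ _ (fun z => 1 + ip c z)); first by rewrite gt_eqF// stereo_den.
apply: (@continuousD R R S1 (fun=> 1) (ip c)); first exact: cst_continuous.
exact: ip_continuous.
Qed.

(** In the stereographic coordinate [C] is an interval, so besides the centre of projection there
    are at most an upper and a lower end. *)
Lemma connected_arc_ends c (C : set S1) : connected C -> ~ C (neg c) ->
  finite_set (closure C `\` C).
Proof.
move=> cC nC; pose J := stereo c @` C.
have Cne z : C z -> z <> neg c by move=> Cz h; apply: nC; rewrite -h.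
have iJ : is_interval J.
  apply/connected_intervalP; apply: connected_continuous_connected => //.
  by apply: continuous_in_subspaceT => z; rewrite inE => /Cne; exact: stereo_continuous.
pose up := [set z | [/\ closure C z, z <> neg c & forall w, C w -> stereo c w < stereo c z]].
pose lo := [set z | [/\ closure C z, z <> neg c & forall w, C w -> stereo c z < stereo c w]].
have upS : finite_set up.
  apply: finite_subsingleton => x y [cx xc xu] [cy yc yu].
  apply: (stereo_inj xc yc); apply/eqP; rewrite eq_le !leNgt; apply/andP; split; apply/negP => h.
    have [w [Cw /= ww]] := cx _ (cvgr_gt _ (stereo_continuous xc) _ h).
    by have := lt_trans ww (yu w Cw); rewrite ltxx.
  have [w [Cw /= ww]] := cy _ (cvgr_gt _ (stereo_continuous yc) _ h).
  by have := lt_trans ww (xu w Cw); rewrite ltxx.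
have loS : finite_set lo.
  apply: finite_subsingleton => x y [cx xc xu] [cy yc yu].
  apply: (stereo_inj xc yc); apply/eqP; rewrite eq_le !leNgt; apply/andP; split; apply/negP => h.
    have [w [Cw /= ww]] := cy _ (cvgr_lt _ (stereo_continuous yc) _ h).
    by have := lt_trans (xu w Cw) ww; rewrite ltxx.
  have [w [Cw /= ww]] := cx _ (cvgr_lt _ (stereo_continuous xc) _ h).
  by have := lt_trans (yu w Cw) ww; rewrite ltxx.
apply: (@sub_finite_set _ _ ([set neg c] `|` (up `|` lo))); last first.
  by rewrite !finite_setU; split; [exact: finite_set1|split].
move=> z [cz nz]; have [->|zc] := pselect (z = neg c); first by left.
right; have nJ : ~ J (stereo c z).
  by move=> [w Cw /(stereo_inj (Cne w Cw) zc) h]; apply: nz; rewrite -h.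
have [[w Cw wz]|nw] := pselect (exists2 w, C w & stereo c w < stereo c z).
  left; split => // w' Cw'; rewrite ltNge; apply/negP => h.
  apply: nJ; apply: (iJ (stereo c w) (stereo c w')); [by exists w|by exists w'|].
  by rewrite (ltW wz) h.
right; split => // w Cw; rewrite lt_neqAle; apply/andP; split.
  by apply/eqP => h; apply: nJ; exists w.
by rewrite leNgt; apply/negP => h; apply: nw; exists w.
Qed.

Lemma sets_connected_or (T : topologicalType) (A B C : set T) : open A -> open B ->
  A `&` B = set0 -> connected C -> C `<=` A `|` B -> C `<=` A \/ C `<=` B.
Proof.
move=> oA oB AB cC CAB.
have [[x [Cx Ax]]|nA] := pselect (C `&` A !=set0); last first.
  right => x Cx; case: (CAB x Cx) => // Ax; exfalso; apply: nA; by exists x.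
left; have <- : C `&` A = C; last by move=> y [].
apply: cC; [by exists x|by exists A|exists (~` B); first exact: open_closedC].
apply/seteqP; split => y [Cy h]; split => //.
  by move=> By; have : (A `&` B) y by []; rewrite AB.
by case: (CAB y Cy).
Qed.

Section Maxtame.
Variable U : set S1.
Hypothesis U_maxtame : maxtame U.

Let oU : open U. Proof. by case: U_maxtame. Qed.
Let afU z : U z -> ~ U (neg z).
Proof. by case: U_maxtame => _ /two_tameP h _ _; exact: h. Qed.
Let finU : finite_set (connected_component U @` U). Proof. by case: U_maxtame. Qed.
Let maxU V : open V -> (forall z, V z -> ~ V (neg z)) -> U `<=` V -> V `<=` U.
Proof.
case: U_maxtame => _ _ _ h oV afV UV; rewrite (h V oV _ UV)//.
exact/two_tameP.
Qed.

Let nU : set S1 := @neg R @^-1` U.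
Let onU : open nU.
Proof. by apply: open_comp => // z _; exact: neg_continuous. Qed.

Let UnU : U `&` nU = set0.
Proof. by apply/seteqP; split => // z [/afU h]. Qed.

(** This is to become the zero set of [psi]. *)
Let Z : set S1 := ~` (U `|` nU).

Let Z_neg z : Z z -> Z (neg z).
Proof. by move=> nz [h|]; [apply: nz; right|rewrite /nU /preimage/= negK => h; apply: nz; left].
  Qed.

(* Otherwise a small arc around [z] could be added to [U]. *)
Let U_dense z (N : set S1) : nbhs z N -> exists2 w, N w & (U `|` nU) w.
Proof.
move=> nN; apply: contrapT => H.
pose M := interior N `&` [set w | 0 < ip z w].
have oM : open M.
  apply: openI; first exact: open_interior.
  apply: (@open_comp _ _ (ip z) [set r | 0 < r]); last exact: open_gt.
  by move=> w _; exact: ip_continuous.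
have Mz : M z by split => //; rewrite /= ip_id.
have NH w : M w -> ~ U w /\ ~ nU w.
  move=> [/interior_subset Nw _]; split=> h; apply: H; exists w => //; [left|right] => //.
have : U `|` M `<=` U.
  apply: maxU; [exact: openU| |by left].
  move=> w [Uw|Mw] [Unw|Mnw].
  - exact: (afU Uw).
  - by have [_] := NH _ Mnw; apply; rewrite /nU /preimage/= negK.
  - by have [_] := NH _ Mw; apply.
  - case: Mw Mnw => [_ h] [_]; rewrite /= ip_neg oppr_gt0 => /(lt_trans h).
    by rewrite ltxx.
by move=> /(_ z (or_intror Mz)) Uz; have [] := NH z Mz.
Qed.

(** A component omits the antipode of each of its points, so it has finitely many ends; as there are
    finitely many components, their closures cover the closure of [U]. *)
Let boundary_finite : finite_set (closure U `\` U).
Proof.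
apply: (@sub_finite_set _ _
  (\bigcup_(C in connected_component U @` U) (closure C `\` C))); last first.
  apply: bigcup_finite => // _ [c Uc <-].
  apply: (@connected_arc_ends c); first exact: component_connected.
  by move=> /connected_component_sub/(afU Uc).
move=> z [cz nz].
have : closed (\bigcup_(C in connected_component U @` U) closure C).
  by apply: closed_bigcup => // C _; exact: closed_closure.
move=> clB.
have : (\bigcup_(C in connected_component U @` U) closure C) z.
  apply: clB; apply: closureS cz => w Uw.
  exists (connected_component U w); first by exists w.
  by apply: subset_closure; exact: connected_component_refl.
move=> [_ [c Uc <-] cCz]; exists (connected_component U c); first by exists c.
by split => // /connected_component_sub.
Qed.

(** By density, a point of [Z] away from the closure of [U] is a limit of points of [nU], so its
    antipode lies in the closure of [U]. *)
Let Z_finite : finite_set Z.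
Proof.
apply: (@sub_finite_set _ _ ((closure U `\` U) `|` @neg R @` (closure U `\` U))); last first.
  by rewrite finite_setU; split => //; exact: finite_image.
move=> z nz; have nUz : ~ U z by move=> h; apply: nz; left.
have nUnz : ~ U (neg z) by move=> h; apply: nz; right.
have [cz|ncz] := pselect (closure U z); first by left.
right; exists (neg z); last exact: negK.
split => // N nN; apply: contrapT => H.
have [M nM MU] : exists2 M, nbhs z M & forall w, M w -> ~ U w.
  move: ncz => /existsNP[M /not_implyP[nM h]]; exists M => // w Mw Uw.
  by apply: h; exists w.
have nN' : nbhs z (@neg R @^-1` N) by exact: neg_continuous.
have [w [Mw Nw] [Uw|Unw]] := U_dense (filterI nM nN'); first exact: (MU w).
by apply: H; exists (neg w).
Qed.

(* Otherwise [b] could be added to [U]. *)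
Let no_two_sided b u0 : Z b -> 0 < u0 ->
  ~ (forall u, 0 < `|u| < u0 -> U (chart b u)).
Proof.
move=> Zb u00 H.
have nUb : ~ U b by move=> h; apply: Zb; left.
have nUnb : ~ U (neg b) by move=> h; apply: Zb; right.
apply: nUb; have : U `|` [set b] `<=` U; last by apply; right.
apply: maxU; last by left.
  rewrite openE => w [Uw|->].
    by apply: (@filterS _ _ _ U); [by left|exact: open_nbhs_nbhs].
  apply: filterS (chart_near b u00) => _ [u uu ->].
  have [->|un0] := eqVneq u 0; first by rewrite chart0; right.
  by left; apply: H; rewrite normr_gt0 un0.
move=> w [Uw|->] [Uw'|].
- exact: (afU Uw).
- by move=> h; apply: nUnb; rewrite -h negK.
- by [].
- exact: neg_neq.
Qed.

(** One representative is chosen in each antipodal pair of [Z]. *)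
Let bs_ex : exists bs : seq S1, uniq (map rp bs) /\ forall z, psi bs z = 0 <-> Z z.
Proof.
have /finite_seqP[rs rsE] : finite_set (rp @` Z) by exact: finite_image.
pose us := undup rs; pose lift (a : RP1 R) : S1 := upper_arc (repr a : unit_itv R).
have rl a : rp (lift a) = a by rewrite rp_arc; exact: quot_proj_repr.
have E : map rp (map lift us) = us.
  by rewrite -map_comp -[RHS]map_id; apply: eq_map => a; exact: rl.
exists (map lift us); rewrite E undup_uniq; split => // z.
split=> [/psi_eq0|Zz].
  rewrite E mem_undup => h; have : (rp @` Z) (rp z) by rewrite rsE.
  move=> [w Zw /rp_eq[<-//|wz]].
  by rewrite -[z]negK -wz; exact: Z_neg.
apply/psi_eq0; rewrite E mem_undup.
have : (rp @` Z) (rp z) by exists z.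
by rewrite rsE.
Qed.

(** Around every point [U] is described by the sign of [psi] up to a local factor [e]; by
    connectedness of the circle this factor is global. *)
Lemma maxtame_sign_set : exists (bs : seq S1) e,
  [/\ uniq (map rp bs), odd (size bs), e = 1 \/ e = -1 & U = sign_set bs e].
Proof.
have [bs [ubs psiZ]] := bs_ex.
have UnZ z : psi bs z <> 0 -> U z \/ nU z.
  move=> pz; apply: contrapT => h; apply: pz; apply/psiZ => -[h'|h']; apply: h; auto.
(* Zeros of [psi] are exempted, so that the condition makes sense at points of [Z] too. *)
pose good e z := \forall w \near z, psi bs w <> 0 -> (U w <-> 0 < e * psi bs w).
have good_off z : psi bs z <> 0 -> good 1 z \/ good (-1) z.
  move=> pz; have [nn|nn] : (\forall w \near z, U w) \/ (\forall w \near z, nU w).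
    by case: (UnZ z pz) => h; [left|right]; exact: open_nbhs_nbhs.
  - move/eqP: pz; rewrite neq_lt => /orP[pz|pz]; [right|left].
      have n2 : \forall w \near z, psi bs w < 0 by exact: (cvgr_lt _ (@psi_continuous R bs z) _ pz).
      by move: nn n2; rewrite /good; apply: filterS2 => w Uw pw _; split => // _; rewrite mulN1r
        oppr_gt0.
    have n2 : \forall w \near z, 0 < psi bs w by exact: (cvgr_gt _ (@psi_continuous R bs z) _ pz).
    by move: nn n2; rewrite /good; apply: filterS2 => w Uw pw _; split => // _; rewrite mul1r.
  have nUw w : nU w -> ~ U w by move=> h h'; exact: (afU h').
  move/eqP: pz; rewrite neq_lt => /orP[pz|pz]; [left|right].
    have n2 : \forall w \near z, psi bs w < 0 by exact: (cvgr_lt _ (@psi_continuous R bs z) _ pz).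
    move: nn n2; rewrite /good; apply: filterS2 => w nUw' pw _; split => [/nUw//|].
    by rewrite mul1r => /(lt_trans pw); rewrite ltxx.
  have n2 : \forall w \near z, 0 < psi bs w by exact: (cvgr_gt _ (@psi_continuous R bs z) _ pz).
  move: nn n2; rewrite /good; apply: filterS2 => w nUw' pw _; split => [/nUw//|].
  by rewrite mulN1r oppr_gt0 => /(lt_trans pw); rewrite ltxx.
(* Each side of [z] lies entirely in [U] or in [nU]. Both sides in [U] contradict [no_two_sided] at
   [z], both in [nU] contradict it at the antipode; hence [U] switches exactly where [psi] does. *)
have good_at z : psi bs z = 0 -> good 1 z \/ good (-1) z.
  move=> pz; have Zz := iffLR (psiZ z) pz.
  have [c [c1 [u0 u00 H]]] := psi_crossing ubs pz.
  have off u : 0 < `|u| < u0 -> U (chart z u) \/ nU (chart z u).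
    move=> /andP[un uu]; apply: UnZ => h; have := H u uu; rewrite h sgr0 => /esym/eqP.
    have un0 : u != 0 by rewrite -normr_gt0.
    by rewrite mulf_eq0 sgr_eq0 (negbTE un0) orbF; case: c1 => ->; rewrite ?oppr_eq0 oner_eq0.
  have side (s : R) : s = 1 \/ s = -1 ->
    (forall u, 0 < s * u < u0 -> U (chart z u)) \/ (forall u, 0 < s * u < u0 -> nU (chart z u)).
    move=> s1; pose P := [set u : R | 0 < s * u < u0].
    have iP : is_interval P.
      move=> x y /andP[x0 xu] /andP[y0 yu] t /andP[xt ty].
      by rewrite /P /=; case: s1 x0 xu y0 yu => -> *; apply/andP; split; lra.
    have [|h|h] := sets_connected_or oU onU UnU (@chart_connected R P z iP).
    - move=> _ [u /andP[su0 suu] <-]; apply: off.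
      have -> : `|u| = s * u.
        by rewrite -[RHS]gtr0_norm// normrM; case: s1 => ->; rewrite ?normrN normr1 mul1r.
      by rewrite su0.
    - by left => u hu; apply: h; exists u.
    - by right => u hu; apply: h; exists u.
  have split_u u (Q : Prop) : 0 < `|u| < u0 ->
      (0 < 1 * u < u0 -> Q) -> (0 < -1 * u < u0 -> Q) -> Q.
    move=> /andP[un uu]; have [h|h|h] := ltrgt0P u.
    - by move=> q _; apply: q; rewrite mul1r h -(gtr0_norm h).
    - by move=> _; apply; rewrite mulN1r oppr_gt0 h -(ltr0_norm h).
    - by move: un; rewrite h normr0 ltxx.
  have [e [e1 He]] : exists e, (e = 1 \/ e = -1) /\ forall u, 0 < `|u| < u0 ->
      (U (chart z u) <-> 0 < e * u).
    have [pU|pn] := side 1 (or_introl erefl); have [mU|mn] := side (-1) (or_intror erefl).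
    - case: (no_two_sided Zz u00) => u hu.
      by apply: (split_u u _ hu) => h; [exact: pU|exact: mU].
    - exists 1; split; [by left|move=> u hu]; apply: (split_u u _ hu) => /[dup] h /andP[h0 _].
        by split => // _; exact: pU.
      split=> [Uu|]; last by rewrite mul1r; lra.
      by have := mn u h => /(afU Uu).
    - exists (-1); split; [by right|move=> u hu]; apply: (split_u u _ hu) => /[dup] h /andP[h0 _].
        split=> [Uu|]; last by rewrite mulN1r; lra.
        by have := pn u h => /(afU Uu).
      by split => // _; exact: mU.
    - case: (no_two_sided (Z_neg Zz) u00) => u hu; rewrite chart_neg.
      by apply: (split_u u _ hu) => h; [exact: pn|exact: mn].
  have gec : good (e * c) z.
    rewrite /good; apply: filterS (chart_near z u00) => _ [u uu ->] pn.
    have un : u != 0 by apply: contra_notN pn => /eqP ->; rewrite chart0.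
    rewrite (He u) ?normr_gt0 ?un// -[0 < e * c * _]sgr_gt0 -[0 < e * u]sgr_gt0 !sgrM H//.
    have cc : Num.sg c * c = 1.
      by case: c1 => ->; rewrite ?sgrN sgr1 ?mulrNN mulr1.
    by rewrite -[_ * _ * (c * _)]mulrA (mulrA (Num.sg c)) cc mul1r.
  by case: e1 gec => ->; case: c1 => -> gec; rewrite ?mulrNN ?mulr1 ?mul1r in gec; auto.
have good_open e : open [set z | good e z].
  by rewrite openE => z; exact: nbhs_interior.
have good_or z : good 1 z \/ good (-1) z.
  by have [/good_at|/eqP/good_off] := eqVneq (psi bs z) 0.
have good_not z : good 1 z -> good (-1) z -> False.
  move=> g1 g2; have [w [h1 h2] /eqP pw] := near_psi_neq0 ubs (filterI g1 g2).
  have := h1 pw; have := h2 pw; rewrite mulN1r mul1r oppr_gt0 => hn hp.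
  move/eqP: pw; rewrite neq_lt => /orP[pn|pp].
    by have := iffLR hp (iffRL hn pn) => /(lt_trans pn); rewrite ltxx.
  by have := iffLR hn (iffRL hp pp) => /(lt_trans pp); rewrite ltxx.
have [e [e1 He]] : exists e, (e = 1 \/ e = -1) /\ forall z, good e z.
  have [[z0 g0]|ng] := pselect (exists z, good 1 z); last first.
    exists (-1); split; [by right|move=> z].
    by have [g|//] := good_or z; exfalso; apply: ng; exists z.
  exists 1; split; [by left|].
  have cg : closed [set z | good 1 z].
    have -> : [set z | good 1 z] = ~` [set z | good (-1) z].
      apply/seteqP; split => z /=; first by move=> g g'; exact: (good_not z).
      by move=> ng; have [|/ng] := good_or z.
    exact: open_closedC.
  have E := @sphere_connected R 0 _ (ex_intro _ z0 g0)
    (ex_intro2 _ _ _ (good_open 1) (esym (setTI _))) (ex_intro2 _ _ _ cg (esym (setTI _))).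
  by move=> z; have : [set: S1] z by []; rewrite -E.
have UE z : psi bs z <> 0 -> (U z <-> 0 < e * psi bs z).
  by move=> pz; exact: (nbhs_singleton (He z)).
exists bs, e; split => //.
  have [z _ /eqP pz] := near_psi_neq0 ubs (filterT (F := nbhs (upper_arc (clamp (0 : R))))).
  (* An even number of factors would make [psi], and with it [U], symmetric under antipodes. *)
  apply/negPn/negP => ev.
  have pn : psi bs (neg z) = psi bs z by rewrite psi_neg -signr_odd (negbTE ev) mul1r.
  have pnz : psi bs (neg z) <> 0 by rewrite pn.
  have h : U z <-> U (neg z) by rewrite (UE z pz) (UE (neg z) pnz) pn.
  case: (UnZ z pz) => h'; first by apply: (afU h'); exact/h.
  by apply: (afU (iffRL h h')).
apply/seteqP; split => z; rewrite /sign_set /=.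
  move=> Uz; apply: (iffLR (UE z _) Uz) => /psiZ; apply; by left.
move=> h; apply: (iffRL (UE z _) h) => p0.
by move: h; rewrite p0 mulr0 ltxx.
Qed.

End Maxtame.
End MaxtameStructure.

(** * The boundary map and its two-point fibres *)

Section MaxtameFibres.
Variable R : realType.
Notation S1 := (sphere R 1).
Notation rp := (@circle_to_RP1 R).
Implicit Types (bs : seq S1) (e : R).

(** Replacing a representative by its antipode only changes the sign of one factor, so up to sign
    [psi] depends on the pairs alone. *)
Lemma psi_RP1 bs : exists e, (e = 1 \/ e = -1) /\ forall z,
  psi bs z = e * \prod_(a <- map rp bs) det (upper_arc (repr a : unit_itv R)) z.
Proof.
elim: bs => [|b bs [e [e1 H]]].
  by exists 1; split; [left|move=> z; rewrite /psi !big_nil mulr1].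
have : b = upper_arc (repr (rp b) : unit_itv R) \/ b = neg (upper_arc (repr (rp b) : unit_itv R)).
  by apply/rp_eq; rewrite rp_arc; apply/esym; exact: quot_proj_repr.
case=> bE; [exists e|exists (- e)]; (split;
  [by case: e1 => ->; rewrite ?opprK; auto|move=> z]); rewrite psi_cons H /= big_cons.
  by rewrite {1}bE; ring.
by rewrite {1}bE det_negl; ring.
Qed.

Lemma psi_perm bs bs' : perm_eq (map rp bs) (map rp bs') ->
  exists e, (e = 1 \/ e = -1) /\ forall z, psi bs z = e * psi bs' z.
Proof.
move=> p; have [e [e1 H]] := psi_RP1 bs; have [e' [e1' H']] := psi_RP1 bs'.
exists (e * e'); split.
  by case: e1 => ->; case: e1' => ->; rewrite ?mulrNN ?mulr1 ?mul1r; auto.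
move=> z; rewrite H H' (perm_big _ p) mulrA -(mulrA e).
have -> : e' * e' = 1 by case: e1' => ->; rewrite ?mulrNN mulr1.
by rewrite mulr1.
Qed.

Lemma enumeration k bs : uniq (map rp bs) -> size bs = k.*2.+1 ->
  exists x : 'I_k.*2.+1 -> RP1 R, injective x /\ range x = [set a | a \in map rp bs].
Proof.
move=> ubs sbs; exists (fun i => nth (RP1_base R) (map rp bs) i); split.
  move=> i j /eqP; rewrite nth_uniq ?size_map ?sbs ?ltn_ord// => /eqP ij.
  exact: val_inj.
apply/seteqP; split => [_ [i _ <-] /=|a /= abs]; first by rewrite mem_nth// size_map sbs.
have h : (index a (map rp bs) < k.*2.+1)%N by rewrite -sbs -(size_map rp) index_mem.
by exists (Ordinal h) => //=; rewrite nth_index.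
Qed.

Lemma sign_set_config (U : maxtames R) bs e k (x : 'I_k.*2.+1 -> RP1 R) :
  proj1_sig U = sign_set bs e -> uniq (map rp bs) -> (e = 1 \/ e = -1) ->
  injective x -> range x = [set a | a \in map rp bs] ->
  boundary_config U = Cinf_class x.
Proof.
move=> UE ubs e1 xi xE; rewrite /boundary_config UE sign_set_boundary//.
rewrite -(Cinf_of_setE xi) xE; congr Cinf_of_set.
apply/seteqP; split => [_ [z /psi_eq0 h <-]//|a /mapP[b bbs ->]].
by exists b => //; apply/psi_eq0; exact: map_f.
Qed.

Lemma maxtames_inj (U V : maxtames R) : proj1_sig U = proj1_sig V -> U = V.
Proof.
case: U V => [U hU] [V hV] /= UV; subst V; congr exist; exact: Prop_irrelevance.
Qed.

(** An injective representative of [c] yields the two sign sets of one [psi]. Any other maxtame set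
    over [c] has the same pairs, hence the same [psi] up to sign. *)
Lemma boundary_config_fibre (c : Cinf R) : exists U1 U2 : maxtames R,
  U1 <> U2 /\ forall U, boundary_config U = c <-> U = U1 \/ U = U2.
Proof.
have [k [t tc]] := config_surj c.
have [m [y [yi ty]]] := Cinf_normal_form (fun i => RP1_pt (t i)).
have cy' : c = Cinf_class y by rewrite -tc.
pose bs := [seq upper_arc (repr (y i) : unit_itv R) | i <- enum 'I_m.*2.+1].
have bsE : map rp bs = codom y.
  rewrite -map_comp; apply: eq_map => i /=; rewrite rp_arc; exact: quot_proj_repr.
have ubs : uniq (map rp bs) by rewrite bsE map_inj_uniq ?enum_uniq.
have sbs : size bs = m.*2.+1 by rewrite size_map size_enum_ord.
have obs : odd (size bs) by rewrite sbs /= odd_double.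
have yE : range y = [set a | a \in map rp bs].
  rewrite bsE; apply/seteqP; split => [_ [i _ <-] /=|a /codomP[i ->]]; first exact: codom_f.
  by exists i.
pose U1 : maxtames R := exist _ _ (sign_set_maxtame ubs obs (or_introl erefl)).
pose U2 : maxtames R := exist _ _ (sign_set_maxtame ubs obs (or_intror erefl)).
exists U1, U2; split.
  move=> U12; have := congr1 (@proj1_sig _ _) U12; rewrite /= => E.
  have [z _ z0] := near_psi_neq0 ubs (filterT (F := nbhs (upper_arc (clamp (0 : R))))).
  have : sign_set bs 1 z <-> sign_set bs (-1) z by rewrite E.
  rewrite /sign_set /= mul1r mulN1r oppr_gt0 => h.
  move: z0; rewrite neq_lt => /orP[/[dup] zn /h|/[dup] zp /h] h'.
    by have := lt_trans zn h'; rewrite ltxx.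
  by have := lt_trans zp h'; rewrite ltxx.
move=> U; split; last first.
  case=> ->; rewrite cy'; first by apply: (@sign_set_config U1 bs 1) => //; left.
  by apply: (@sign_set_config U2 bs (-1)) => //; right.
move=> Uc; have [bs' [e [ubs' obs' e1 UE]]] := maxtame_sign_set (proj2_sig U).
have sbs' : size bs' = (size bs')./2.*2.+1 by rewrite -{1}(odd_double_half (size bs')) obs'.
have [x [xi xE]] := enumeration ubs' sbs'.
have Ux := sign_set_config UE ubs' e1 xi xE.
have xy : range x = range y.
  by apply: sim_Cinf_class => //; apply: sim_Cinf; rewrite -Ux Uc.
have p : perm_eq (map rp bs') (map rp bs).
  apply: uniq_perm => // a; have : (range x) a = (range y) a by rewrite xy.
  by rewrite xE yE /= => h; apply/idP/idP; rewrite h.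
have [e' [e1' H]] := psi_perm p.
have UE' : proj1_sig U = sign_set bs (e * e').
  by rewrite UE; apply/seteqP; split => z; rewrite /sign_set /= H mulrA.
have : e * e' = 1 \/ e * e' = -1.
  by case: e1 => ->; case: e1' => ->; rewrite ?mulrNN ?mulr1 ?mul1r; auto.
by case=> E; [left|right]; apply: maxtames_inj; rewrite UE' E.
Qed.

End MaxtameFibres.

(** The points of each fibre are matched by arbitrary choice; no continuity is required, because the
    topology will be transported along the bijection. *)
Lemma two_point_fibres_bijection (X Z C : Type) (f : X -> C) (g : Z -> C) :
  (forall c, exists x1 x2, x1 <> x2 /\ forall x, f x = c <-> x = x1 \/ x = x2) ->
  (forall c, exists z1 z2, z1 <> z2 /\ forall z, g z = c <-> z = z1 \/ z = z2) ->
  exists (h : X -> Z) (h' : Z -> X), [/\ cancel h h', cancel h' h & forall x, g (h x) = f x].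
Proof.
move=> /choice[x1 /choice[x2 fE]] /choice[z1 /choice[z2 gE]].
pose h x := if pselect (x = x1 (f x)) then z1 (f x) else z2 (f x).
pose h' z := if pselect (z = z1 (g z)) then x1 (g z) else x2 (g z).
have gh x : g (h x) = f x.
  have [_ gx] := gE (f x); rewrite /h.
  by case: pselect => e0; [apply/gx; left|apply/gx; right].
have fh z : f (h' z) = g z.
  have [_ fz] := fE (g z); rewrite /h'.
  by case: pselect => e0; [apply/fz; left|apply/fz; right].
exists h, h'; split => // [x|z].
- rewrite /h' gh; have [ne fe] := fE (f x); have [ne' ge] := gE (f x).
  rewrite /h; case: (pselect (x = x1 (f x))) => [e|n]; case: pselect => e'//.
    by case/fe: (erefl (f x)) => [h0|h0]; [case: (n h0)|case: ne'].
  by case/fe: (erefl (f x)) => [h0|h0]; [case: (n h0)|].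
- rewrite /h fh; have [ne fe] := fE (g z); have [ne' ge] := gE (g z).
  rewrite /h'; case: (pselect (z = z1 (g z))) => [e|n]; case: pselect => e'//.
    by case/ge: (erefl (g z)) => [h0|h0]; [case: (n h0)|case: ne].
  by case/ge: (erefl (g z)) => [h0|h0]; [case: (n h0)|].
Qed.

Lemma maxtames_topology_exists (R : realType) :
  exists tau : topology_on (maxtames R),
    connected_double_covering (@boundary_config R : with_topology tau -> Cinf R).
Proof.
have [q [nu [[cnu nuK nu_free] q_surj q_eq q_open]]] := sphere_double_covers_configurations R.
have q_fibre (c : Cinf R) : exists z1 z2, z1 <> z2 /\ forall z, q z = c <-> z = z1 \/ z = z2.
  have [x xc] := q_surj c; exists x, (nu x); split.
    by have [U [_ Ux Un]] := nu_free x => h; apply: (Un x Ux); rewrite -h.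
  move=> z; rewrite -xc; split; first by move=> /esym/q_eq.
  by move=> h; apply/esym/q_eq.
have [h [h' [hK h'K qh]]] := two_point_fibres_bijection (@boundary_config_fibre R) q_fibre.
(* The initial topology along the bijection [h] makes it a homeomorphism over the configurations. *)
pose tau : topology_on (maxtames R) :=
  Topological.class (initial_topology (h : {classic maxtames R} -> sphere_infty R)).
exists tau.
pose hT : with_topology tau -> sphere_infty R := h.
pose hT' : sphere_infty R -> with_topology tau := h'.
have ch : continuous hT by exact: initial_continuous.
have ch' : continuous hT'.
  apply: (@continuous_comp_initial {classic maxtames R} _ _ h).
  have -> : h \o h' = id by apply/funext => z; exact: h'K.
  by move=> z; exact: cvg_id.
have bE (U : maxtames R) : boundary_config U = q (h U) by rewrite qh.
split; last first.
  have -> : [set: with_topology tau] = range hT'.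
    by apply/seteqP; split => // U _; exists (h U) => //; exact: hK.
  apply: connected_continuous_connected; first exact: Soo_connected.
  exact: continuous_subspaceT.
apply: (@quotient_by_involution_double_covering (with_topology tau) (Cinf R) _ (hT' \o nu \o hT)).
- move=> U; apply: (@continuous_comp (with_topology tau) (sphere_infty R) _ (nu \o hT)); last
  exact: ch'.
  by apply: continuous_comp; [exact: ch|exact: cnu].
- by move=> U; rewrite /= /hT /hT' h'K nuK hK.
- move=> U; have [N [oN Nx Nnu]] := nu_free (h U); exists (hT @^-1` N); split => //.
    by apply: open_comp => // V _; exact: ch.
  by move=> V NV; rewrite /preimage /= /hT /hT' h'K; exact: Nnu.
- move=> c; have [z zc] := q_surj c; exists (h' z); by rewrite bE h'K.
- move=> U V; rewrite !bE; split=> [/q_eq[E|E]|[->//|->]].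
  + by left; rewrite -[V]hK E hK.
  + by right; rewrite -[V]hK E.
  + by rewrite /= /hT /hT' h'K; apply/q_eq; right.
move=> V; split=> [/q_open oV|oV].
  have -> : @boundary_config R @^-1` V = hT @^-1` (q @^-1` V).
    by apply/seteqP; split => U; rewrite /preimage /= bE.
  by apply: open_comp => // U _; exact: ch.
apply/q_open; have -> : q @^-1` V = hT' @^-1` (@boundary_config R @^-1` V).
  by apply/seteqP; split => z; rewrite /preimage /= /hT' bE h'K.
by apply: open_comp => // z _; exact: ch'.
Qed.

(** The topology is characterised by the covering property: the first half shows that such a
    topology exists, the second that every such topology gives the infinite sphere. *)
Theorem lemma5p1 (R : realType) :
  (exists tau : topology_on (maxtames R),
     connected_double_covering
       (@boundary_config R : with_topology tau -> Cinf R)) /\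
  (forall tau : topology_on (maxtames R),
     connected_double_covering
       (@boundary_config R : with_topology tau -> Cinf R) ->
     homeomorphic (with_topology tau) (sphere_infty R)).
Proof.
split; first exact: maxtames_topology_exists.
by move=> tau [cov conn]; exact: covering_homeomorphic cov conn.
Qed.
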